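(* Let $H_k=H_k(\nu,\mu,q)$ be the functions of $(\nu,\mu,q)\in\mathfrak h_{\mathrm{reg}}\times\mathfrak h^*\times(Q_m)^n$ obtained by substituting $$(v_i)_j=(\varphi_j)_i,\qquad (w_i)_j=(\psi_j)_i,$$ $$(Y_i)_{jj}=\mu_j+\frac1{\nu_j}\sum_{r=0}^i\big(\lambda_r+(\psi_j\varphi_j)_{rr}\big)+\frac1{\nu_j}\sum_{r=0}^{m-1}\frac{r-m}m\big(\lambda_r+(\psi_j\varphi_j)_{rr}\big),$$ $$(Y_i)_{jk}=-\sum_{l=0}^{m-1}\frac{(\psi_k\varphi_j)_{i-l,i-l}\,\nu_j^l\nu_k^{m-l-1}}{\nu_j^m-\nu_k^m}\quad(j\ne k)$$ ($i=0,\dots,m-1$) into $$H_k=-\sum_{i\in I}w_iY_iY_{i+1}\cdots Y_{i+k-1}v_{i+k}.$$ Then $H_k$ with $k=1,\dots,mn$ are functionally independent, Poisson commuting functions and hence define a completely integrable system. The Hamiltonian flows defined by the $H_k$ extend from $\big(\mathfrak h_{\mathrm{reg}}\times\mathfrak h^*\times(Q_m)^n\big)/G$ to produce complete flows on the Calogero--Moser space $\mathcal C_{n,\lambda}$.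
   Context: Fix $m,n\ge1$, a primitive $m$-th root of unity $\mu$ (without index; $\mu_1,\dots,\mu_n$ are complex coordinates), $I=\mathbb Z/m\mathbb Z=\{0,\dots,m-1\}$ (indices mod $m$), $\lambda\in\mathbb C^m$, $|\lambda|=\sum_i\lambda_i$, with $\lambda$ assumed regular: $|\lambda|\ne0$ and $\lambda_i+\dots+\lambda_{j-1}\neq N|\lambda|$ for all $N\in\mathbb Z$, $1\le i<j\le m$. **Phase space.** $\mathfrak h=\mathbb C^n$, $\mathfrak h_{\mathrm{reg}}=\{\nu\in\mathfrak h:\prod_i\nu_i\prod_{i<j}(\nu_i^m-\nu_j^m)\neq0\}$, $\mu=(\mu_1,\dots,\mu_n)\in\mathfrak h^*$, $q=(q_1,\dots,q_n)$, where $q_j$ is the class of $(\varphi_j,\psi_j)$ in $$Q_m=\{(\varphi,\psi)\in(\mathbb C^m)^*\oplus\mathbb C^m:\varphi\psi=-|\lambda|\}/\mathbb C^\times,$$ $\mathbb C^\times$ acting by $(\varphi,\psi)\mapsto(d\varphi,d^{-1}\psi)$; $\varphi_j$ are rows, $\psi_j$ columns, with entries indexed by $I$. The symplectic form on $\mathfrak h_{\mathrm{reg}}\times\mathfrak h^*\times(Q_m)^n$ is $\sum_{j=1}^n(m\,\mathrm d\mu_j\wedge\mathrm d\nu_j-\mathrm d\varphi_j\wedge\mathrm d\psi_j)$, with $\mathrm d\varphi_j\wedge\mathrm d\psi_j$ understood as the symplectic form on $Q_m$ reduced from $\sum_{r}\mathrm d\varphi_{j,r}\wedge\mathrm d\psi_{j,r}$.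 **Calogero--Moser space.** Let $V_i=\mathbb C^n$ and let $R$ be the space of collections $X_i:V_i\to V_{i+1}$, $Y_i:V_{i+1}\to V_i$, $v_i:\mathbb C\to V_i$, $w_i:V_i\to\mathbb C$ ($i\in I$), with symplectic form $\sum_i(\mathrm{tr}(\mathrm dY_i\wedge\mathrm dX_i)+\mathrm dw_i\wedge\mathrm dv_i)$. $\mathcal C_{n,\lambda}$ is the quotient of $\{Y_iX_i-X_{i-1}Y_{i-1}-v_iw_i=\lambda_i1_{V_i},\ i\in I\}\subset R$ by $\prod_i\mathrm{GL}(V_i)$, with the symplectic form given by Hamiltonian reduction. The map sending $(\nu,\mu,q)$ to the class of $X_i=\mathrm{diag}(\nu_1,\dots,\nu_n)$ and $Y_i,v_i,w_i$ as in the claim identifies $(\mathfrak h_{\mathrm{reg}}\times\mathfrak h^*\times(Q_m)^n)/G$ with the open subset $\mathcal C'_{n,\lambda}\subset\mathcal C_{n,\lambda}$ where $X_{m-1}\cdots X_0$ has distinct non-zero eigenvalues, compatibly with symplectic forms. Here $G=S_n\ltimes(\mathbb Z_m)^n$: $S_n$ simultaneously permutes $\{\nu_j\},\{\mu_j\},\{q_j\}$, and $(r_1,\dots,r_n)\in(\mathbb Z_m)^n$ replaces $\nu_j,\mu_j,\varphi_j,\psi_j$ by $\mu^{r_j}\nu_j,\mu^{-r_j}\mu_j,\varphi_jE^{r_j},E^{-r_j}\psi_j$, where $E=\mathrm{diag}(1,\mu,\mu^2,\dots,\mu^{m-1})$. *)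

(* Defs.v *)
From HB Require Import structures.
From mathcomp Require Import all_boot all_order all_algebra perm.
From mathcomp Require Import all_classical all_reals all_analysis.
From mathcomp Require Export complex.
From mathcomp Require Import ring.

Set Implicit Arguments.
Unset Strict Implicit.
Unset Printing Implicit Defensive.

Import Order.TTheory GRing.Theory Num.Theory.
Import numFieldNormedType.Exports.

Local Open Scope classical_set_scope.
Local Open Scope ring_scope.
Local Open Scope quotient_scope.

(** Level sets [L : set V] carry the subspace topology (library instance on
    [set_type L]), their quotients the quotient topology. *)
Definition orbit_space (V : topologicalType) (L : set V) (e : equiv_rel L) :=
  quotient_topology {eq_quot e}.

Definition level_point (T : Type) (L : set T) (x : T) (Lx : L x) : L :=
  exist _ x (mem_set Lx).

Section HolomorphicStructure.

Context {C : numClosedFieldType} {V : normedModType C}.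
Context {L : set V} {e : equiv_rel L}.
Local Notation Q := (orbit_space e).

(** A function on the quotient of a complex submanifold [L] of [V] is
    holomorphic when its pullback to [L] extends, locally around each point, to
    a holomorphic function on [V].  ([differentiable] is Frechet
    differentiability over the complex scalars [C].) *)
Definition holomorphic_on (U : set Q) (f : Q -> C) :=
  forall x : L, U (\pi_Q x) -> exists F : V -> C,
    (\forall y \near val x, differentiable F y) /\
    (\forall y \near x, F (val y) = f (\pi_Q y)).

Definition holomorphic_on_time (U : set (C * Q)) (f : C * Q -> C) :=
  forall (t : C) (x : L), U (t, \pi_Q x) -> exists F : C * V -> C,
    (\forall y \near (t, val x), differentiable F y) /\
    (\forall s \near t & y \near x, F (s, val y) = f (s, \pi_Q y)).

(** A complete flow is a holomorphic action of the additive group [C]: a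
    continuous map pulling local holomorphic functions back to holomorphic
    functions. *)
Definition complete_flow (Phi : C -> Q -> Q) :=
  [/\ forall q, Phi 0 q = q,
      forall s t q, Phi (s + t) q = Phi s (Phi t q),
      continuous (fun p : C * Q => Phi p.1 p.2) &
      forall (U : set Q) (f : Q -> C), open U -> holomorphic_on U f ->
        holomorphic_on_time [set p | U (Phi p.1 p.2)]
                            (fun p => f (Phi p.1 p.2))].

End HolomorphicStructure.

(** The quotient of the level set [L] of [mom] is the Hamiltonian reduction of
    [V] with the constant symplectic form [omega].  Its tangent space at the
    class of [x] is [tangent x] modulo [radical x]; the vectors tangent to the
    orbit of [x] are those in the radical of [omega] on [tangent x].  Vectors
    and covectors of the quotient are represented by vectors of [V] tangent to
    [L] and by functions on them. *)
Section Reduction.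

Context {C : numClosedFieldType} {V W : normedModType C}.
Context {L : set V} {e : equiv_rel L}.
Variables (mom : V -> W) (omega : V -> V -> C).
Local Notation Q := (orbit_space e).

Definition tangent (x : L) : set V := [set h | 'd mom (val x) h = 0].

Definition radical (x : L) : set V :=
  [set h | tangent x h /\ forall h', tangent x h' -> omega h h' = 0].

Definition reduced_dim (x : L) (d : nat) :=
  exists b : 'I_d -> V, (forall i, tangent x (b i)) /\
    forall h, tangent x h ->
      exists! a : 'rV[C]_d, radical x (h - \sum_i a ord0 i *: b i).

Definition differential_at (f : Q -> C) (x : L) (l : V -> C) :=
  exists F : V -> C,
    [/\ differentiable F (val x),
        \forall y \near x, F (val y) = f (\pi_Q y) &
        forall h, tangent x h -> l h = 'd F (val x) h].

(** Sign convention: [omega(X_f, .) = - df], so that [dp /\ dq] gives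
    [q' = df/dp] and [p' = - df/dq]. *)
Definition hamiltonian_vector (f : Q -> C) (x : L) (xi : V) :=
  tangent x xi /\ exists2 l, differential_at f x l &
    forall h, tangent x h -> omega xi h = - l h.

(** [poisson_bracket f g x c]: the bracket of [f] and [g] at the class of [x]
    exists and equals [c]. *)
Definition poisson_bracket (f g : Q -> C) (x : L) (c : C) :=
  exists xi eta, [/\ hamiltonian_vector f x xi, hamiltonian_vector g x eta &
                     c = omega xi eta].

Definition poisson_commute (f g : Q -> C) :=
  forall x : L, poisson_bracket f g x 0.

Definition independent_at (N : nat) (f : 'I_N -> Q -> C) (x : L) :=
  exists l : 'I_N -> V -> C, (forall k, differential_at (f k) x (l k)) /\
    forall a : 'I_N -> C,
      (forall h, tangent x h -> \sum_k a k * l k h = 0) -> forall k, a k = 0.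

Definition functionally_independent (N : nat) (f : 'I_N -> Q -> C) :=
  exists U : set Q, [/\ open U, dense U &
    forall x : L, U (\pi_Q x) -> independent_at f x].

Definition completely_integrable (N : nat) (f : 'I_N -> Q -> C) :=
  [/\ forall x : L, reduced_dim x (2 * N),
      forall k l, poisson_commute (f k) (f l) &
      functionally_independent f].

(** Curves in the quotient are represented by lifts to [L]. *)
Definition integral_curve (f : Q -> C) (D : set C) (g : C -> L) :=
  forall t, D t -> exists2 xi, hamiltonian_vector f (g t) xi &
    is_derive t (1 : C) (fun s => val (g s)) xi.

End Reduction.

Section CyclicQuiver.

Context {C : numClosedFieldType} {m n : nat}.
Implicit Types (lam : 'I_m -> C) (zeta : C).

Definition regular_weight lam :=
  \sum_r lam r != 0 /\
  forall (i j : nat) (N : int), (1 <= i)%N -> (i < j)%N -> (j <= m)%N ->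
    \sum_(r < m | (i <= r < j)%N) lam r != (\sum_r lam r) *~ N.

(** [(nu, mu, phi, psi)], the rows of [phi] being the [phi_j] and the columns
    of [psi] the [psi_j]. *)
Definition phase_vector :=
  ('rV[C]_n * 'rV[C]_n * 'M[C]_(n, m) * 'M[C]_(m, n))%type.

Definition nu (x : phase_vector) (j : 'I_n) : C := x.1.1.1 ord0 j.
Definition mu (x : phase_vector) (j : 'I_n) : C := x.1.1.2 ord0 j.
Definition phi (x : phase_vector) (j : 'I_n) (r : 'I_m) : C := x.1.2 j r.
Definition psi (x : phase_vector) (r : 'I_m) (j : 'I_n) : C := x.2 r j.

Definition hreg (x : phase_vector) :=
  (\prod_j nu x j) *
  \prod_(j < n) \prod_(k < n | (j < k)%N) (nu x j ^+ m - nu x k ^+ m) != 0.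

Definition phase_moment (x : phase_vector) : 'rV[C]_n :=
  \row_j \sum_r phi x j r * psi x r j.

Definition phase_level lam : set phase_vector :=
  [set x | hreg x /\ phase_moment x = const_mx (- \sum_r lam r)].

(** [sum_j (m dmu_j /\ dnu_j - sum_r dphi_(j,r) /\ dpsi_(r,j))], with
    [(da /\ db)(h, h') = a(h) b(h') - a(h') b(h)]. *)
Definition phase_form (h h' : phase_vector) : C :=
  \sum_j (m%:R * (mu h j * nu h' j - mu h' j * nu h j)
          - \sum_r (phi h j r * psi h' r j - phi h' j r * psi h r j)).

Definition rescale (d : 'I_n -> C) (x : phase_vector) : phase_vector :=
  (x.1.1.1, x.1.1.2, \matrix_(j, r) (d j * phi x j r),
   \matrix_(r, j) ((d j)^-1 * psi x r j)).

Definition same_phase lam : rel (phase_level lam) :=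
  fun x y => `[< exists2 d : 'I_n -> C, forall j, d j != 0 &
                 val y = rescale d (val x) >].

Lemma rescale1 x : rescale (fun=> 1) x = x.
Proof.
case: x => [[[a b] c] d]; rewrite /rescale /phi /psi /=.
by congr (_, _, _, _); apply/matrixP => i j; rewrite mxE ?invr1 mul1r.
Qed.

Lemma rescaleM d d' x :
  rescale d (rescale d' x) = rescale (fun j => d j * d' j) x.
Proof.
rewrite /rescale /phi /psi /=.
by congr (_, _, _, _); apply/matrixP => i j; rewrite !mxE mulrA ?invfM.
Qed.

Lemma same_phase_refl lam : reflexive (@same_phase lam).
Proof.
move=> x; apply/asboolP; exists (fun=> 1) => [j|]; first exact: oner_neq0.
by rewrite rescale1.
Qed.

Lemma same_phase_sym lam : symmetric (@same_phase lam).
Proof.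
suff H x y : same_phase x y -> @same_phase lam y x.
  by move=> x y; apply/idP/idP; exact: H.
move=> /asboolP[d d0 E]; apply/asboolP; exists (fun j => (d j)^-1).
  by move=> j; rewrite invr_eq0.
rewrite E rescaleM -[LHS]rescale1; congr rescale.
by apply/funext => j; rewrite mulVf.
Qed.

Lemma same_phase_trans lam : transitive (@same_phase lam).
Proof.
move=> y x z /asboolP[d d0 E] /asboolP[d' d'0 E']; apply/asboolP.
exists (fun j => d' j * d j) => [j|]; first by rewrite mulf_neq0.
by rewrite E' E rescaleM.
Qed.

Canonical same_phase_equiv lam :=
  EquivRel (@same_phase lam) (@same_phase_refl lam) (@same_phase_sym lam)
    (@same_phase_trans lam).

(** [h_reg * h^* * (Q_m)^n], the [n] quotients by [C^*] being taken at once. *)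
Definition phase_space lam := orbit_space (same_phase_equiv lam).

Definition phase_class lam (x : phase_level lam) : phase_space lam :=
  \pi_(phase_space lam) x.

(** [(X, Y, v, w)]: the [i]-th rows are [X_i] and [Y_i] (flattened by [mxvec]),
    the transpose of the column [v_i], and the row [w_i]. *)
Definition cm_vector :=
  ('M[C]_(m, n * n) * 'M[C]_(m, n * n) * 'M[C]_(m, n) * 'M[C]_(m, n))%type.

Definition cmX (z : cm_vector) (i : 'I_m) : 'M[C]_n := vec_mx (row i z.1.1.1).
Definition cmY (z : cm_vector) (i : 'I_m) : 'M[C]_n := vec_mx (row i z.1.1.2).
Definition cmv (z : cm_vector) (i : 'I_m) : 'cV[C]_n := (row i z.1.2)^T.
Definition cmw (z : cm_vector) (i : 'I_m) : 'rV[C]_n := row i z.2.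

Definition mk_cm (X Y : 'I_m -> 'M[C]_n) (v : 'I_m -> 'cV[C]_n)
    (w : 'I_m -> 'rV[C]_n) : cm_vector :=
  (\matrix_i mxvec (X i), \matrix_i mxvec (Y i), \matrix_i (v i)^T,
   \matrix_i w i).

Definition cm_level lam : set cm_vector :=
  [set z | forall i : 'I_m,
    cmY z i *m cmX z i - cmX z (ord_pred i) *m cmY z (ord_pred i)
      - cmv z i *m cmw z i = (lam i)%:M].

Definition gauge (g : 'I_m -> 'M[C]_n) (z : cm_vector) : cm_vector :=
  mk_cm (fun i => g (ordS i) *m cmX z i *m invmx (g i))
        (fun i => g i *m cmY z i *m invmx (g (ordS i)))
        (fun i => g i *m cmv z i)
        (fun i => cmw z i *m invmx (g i)).

Definition same_cm lam : rel (cm_level lam) :=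
  fun y z => `[< exists2 g : 'I_m -> 'M[C]_n, forall i, g i \in unitmx &
                 val z = gauge g (val y) >].

Lemma cmXK X Y v w : cmX (mk_cm X Y v w) = X.
Proof. by apply/funext => i; rewrite /cmX rowK mxvecK. Qed.
Lemma cmYK X Y v w : cmY (mk_cm X Y v w) = Y.
Proof. by apply/funext => i; rewrite /cmY rowK mxvecK. Qed.
Lemma cmvK X Y v w : cmv (mk_cm X Y v w) = v.
Proof. by apply/funext => i; rewrite /cmv rowK trmxK. Qed.
Lemma cmwK X Y v w : cmw (mk_cm X Y v w) = w.
Proof. by apply/funext => i; rewrite /cmw rowK. Qed.
Definition cmE := (cmXK, cmYK, cmvK, cmwK).

Lemma mk_cmK z : mk_cm (cmX z) (cmY z) (cmv z) (cmw z) = z.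
Proof.
case: z => [[[a b] c] d]; rewrite /mk_cm /cmX /cmY /cmv /cmw /=.
by congr (_, _, _, _); apply/row_matrixP => i; rewrite rowK ?vec_mxK ?trmxK.
Qed.

Lemma gauge1 z : gauge (fun=> 1%:M) z = z.
Proof.
rewrite -[RHS]mk_cmK /gauge.
by congr mk_cm; apply/funext => i; rewrite ?invmx1 ?mul1mx ?mulmx1.
Qed.

Lemma invmxM (a b : 'M[C]_n) : a \in unitmx -> b \in unitmx ->
  invmx (a *m b) = invmx b *m invmx a.
Proof.
move=> ua ub; have uab : a *m b \in unitmx by rewrite unitmx_mul ua.
apply: (can_inj (mulKmx uab)); rewrite mulmxV// -mulmxA (mulmxA b) mulmxV//.
by rewrite mul1mx mulmxV.
Qed.

Lemma gaugeM g g' z : (forall i, g i \in unitmx) ->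
  (forall i, g' i \in unitmx) ->
  gauge g (gauge g' z) = gauge (fun i => g i *m g' i) z.
Proof.
move=> ug ug'; rewrite /gauge !cmE.
by congr mk_cm; apply/funext => i; rewrite ?invmxM// !mulmxA.
Qed.

Lemma same_cm_refl lam : reflexive (@same_cm lam).
Proof.
move=> z; apply/asboolP; exists (fun=> 1%:M) => [i|]; first exact: unitmx1.
by rewrite gauge1.
Qed.

Lemma same_cm_sym lam : symmetric (@same_cm lam).
Proof.
suff H y z : same_cm y z -> @same_cm lam z y.
  by move=> y z; apply/idP/idP; exact: H.
move=> /asboolP[g ug E]; apply/asboolP; exists (fun i => invmx (g i)).
  by move=> i; rewrite unitmx_inv.
rewrite E gaugeM//; last by move=> i; rewrite unitmx_inv.
by rewrite -[LHS]gauge1; congr gauge; apply/funext => i; rewrite mulVmx.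
Qed.

Lemma same_cm_trans lam : transitive (@same_cm lam).
Proof.
move=> y x z /asboolP[g ug E] /asboolP[g' ug' E']; apply/asboolP.
exists (fun i => g' i *m g i) => [i|]; first by rewrite unitmx_mul ug' ug.
by rewrite E' E gaugeM.
Qed.

Canonical same_cm_equiv lam :=
  EquivRel (@same_cm lam) (@same_cm_refl lam) (@same_cm_sym lam)
    (@same_cm_trans lam).

Definition cm_space lam := orbit_space (same_cm_equiv lam).

(** [diag_entry x j k r] is [(psi_j phi_k)_(r,r)]. *)
Definition diag_entry (x : phase_vector) (j k : 'I_n) (r : 'I_m) : C :=
  psi x r j * phi x k r.

Definition Y_diag lam (x : phase_vector) (i : 'I_m) (j : 'I_n) : C :=
  mu x j
  + (nu x j)^-1 * \sum_(r < m | (r <= i)%N) (lam r + diag_entry x j j r)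
  + (nu x j)^-1 *
      \sum_(r < m) (r%:R - m%:R) / m%:R * (lam r + diag_entry x j j r).

(** [iter l ord_pred i] is the index [i - l] modulo [m]. *)
Definition Y_offdiag (x : phase_vector) (i : 'I_m) (j k : 'I_n) : C :=
  - \sum_(l < m)
      diag_entry x k j (iter l (@ord_pred m) i)
      * nu x j ^+ l * nu x k ^+ (m - l - 1) / (nu x j ^+ m - nu x k ^+ m).

Definition cm_point lam (x : phase_vector) : cm_vector :=
  mk_cm (fun=> diag_mx (\row_j nu x j))
        (fun i => \matrix_(j, k) if j == k then Y_diag lam x i j
                                 else Y_offdiag x i j k)
        (fun i => \col_j phi x j i)
        (fun i => \row_j psi x i j).

(** [H_k = - sum_i w_i Y_i Y_(i+1) ... Y_(i+k-1) v_(i+k)]. *)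
Definition cm_hamiltonian (k : nat) (z : cm_vector) : C :=
  - \sum_(i < m)
      (cmw z i *m (\prod_(0 <= l < k) cmY z (iter l (@ordS m) i))
         *m cmv z (iter k (@ordS m) i)) ord0 ord0.

Definition hamiltonian lam (k : nat) (p : phase_space lam) : C :=
  cm_hamiltonian k (cm_point lam (val (repr p))).

Lemma iter_ordSE l (i : 'I_m) : iter l (@ordS m) i = ((i + l) %% m)%N :> nat.
Proof.
elim: l => [|l IH] /=; first by rewrite addn0 modn_small.
by rewrite IH addnS -addn1 modnDml addn1.
Qed.

Lemma iter_ord_pred_m (i : 'I_m) : iter m (@ord_pred m) i = i.
Proof.
have SK l (j : 'I_m) : iter l (@ord_pred m) (iter l (@ordS m) j) = j.
  by elim: l j => // l IH j; rewrite iterSr iterS ordSK IH.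
rewrite -[RHS](SK m); congr (iter m _ _); apply/val_inj => /=.
by rewrite iter_ordSE modnDr modn_small.
Qed.

Lemma hregP (x : phase_vector) :
  reflect ((forall j, nu x j != 0) /\
           (forall j k, j != k -> nu x j ^+ m - nu x k ^+ m != 0)) (hreg x).
Proof.
rewrite /hreg mulf_eq0 negb_or; apply: (iffP andP) => -[H1 H2].
  split=> [j|j k]; first by move/prodf_neq0: H1; exact.
  have H (a b : 'I_n) : (a < b)%N -> nu x a ^+ m - nu x b ^+ m != 0.
    by move=> ab; move/prodf_neq0: H2 => /(_ a isT) /prodf_neq0; exact.
  rewrite neq_ltn => /orP[|kj]; first exact: H.
  by rewrite -oppr_eq0 opprB; exact: H.
split; first by apply/prodf_neq0 => j _.
apply/prodf_neq0 => j _; apply/prodf_neq0 => k jk; apply: H2.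
by rewrite neq_ltn jk.
Qed.

Lemma cm_point_level lam x :
  phase_level lam x -> cm_level lam (cm_point lam x : cm_vector).
Proof.
move=> [/hregP[nu0 nuD] mom] i; rewrite /cm_point !cmE.
apply/matrixP => j k; rewrite mul_mx_diag mul_diag_mx !mxE big_ord1 !mxE.
case: eqVneq => [<-{k}|jk]; last first.
  rewrite mulr0n /Y_offdiag; have D0 := nuD _ _ jk.
  set D := nu x j ^+ m - nu x k ^+ m in D0 *; have ED : D = nu x j ^+ m - nu x k ^+ m by [].
  clearbody D.
  pose T l := diag_entry x k j (iter l (@ord_pred m) i)
                * nu x j ^+ l * nu x k ^+ (m - l).
  have -> : \sum_(l < m) diag_entry x k j (iter l (@ord_pred m) i)
      * nu x j ^+ l * nu x k ^+ (m - l - 1) / D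
      = (\sum_(l < m) T l) / (nu x k * D).
    rewrite mulr_suml; apply: eq_bigr => l _; rewrite /T.
    have E : (m - l = (m - l - 1).+1)%N by rewrite subn1 prednK// subn_gt0.
    rewrite [in RHS]E exprSr; move: (_ ^+ (m - l - 1)) (_ ^+ l) => u u'.
    by field; rewrite ?nu0 ?D0.
  have -> : \sum_(l < m) diag_entry x k j (iter l (@ord_pred m) (ord_pred i))
      * nu x j ^+ l * nu x k ^+ (m - l - 1) / D
      = (\sum_(l < m) T l.+1) / (nu x j * D).
    rewrite mulr_suml; apply: eq_bigr => l _; rewrite /T iterSr.
    rewrite (_ : (m - l.+1 = m - l - 1)%N) ?exprS; last by rewrite subn1 -subnS.
    move: (_ ^+ (m - l - 1)) (_ ^+ l) => u u'.
    by field; rewrite ?nu0 ?D0.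
  have : \sum_(l < m) T l.+1 - \sum_(l < m) T l = T m - T 0%N.
    by rewrite -sumrB -(big_mkord xpredT (fun l => T l.+1 - T l)) telescope_sumr.
  rewrite /T subnn iter_ord_pred_m subn0 /diag_entry /= => /(canRL (subrK _)) ->.
  have -> : nu x j ^+ m = D + nu x k ^+ m by rewrite ED subrK.
  by field; rewrite D0 !nu0.
rewrite mulr1n /Y_diag.
pose a r := lam r + diag_entry x j j r.
have a0 : \sum_r a r = 0.
  rewrite big_split /=; move/rowP: mom => /(_ j); rewrite !mxE => E.
  rewrite (_ : \sum_(r < m) diag_entry x j j r = - \sum_r lam r) ?subrr//.
  by rewrite -E; apply: eq_bigr => r _; rewrite mulrC.
set S1 := \sum_(r < m | (r <= i)%N) _; set S2 := \sum_(r < m | (r <= _)%N) _.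
have ES : S1 - S2 = a i.
  rewrite /S1 -/(a _) (bigD1 i) //=.
  rewrite (eq_bigl (fun r : 'I_m => (r < i)%N)); last first.
    by move=> r; rewrite ltn_neqAle andbC.
  rewrite /S2 /=; case: (posnP i) => [i0|i0].
    rewrite [X in a i + X]big1 => [|r]; last by rewrite i0.
    rewrite [X in _ - X](eq_bigl xpredT) ?a0 ?subr0 ?addr0// => r.
    have m0 : (0 < m)%N by apply: leq_ltn_trans (ltn_ord i).
    by rewrite i0 add0n modn_small ?ltn_predL// -ltnS prednK// ltn_ord.
  rewrite [X in _ - X](eq_bigl (fun r : 'I_m => (r < i)%N)) ?addrK// => r.
  have -> : ((i + m).-1 %% m)%N = i.-1.
    rewrite -subn1 addnC -addnBA// modnDl subn1 modn_small//.
    by rewrite (leq_ltn_trans (leq_pred _))// ltn_ord.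
  by rewrite -ltnS prednK.
rewrite -(subrK S2 S1) ES /a /diag_entry.
by field; rewrite nu0.
Qed.

(** [(s, r)] in [S_n |x (Z_m)^n], residues modulo [m] being represented by
    natural numbers; the root of unity [mu] of [E = diag(1, mu, mu^2, ...)] is
    called [zeta]. *)
Definition G_act zeta (s : 'S_n) (r : 'I_n -> nat) (x : phase_vector) :
    phase_vector :=
  (\row_j (zeta ^+ r j * nu x (s j)), \row_j (zeta ^- r j * mu x (s j)),
   \matrix_(j < n, a < m) (phi x (s j) a * (zeta ^+ a) ^+ r j),
   \matrix_(a < m, j < n) ((zeta ^+ a) ^- r j * psi x a (s j))).

Definition same_mod_G zeta lam : rel (phase_space lam) :=
  fun p q => `[< exists (s : 'S_n) (r : 'I_n -> nat) (x y : phase_level lam),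
    [/\ p = phase_class x, q = phase_class y & val y = G_act zeta s r (val x)] >].

Lemma phase_eqP lam (x y : phase_level lam) :
  reflect (phase_class x = phase_class y)
    `[< exists2 d : 'I_n -> C, forall j, d j != 0 &
          val y = rescale d (val x) >].
Proof. exact: (eqmodP (same_phase_equiv lam)). Qed.

Lemma G_actM zeta s r s' r' x :
  G_act zeta s r (G_act zeta s' r' x) =
  G_act zeta (s * s')%g (fun j => (r j + r' (s j))%N) x.
Proof.
rewrite /G_act /nu /mu /phi /psi /=; congr (_, _, _, _); apply/matrixP => a j;
  by rewrite !mxE permM exprD ?invfM; ring.
Qed.

Lemma G_act_rescale zeta s r d x :
  G_act zeta s r (rescale d x) = rescale (d \o s) (G_act zeta s r x).
Proof.
rewrite /G_act /rescale /nu /mu /phi /psi /=; congr (_, _, _, _);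
  by apply/matrixP => a j; rewrite !mxE //=; ring.
Qed.

Section PrimitiveRoot.

Variable zeta : C.
Hypothesis hz : m.-primitive_root zeta.

Let zeta_neq0 : zeta != 0.
Proof.
apply/eqP => z0; have /eqP := prim_expr_order hz.
by rewrite z0 expr0n gtn_eqF ?(prim_order_gt0 hz)// eq_sym oner_eq0.
Qed.

Lemma G_act_id (q : 'I_n -> nat) x : G_act zeta 1%g (fun j => (m * q j)%N) x = x.
Proof.
have z1 a b : (zeta ^+ a) ^+ (m * b) = 1.
  by rewrite -exprM mulnCA exprM (prim_expr_order hz) expr1n.
have z1' b : zeta ^+ (m * b) = 1 by rewrite -(z1 1%N b) expr1.
case: x => [[[u v] w] t]; rewrite /G_act /nu /mu /phi /psi /=.
congr (_, _, _, _); apply/matrixP => a j;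
  by rewrite !mxE perm1 ?z1 ?z1' ?invr1 ?mul1r ?mulr1 // [a]ord1.
Qed.

Lemma G_act_level lam s r x :
  phase_level lam x -> phase_level lam (G_act zeta s r x).
Proof.
have zX b : (zeta ^+ b) ^+ m = 1 by rewrite exprAC (prim_expr_order hz) expr1n.
move=> [/hregP[nu0 nuD] mom]; split.
  apply/hregP; split=> [j|j k jk]; rewrite /nu /= !mxE.
    by rewrite mulf_neq0 ?expf_neq0.
  by rewrite !exprMn !zX !mul1r nuD// (inj_eq perm_inj).
apply/rowP => j; move/rowP: mom => /(_ (s j)); rewrite !mxE => <-.
apply: eq_bigr => a _; rewrite /phi /psi /= !mxE mulrA mulfK//.
by rewrite !expf_neq0.
Qed.

Lemma same_mod_G_refl lam : reflexive (@same_mod_G zeta lam).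
Proof.
move=> p; apply/asboolP; exists 1%g, (fun=> (m * 0)%N), (repr p), (repr p).
by rewrite /phase_class reprK (G_act_id (fun=> 0%N)).
Qed.

Lemma same_mod_G_sym lam : symmetric (@same_mod_G zeta lam).
Proof.
suff H p q : same_mod_G zeta p q -> @same_mod_G zeta lam q p.
  by move=> p q; apply/idP/idP; exact: H.
move=> /asboolP[s [r [x [y [-> -> E]]]]]; apply/asboolP.
exists (s^-1)%g, (fun j => r (s^-1 j)%g * m.-1)%N, y, x; split=> //.
rewrite E G_actM mulVg -[LHS](G_act_id (fun j => r (s^-1 j)%g)).
congr G_act; apply/funext => j.
by rewrite addnC -mulnS prednK ?(prim_order_gt0 hz)// mulnC.
Qed.

Lemma same_mod_G_trans lam : transitive (@same_mod_G zeta lam).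
Proof.
move=> q p p' /asboolP[s [r [x [y [-> -> E]]]]].
move=> /asboolP[s' [r' [x' [y' [qE -> E']]]]]; apply/asboolP.
have hl := G_act_level (s' * s)%g (fun j => r' j + r (s' j))%N (set_mem (valP x)).
exists (s' * s)%g, (fun j => r' j + r (s' j))%N, x, (level_point hl).
split=> //; move/phase_eqP/asboolP: qE => [d d0 dE].
apply/esym/phase_eqP/asboolP; exists (d \o s') => [j|]; first exact: d0.
by rewrite E' dE G_act_rescale E G_actM.
Qed.

Canonical same_mod_G_equiv lam :=
  EquivRel (@same_mod_G zeta lam) (@same_mod_G_refl lam)
    (@same_mod_G_sym lam) (@same_mod_G_trans lam).

(** [(h_reg * h^* * (Q_m)^n) / G] *)
Definition phase_quotient lam := quotient_topology {eq_quot same_mod_G_equiv lam}.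

Definition mod_G lam (p : phase_space lam) : phase_quotient lam :=
  \pi_(phase_quotient lam) p.

Definition cm_class lam (x : phase_level lam) : cm_space lam :=
  \pi_(cm_space lam) (level_point (cm_point_level (set_mem (valP x)))).

Definition cm_embedding lam (p : phase_quotient lam) : cm_space lam :=
  cm_class (repr (repr p)).

End PrimitiveRoot.

Section Monomial.

Variables (c : 'I_m -> 'I_n -> C) (s : 'S_n).
Hypothesis c0 : forall i j, c i j != 0.

Let g i : 'M[C]_n := \matrix_(j, k) (c i j *+ (k == s j)).

Let gl i p (A : 'M[C]_(n, p)) j k : (g i *m A) j k = c i j * A (s j) k.
Proof.
rewrite mxE (bigD1 (s j)) //= mxE eqxx big1 ?addr0// => l ls.
by rewrite mxE (negbTE ls) mul0r.
Qed.

Let gr i p (A : 'M[C]_(p, n)) j k : (A *m g i) j (s k) = A j k * c i k.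
Proof.
rewrite mxE (bigD1 k) //= mxE eqxx big1 ?addr0// => l ls.
by rewrite mxE (inj_eq perm_inj) eq_sym (negbTE ls) mulr0.
Qed.

Let gu i : g i \in unitmx.
Proof.
suff /mulmx1_unit[] : g i *m (\matrix_(k, j) ((c i j)^-1 *+ (k == s j))) = 1%:M.
  by [].
apply/matrixP => j k; rewrite gl !mxE (inj_eq perm_inj).
by case: eqVneq => [->|]; rewrite ?mulr0// mulr1n divff.
Qed.

Lemma monomial_gauge lam lam' (x x' : phase_vector) :
  (forall i j, nu x' j * c i j = c (ordS i) j * nu x (s j)) ->
  (forall i j, phi x' j i = c i j * phi x (s j) i) ->
  (forall i j, psi x' i j * c i j = psi x i (s j)) ->
  (forall i j, Y_diag lam' x' i j * c (ordS i) j
               = c i j * Y_diag lam x i (s j)) ->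
  (forall i j k, j != k -> Y_offdiag x' i j k * c (ordS i) k
               = c i j * Y_offdiag x i (s j) (s k)) ->
  exists2 g : 'I_m -> 'M[C]_n, forall i, g i \in unitmx &
    cm_point lam' x' = gauge g (cm_point lam x).
Proof.
move=> Hnu Hphi Hpsi HY HYo; exists g => //; rewrite /gauge /cm_point !cmE.
have H i p (A B : 'M[C]_(p, n)) : A *m g i = B -> A = B *m invmx (g i).
  by move=> <-; rewrite mulmxK.
have sP k : exists k', k = s k' by exists (s^-1 k)%g; rewrite permKV.
congr mk_cm; apply/funext => i; [apply: H|apply: H| |apply: H].
- apply/matrixP => j k; have [{}k ->] := sP k; rewrite gr gl !mxE.
  rewrite (inj_eq perm_inj); case: eqVneq => [->|_]; last by rewrite mul0r mulr0.
  by rewrite !mulr1n Hnu.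
- apply/matrixP => j k; have [{}k ->] := sP k; rewrite gr gl !mxE.
  by rewrite (inj_eq perm_inj); case: eqVneq => [->|jk]; rewrite ?HY ?HYo.
- by apply/matrixP => j k; rewrite gl !mxE Hphi.
- by apply/matrixP => j k; have [{}k ->] := sP k; rewrite gr !mxE Hpsi.
Qed.

End Monomial.

Lemma cm_point_rescale lam d x : (forall j, d j != 0) ->
  exists2 g : 'I_m -> 'M[C]_n, forall i, g i \in unitmx &
    cm_point lam (rescale d x) = gauge g (cm_point lam x).
Proof.
move=> d0; apply: (monomial_gauge (c := fun=> d) (s := 1%g)) => //=.
- by move=> i j; rewrite perm1 mulrC.
- by move=> i j; rewrite perm1 /phi mxE.
- by move=> i j; rewrite perm1 /psi mxE mulrAC mulVf ?mul1r.
- move=> i j; rewrite perm1 mulrC; congr (_ * _); rewrite /Y_diag.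
  have H r : diag_entry (rescale d x) j j r = diag_entry x j j r.
    by rewrite /diag_entry /psi /phi !mxE mulrACA mulVf// mul1r.
  by under eq_bigr do rewrite H; under [in X in _ + X]eq_bigr do rewrite H.
- move=> i j k jk; rewrite !perm1 /Y_offdiag mulNr mulrN mulr_suml mulr_sumr.
  congr (- _); apply: eq_bigr => l _; rewrite /nu /=.
  have -> r : diag_entry (rescale d x) k j r
              = (d k)^-1 * d j * diag_entry x k j r.
    by rewrite /diag_entry /psi /phi !mxE mulrACA.
  set D := (_ - _)^-1; move: (diag_entry _ _ _ _) (_ ^+ l) (_ ^+ (_ - _)) => a p q.
  by field.
Qed.

Lemma cm_point_G zeta lam s r x : m.-primitive_root zeta ->
  exists2 g : 'I_m -> 'M[C]_n, forall i, g i \in unitmx &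
    cm_point lam (G_act zeta s r x) = gauge g (cm_point lam x).
Proof.
move=> hz; pose u j := zeta ^+ r j.
have z0 : zeta != 0.
  apply/eqP => z0; have /eqP := prim_expr_order hz.
  by rewrite z0 expr0n gtn_eqF ?(prim_order_gt0 hz)// eq_sym oner_eq0.
have u0 j : u j != 0 by rewrite expf_neq0.
have zu a j : (zeta ^+ a) ^+ r j = u j ^+ a by rewrite exprAC.
have um j : u j ^+ m = 1 by rewrite -zu (prim_expr_order hz) expr1n.
have umod j a : u j ^+ (a %% m) = u j ^+ a.
  by rewrite {2}(divn_eq a m) exprD mulnC exprM um expr1n mul1r.
have uS j (i : 'I_m) : u j ^+ ordS i = u j * u j ^+ i by rewrite umod exprS.
have upred j l i : u j ^+ iter l (@ord_pred m) i * u j ^+ l = u j ^+ i.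
  rewrite -exprD -umod -iter_ordSE; congr (_ ^+ _); apply: congr1.
  by elim: l i => // l IH i; rewrite iterS [iter l.+1 _ i]iterSr IH ord_predK.
have phiE j a : phi (G_act zeta s r x) j a = phi x (s j) a * u j ^+ a.
  by rewrite /phi mxE zu.
have psiE j a : psi (G_act zeta s r x) a j = (u j ^+ a)^-1 * psi x a (s j).
  by rewrite /psi mxE zu.
have dE j k a : diag_entry (G_act zeta s r x) j k a
    = (u j ^+ a)^-1 * u k ^+ a * diag_entry x (s j) (s k) a.
  by rewrite /diag_entry phiE psiE; ring.
have nuE j : nu (G_act zeta s r x) j = u j * nu x (s j) by rewrite /nu mxE.
have muE j : mu (G_act zeta s r x) j = (u j)^-1 * mu x (s j) by rewrite /mu mxE.
apply: (monomial_gauge (c := fun i j => u j ^+ i) (s := s)).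
- by move=> i j; rewrite expf_neq0.
- by move=> i j; rewrite nuE uS mulrAC.
- by move=> i j; rewrite phiE mulrC.
- by move=> i j; rewrite psiE mulrAC mulVf ?mul1r// expf_neq0.
- move=> i j; rewrite uS /Y_diag nuE muE.
  have H a : diag_entry (G_act zeta s r x) j j a = diag_entry x (s j) (s j) a.
    by rewrite dE mulVf ?mul1r// expf_neq0.
  under eq_bigr do rewrite H; under [in X in _ + X]eq_bigr do rewrite H.
  rewrite invfM; move: (\sum_(_ < _ | _) _) (\sum_(_ < _) _) (nu x _)^-1 => a b v.
  by field.
- move=> i j k jk; rewrite uS /Y_offdiag mulNr mulrN mulr_suml mulr_sumr.
  congr (- _); apply: eq_bigr => l _; rewrite dE !nuE !exprMn !um !mul1r.
  set D := (_ - _)^-1; rewrite -(upred k l i) -(upred j l i).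
  have : u k ^+ (m - l - 1) * u k ^+ l * u k = 1.
    by rewrite -exprD -exprSr -addSn subn1 prednK ?subn_gt0// subnK ?um// ltnW.
  have : u k ^+ iter l (@ord_pred m) i != 0 by rewrite expf_neq0.
  move: (diag_entry _ _ _ _) (nu x _ ^+ l) (nu x _ ^+ (_ - _)) => a p q.
  move: (u k ^+ (m - l - 1)) (u k ^+ l) (u j ^+ l) => P L L'.
  move: (u k ^+ _) (u j ^+ _) => A B A0 PLu.
  transitivity (B * L' * (a * p * q * D) * (P * L * u k)); last first.
    by rewrite PLu mulr1.
  by field.
Qed.

Lemma cm_eqP lam (y z : cm_level lam) :
  reflect (\pi_(cm_space lam) y = \pi z)
    `[< exists2 g : 'I_m -> 'M[C]_n, forall i, g i \in unitmx &
          val z = gauge g (val y) >].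
Proof. exact: (eqmodP (same_cm_equiv lam)). Qed.

Lemma cm_class_phase lam (x y : phase_level lam) :
  phase_class x = phase_class y -> cm_class x = cm_class y.
Proof.
move=> /phase_eqP/asboolP[d d0 E]; apply/cm_eqP/asboolP => /=.
by rewrite E; exact: cm_point_rescale.
Qed.

Lemma phase_reprK lam (p : phase_space lam) : phase_class (repr p) = p.
Proof. exact: reprK. Qed.

Lemma cm_embeddingE zeta (hz : m.-primitive_root zeta) lam (x : phase_level lam) :
  cm_embedding (mod_G hz (phase_class x)) = cm_class x.
Proof.
rewrite /cm_embedding; set p := repr (mod_G _ _).
have /(eqmodP (same_mod_G_equiv hz lam)) : mod_G hz p = mod_G hz (phase_class x).
  by rewrite /mod_G reprK.
move=> /asboolP[s [r [y [z [pE xE E]]]]]; rewrite pE.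
rewrite (@cm_class_phase _ (repr _) y) ?phase_reprK// (cm_class_phase xE).
by apply/cm_eqP/asboolP; rewrite /= E; exact: cm_point_G.
Qed.

Lemma cm_hamiltonian_gauge k g z : (forall i, g i \in unitmx) ->
  cm_hamiltonian k (gauge g z) = cm_hamiltonian k z.
Proof.
move=> ug; rewrite /cm_hamiltonian /gauge !cmE; congr (- _).
apply: eq_bigr => i _; congr (fun_of_matrix _ ord0 ord0).
have -> : \prod_(0 <= l < k) (g (iter l (@ordS m) i)
      *m cmY z (iter l (@ordS m) i) *m invmx (g (ordS (iter l (@ordS m) i))))
    = g i *m (\prod_(0 <= l < k) cmY z (iter l (@ordS m) i))
        *m invmx (g (iter k (@ordS m) i)).
  elim: k => [|k IH]; first by rewrite !big_geq// -idmxE mulmx1 mulmxV.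
  by rewrite !big_nat_recr//= IH -!mulmxE !mulmxA mulmxKV.
by rewrite !mulmxA !mulmxKV.
Qed.

Lemma hamiltonianE lam k (x : phase_level lam) :
  hamiltonian k (phase_class x) = cm_hamiltonian k (cm_point lam (val x)).
Proof.
rewrite /hamiltonian; set y := repr _.
have /phase_eqP/asboolP[d d0 ->] : phase_class x = phase_class y.
  by rewrite phase_reprK.
by have [g ug ->] := cm_point_rescale lam (val x) d0; rewrite cm_hamiltonian_gauge.
Qed.

(** Every solution curve of Hamilton's equations of [h] over a connected open
    set of complex times, pushed to the phase space modulo [G] and embedded in
    the Calogero-Moser space, is the orbit under [Phi] of its value at time 0. *)
Definition extends_hamiltonian_flow zeta (hz : m.-primitive_root zeta) lam
    (h : phase_space lam -> C) (Phi : C -> cm_space lam -> cm_space lam) :=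
  forall (D : set C) (g : C -> phase_level lam), open D -> connected D -> D 0 ->
    integral_curve phase_moment phase_form h D g ->
    forall t, D t ->
      cm_embedding (mod_G hz (phase_class (g t)))
      = Phi t (cm_embedding (mod_G hz (phase_class (g 0)))).

End CyclicQuiver.

(* Main.v *)
From HB Require Import structures.
Require Import Defs.
From mathcomp Require Import all_boot all_order all_algebra.
From mathcomp Require Import all_classical all_reals all_analysis.
From mathcomp Require Import complex ring zify.

Set Implicit Arguments.
Unset Strict Implicit.
Unset Printing Implicit Defensive.

Import Order.TTheory GRing.Theory Num.Theory.
Import numFieldNormedType.Exports.

Local Open Scope classical_set_scope.
Local Open Scope quotient_scope.
Local Open Scope ring_scope.
Local Open Scope complex_scope.

(** Assemble a quiver representation into one block matrix [Y], a column [v] and a row [w] on the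
    sum of the [V_i]. Then [H_k = - w Y^k v] ([cm_hamiltonianE]) does not involve [X], so its
    Hamilton equations on the representation space keep [Y] fixed: [v' = - Y^k v], [w' = w Y^k], and
    [X'] consists of blocks of minus the sum of the [Y^a v w Y^(k-1-a)]. They are solved in closed
    form by matrix exponentials and the integral of [e^(-s Y^k) v w e^(s Y^k)]. The solution [flow]
    exists for all complex times, preserves the moment level ([flow_level]) and commutes with the
    gauge group ([flow_gauge]), so it descends to a complete flow on the Calogero-Moser space
    ([cm_flow_complete]). The fields of [H_k] and [H_l] are orthogonal, since their pairing consists
    of [w Y^(k+l) v] taken twice with opposite signs ([ham_fields_orthogonal]).

    The transfer to the phase space rests on two facts about [cm_point]. It pulls the form of the
    representation space back to [phase_form] ([cm_point_symplectic]), since [X] is diagonal and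
    independent of [i] and the diagonals of the [Y_i] sum to [m mu_j]. And every vector tangent to
    the moment level at an image point is the image of a tangent vector of the phase space plus an
    infinitesimal gauge transformation ([cm_tangent_decomposition]); the latter are orthogonal to
    all tangent vectors. Hence Hamiltonian vectors on both sides agree up to gauge directions
    ([hamiltonian_vector_exists], [hamiltonian_vectorP]), and Poisson commutation follows
    ([hamiltonians_commute]). The dimension [2 m n] is a count of ranks ([phase_reduced_dim]).

    For independence, the differentials of [H_1, ..., H_mn] are evaluated on [m n] tangent
    directions that fix [nu] and [psi], which gives a square matrix [jac]. Along the line [mu + t y]
    its determinant is a power of [t] times a polynomial in [1/t] ([jac_shift]). At [1/t = 0] the
    matrix [Y] degenerates to [diag y] and the entries become explicit ([jac_limit0]); a Vandermonde
    argument with the [m n] points [zeta^a y_j] shows invertibility as soon as the circulants of the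
    [psi_j] are invertible ([limit_jacobian_inj]). So the polynomial is not zero, and [jac] is
    invertible arbitrarily close to any given point ([jac_generic]).

    For the extension, let [g] be a solution curve on the phase space. For each gauge invariant
    differentiable [F], the function [F (flow (-t) (cm_point (g t)))] of [t] has zero derivative,
    hence is constant on the connected time domain ([invariant_along_flow]). Such invariants
    separate an image point from all other gauge classes of the level ([invariants_separate]), so
    [flow (-t) (cm_point (g t))] and [cm_point (g 0)] are gauge equivalent, and flowing forward
    again gives [cm_flow_extends]. *)

(** * Calculus of derivatives and differentials for matrices, pairs and finite sums *)

Section Derivatives.
Context {K : numFieldType}.

Lemma is_derive_lin (V W W' : normedModType K) (L : {linear W -> W'})
    (f : V -> W) (x v : V) df :
  continuous L -> is_derive x v f df -> is_derive x v (L \o f) (L df).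
Proof.
move=> cL [dvf <-].
have H : (fun h : K => h^-1 *: (((L \o f) \o shift x) (h *: v) - (L \o f) x))
         @ 0^' --> L ('D_v f x).
  have -> : (fun h : K => h^-1 *: (((L \o f) \o shift x) (h *: v) - (L \o f) x))
    = L \o (fun h : K => h^-1 *: ((f \o shift x) (h *: v) - f x)).
    by apply/funext => h /=; rewrite linearZ [L (_ - _)]linearB.
  by apply: cvg_comp; [exact: dvf|exact: cL].
apply: DeriveDef; first by apply/cvg_ex; exists (L ('D_v f x)).
exact: cvg_lim H.
Qed.

Lemma is_derive_pair (V W W' : normedModType K) (f : V -> W) (g : V -> W')
    (x v : V) df dg :
  is_derive x v f df -> is_derive x v g dg ->
  is_derive x v (fun y => (f y, g y)) (df, dg).
Proof.
move=> [dvf <-] [dvg <-].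
have H : (fun h : K => h^-1 *: (((fun y => (f y, g y)) \o shift x) (h *: v)
           - (f x, g x))) @ 0^' --> ('D_v f x, 'D_v g x).
  exact: (cvg_pair dvf dvg).
apply: DeriveDef; first by apply/cvg_ex; exists ('D_v f x, 'D_v g x).
exact: cvg_lim H.
Qed.

Lemma cvg_bigsum (T : Type) (F : set_system T) {FF : Filter F}
    (V : normedModType K) (I : Type) (s : seq I) (P : pred I) (f : I -> T -> V)
    (l : I -> V) :
  (forall i, P i -> f i @ F --> l i) ->
  (fun x => \sum_(i <- s | P i) f i x) @ F --> \sum_(i <- s | P i) l i.
Proof.
move=> H; elim: s => [|i s IH].
  by rewrite big_nil; under eq_fun do rewrite big_nil; exact: cvg_cst.
rewrite big_cons; under eq_fun do rewrite big_cons.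
by case: ifP => // Pi; apply: cvgD => //; exact: H.
Qed.

Lemma cvg_scalar_unique (T : Type) (F : set_system T) {FF : ProperFilter F}
    (f : T -> K) (l l' : K) : f @ F --> l -> f @ F --> l' -> l = l'.
Proof. exact: (cvg_unique (@norm_hausdorff K K^o)). Qed.

Lemma linear_mx_continuous p q (W : normedModType K)
    (L : {linear 'M[K]_(p, q) -> W}) : continuous L.
Proof.
have -> : (L : 'M[K]_(p, q) -> W)
    = fun M => \sum_(i < p) \sum_(j < q) M i j *: L (delta_mx i j).
  apply/funext => M; rewrite {1}(matrix_sum_delta M) linear_sum.
  by apply: eq_bigr => i _; rewrite linear_sum; apply: eq_bigr => j _; rewrite linearZ.
move=> M; apply: (@cvg_bigsum _ (nbhs M)) => i _; apply: (@cvg_bigsum _ (nbhs M)) => j _.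
by apply: cvgZl; exact: coord_continuous.
Qed.

(** A named function so that it can carry the linear structure that [is_derive_lin] expects; the
    same holds for [scale_delta_mx]. *)
Definition coord_mx p q i j (M : 'M[K]_(p, q)) : K := M i j.

Fact coord_mx_is_linear p q i j : linear (@coord_mx p q i j).
Proof. by move=> a x y; rewrite /coord_mx !mxE. Qed.
HB.instance Definition _ p q i j :=
  GRing.isLinear.Build _ _ _ _ _ (@coord_mx_is_linear p q i j).

Definition scale_delta_mx p q i j (c : K) : 'M[K]_(p, q) := c *: delta_mx i j.

Fact scale_delta_mx_is_linear p q i j : linear (@scale_delta_mx p q i j).
Proof. by move=> a x y; rewrite /scale_delta_mx scalerDl scalerA. Qed.
HB.instance Definition _ p q i j :=
  GRing.isLinear.Build _ _ _ _ _ (@scale_delta_mx_is_linear p q i j).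

Lemma is_derive_coord (V : normedModType K) p q (f : V -> 'M[K]_(p, q)) x v (df : 'M[K]_(p, q)) i j :
  is_derive x v f df -> is_derive x v (fun y => f y i j) (df i j).
Proof.
move=> H; apply: (is_derive_lin (L := coord_mx i j)) => //.
exact: coord_continuous.
Qed.

(** A matrix is the finite sum of its entries times elementary matrices, and each summand is a
    continuous linear image of an entry. *)
Lemma is_derive_mx (V : normedModType K) p q (f : V -> 'M[K]_(p, q)) x v (df : 'M[K]_(p, q)) :
  (forall i j, is_derive x v (fun y => f y i j) (df i j)) -> is_derive x v f df.
Proof.
move=> H; rewrite (_ : f = \sum_(i < p) \sum_(j < q)
    (scale_delta_mx i j \o (fun y => f y i j))); last first.
  apply/funext => y; rewrite {1}[f y]matrix_sum_delta fct_sumE.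
  by apply: eq_bigr => i _; rewrite fct_sumE.
rewrite [df]matrix_sum_delta; apply: is_derive_sum => i; apply: is_derive_sum => j.
apply: (is_derive_lin (L := scale_delta_mx i j)) => //; exact: scalel_continuous.
Qed.

Lemma is_derive_bigsum (V W : normedModType K) (I : finType) (P : pred I)
    (h : I -> V -> W) (dh : I -> W) x v :
  (forall i, P i -> is_derive x v (h i) (dh i)) ->
  is_derive x v (fun y => \sum_(i | P i) h i y) (\sum_(i | P i) dh i).
Proof.
move=> H; rewrite (_ : (fun y => _) = \sum_(i | P i) h i); last first.
  by apply/funext => y; rewrite fct_sumE.
elim/big_ind2 : _ => //; first exact: is_derive_cst.
by move=> a b c d; exact: is_deriveD.
Qed.

Lemma is_derive_mul (V : normedModType K) (f g : V -> K) x v df dg :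
  is_derive x v f df -> is_derive x v g dg ->
  is_derive x v (fun y => f y * g y) (df * g x + f x * dg).
Proof.
move=> H1 H2; apply: (is_derive_eq (is_deriveM H1 H2)).
by rewrite addrC; congr (_ + _); rewrite mulrC.
Qed.

Lemma is_derive_mulmx (V : normedModType K) p q r (f : V -> 'M[K]_(p, q))
    (g : V -> 'M[K]_(q, r)) x v (df : 'M[K]_(p, q)) (dg : 'M[K]_(q, r)) :
  is_derive x v f df -> is_derive x v g dg ->
  is_derive x v (fun y => f y *m g y) (df *m g x + f x *m dg).
Proof.
move=> H1 H2; apply: is_derive_mx => i j; rewrite !mxE -big_split /=.
rewrite (_ : (fun y => _) = fun y => \sum_k f y i k * g y k j); last first.
  by apply/funext => y; rewrite mxE.
by apply: is_derive_bigsum => k _; apply: is_derive_mul; exact: is_derive_coord.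
Qed.

Lemma is_derive_ext (V W : normedModType K) (f g : V -> W) x v df dg :
  is_derive x v f df -> f =1 g -> df = dg -> is_derive x v g dg.
Proof. by move=> H /funext <- <-. Qed.

Lemma differentiable_lin (V W W' : normedModType K) (L : {linear W -> W'})
    (f : V -> W) x : continuous L -> differentiable f x ->
  differentiable (L \o f) x.
Proof.
move=> cL df; apply: differentiable_comp => //.
by apply: linear_differentiable; exact: cL.
Qed.

Lemma differentiable_fst (V W W' : normedModType K) (f : V -> (W * W')%type) x :
  differentiable f x -> differentiable (fun y => (f y).1) x.
Proof.
move=> df; apply: (differentiable_lin (L := fst)) => //.
by move=> p; exact: cvg_fst.
Qed.

Lemma differentiable_snd (V W W' : normedModType K) (f : V -> (W * W')%type) x :
  differentiable f x -> differentiable (fun y => (f y).2) x.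
Proof.
move=> df; apply: (differentiable_lin (L := snd)) => //.
by move=> p; exact: cvg_snd.
Qed.

Lemma is_derive_fst (V W W' : normedModType K) (f : V -> (W * W')%type) x v df :
  is_derive x v f df -> is_derive x v (fun y => (f y).1) df.1.
Proof.
move=> H; apply: (is_derive_lin (L := fst)) => //.
by move=> p; exact: cvg_fst.
Qed.

Lemma is_derive_snd (V W W' : normedModType K) (f : V -> (W * W')%type) x v df :
  is_derive x v f df -> is_derive x v (fun y => (f y).2) df.2.
Proof.
move=> H; apply: (is_derive_lin (L := snd)) => //.
by move=> p; exact: cvg_snd.
Qed.

Lemma differentiable_mx (V : normedModType K) p q (f : V -> 'M[K]_(p, q)) x :
  (forall i j, differentiable (fun y => f y i j) x) -> differentiable f x.
Proof.
move=> H; rewrite (_ : f = \sum_(i < p) \sum_(j < q)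
    (scale_delta_mx i j \o (fun y => f y i j))); last first.
  apply/funext => y; rewrite {1}[f y]matrix_sum_delta fct_sumE.
  by apply: eq_bigr => i _; rewrite fct_sumE.
apply: differentiable_sum => i; apply: differentiable_sum => j.
apply: (differentiable_lin (L := scale_delta_mx i j)) => //; exact: scalel_continuous.
Qed.

Lemma differentiable_entry (V : normedModType K) p q (f : V -> 'M[K]_(p, q)) x i j :
  differentiable f x -> differentiable (fun y => f y i j) x.
Proof.
move=> H; apply: (differentiable_lin (L := coord_mx i j)) => //.
exact: coord_continuous.
Qed.

Lemma differentiable_bigsum (V W : normedModType K) (I : finType) (P : pred I)
    (h : I -> V -> W) x :
  (forall i, P i -> differentiable (h i) x) ->
  differentiable (fun y => \sum_(i | P i) h i y) x.
Proof.
move=> H; rewrite (_ : (fun y => _) = \sum_(i | P i) h i); last first.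
  by apply/funext => y; rewrite fct_sumE.
elim/big_ind : _ => // a b; exact: differentiableD.
Qed.

Lemma differentiable_bigprod (V : normedModType K) (I : Type) (s : seq I)
    (P : pred I) (h : I -> V -> K) x :
  (forall i, P i -> differentiable (h i) x) ->
  differentiable (fun y => \prod_(i <- s | P i) h i y) x.
Proof.
move=> H; elim: s => [|i s IH].
  rewrite (_ : (fun y => _) = cst 1); first exact: differentiable_cst.
  by apply/funext => y; rewrite big_nil.
have [Pi|Pi] := boolP (P i); last by under eq_fun do rewrite big_cons (negbTE Pi).
by under eq_fun do rewrite big_cons Pi; apply: differentiableM => //; exact: H.
Qed.

Lemma differentiable_mulmx (V : normedModType K) p q r (f : V -> 'M[K]_(p, q))
    (g : V -> 'M[K]_(q, r)) x :
  differentiable f x -> differentiable g x ->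
  differentiable (fun y => f y *m g y) x.
Proof.
move=> H1 H2; apply: differentiable_mx => i j.
under eq_fun do rewrite mxE.
by apply: differentiable_bigsum => k _; apply: differentiableM;
  exact: differentiable_entry.
Qed.

Lemma is_derive_diff (V W : normedModType K) (f : V -> W) x v :
  differentiable f x -> is_derive x v f ('d f x v).
Proof.
by move=> df; apply: DeriveDef; [exact: diff_derivable|rewrite deriveE].
Qed.

Lemma diff_is_derive (V W : normedModType K) (f : V -> W) x v df :
  differentiable f x -> is_derive x v f df -> 'd f x v = df.
Proof. by move=> dfx [_ <-]; rewrite deriveE. Qed.

Lemma is_derive_curve (V W : normedModType K) (F : V -> W) (c : K -> V) t dc :
  differentiable F (c t) -> is_derive t (1 : K) c dc ->
  is_derive t (1 : K) (F \o c) ('d F (c t) dc).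
Proof.
move=> dF [/derivable1_diffP dct <-].
have dFc : differentiable (F \o c) t by exact: differentiable_comp.
apply: DeriveDef; first exact: diff_derivable.
by rewrite deriveE// diff_comp//= deriveE.
Qed.

Lemma is_derive_line (V : normedModType K) (x h : V) (t : K) :
  is_derive t (1 : K) (fun s => x + s *: h) h.
Proof.
have H : is_derive t (1 : K) (fun s : K => s *: h) h.
  have [df dE] : is_diff t ( *:%R^~ h) ( *:%R^~ h) by exact: is_diff_scalel.
  by apply: (is_derive_eq (is_derive_diff (1 : K^o) df)); rewrite dE scale1r.
by apply: (is_derive_eq (is_deriveD (is_derive_cst x t 1) H)); rewrite add0r.
Qed.

Lemma is_derive_comp1 (W : normedModType K) (f : K -> W) (c : K -> K) (t dc : K) df :
  is_derive (c t) (1 : K) f df -> is_derive t (1 : K) c dc ->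
  is_derive t (1 : K) (f \o c) (dc *: df).
Proof.
move=> Hf Hc; have dff : differentiable f (c t).
  by apply/derivable1_diffP; exact: ex_derive.
apply: (is_derive_eq (is_derive_curve dff Hc)).
have -> : dc = dc *: (1 : K) by rewrite [RHS]mulr1.
by rewrite linearZ/= (diff_is_derive dff Hf) [dc *: 1]mulr1.
Qed.

Lemma near_neq0 (V : normedModType K) (f : V -> K) x :
  differentiable f x -> f x != 0 -> \forall y \near x, f y != 0.
Proof.
move=> df; apply: (cvgr_neq0 (V := K^o)); exact: (differentiable_continuous df).
Qed.

End Derivatives.

(** [R[i]] under a name typed as a [numClosedFieldType], the kind of field over which flows and
    reductions are defined. *)
Definition complexField (R : realType) : numClosedFieldType := R[i].

(** * Complex functions with zero derivative *)

Section ComplexAnalysis.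
Context {R : realType}.
Local Notation C := (complexField R).
Local Notation toC := (real_complex R : R -> C).

Lemma normc_real (x : R) : `|(toC x)| = `|x|%:C.
Proof. by rewrite normc_def /= expr0n addr0 sqrtr_sqr. Qed.

Lemma real_complex_continuous : continuous toC.
Proof.
move=> x; apply/cvgrPdist_lt => e e0.
have /andP[/eqP eI eR] : (complex.Im e == 0) && (0 < complex.Re e).
  by move: e0; rewrite ltcE.
apply: filterS (nbhsx_ballx x _ eR) => y xy.
by rewrite -rmorphB normc_real ltcE /= eI eqxx.
Qed.

Lemma Re_continuous : continuous (@complex.Re R : C -> R).
Proof.
move=> x; apply/(@cvgrPdist_lt _ _ _ (nbhs (x : C)) (nbhs_filter (x : C))) => e e0.
have e0' : 0 < toC e by rewrite ltcR.
apply: (@filterS _ (nbhs x) _ _ _ _ (nbhsx_ballx x _ e0')) => y xy.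
rewrite -ltcR.
by apply: le_lt_trans xy; rewrite -raddfB; exact: normc_ge_Re.
Qed.

Lemma cvg_complex (T : Type) (F : set_system T) {FF : Filter F} (u v : T -> R) a b :
  u @ F --> a -> v @ F --> b ->
  (fun x => (u x +i* v x : C)) @ F --> (a +i* b : C).
Proof.
move=> ua vb.
rewrite (_ : (a +i* b : C) = toC a + ('i : C) * toC b); last exact: complexE.
rewrite (_ : (fun x => _) = fun x => toC (u x) + ('i : C) * toC (v x)); last first.
  by apply/funext => x; exact: complexE.
have ca : toC \o u @ F --> toC a.
  by apply: (cvg_comp _ _ ua); exact: real_complex_continuous.
have cb : toC \o v @ F --> toC b.
  by apply: (cvg_comp _ _ vb); exact: real_complex_continuous.
have ci : (fun x => ('i : C) * (toC \o v) x) @ F --> ('i : C) * toC b.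
  exact: (cvgM (cvg_cst ('i : C)) cb).
exact: (cvgD ca ci).
Qed.

Lemma real_complex_dnbhs0 : toC @ (0 : R)^' --> (0 : C)^'.
Proof.
move=> P wP; have := real_complex_continuous (x := 0) wP.
apply: (@filterS _ (nbhs (0 : R)) _) => x /= Px x0; apply: Px.
by apply: contraNneq x0 => /complexI ->.
Qed.

(** The real difference quotients are the real parts of the complex ones at real increments, and
    real increments tend to 0 inside the punctured complex neighbourhoods. *)
Lemma is_derive_Re (g : C -> C) (r : R) dg :
  is_derive ((toC r)) (1 : C) g dg ->
  is_derive r (1 : R) (fun s => complex.Re (g (toC s))) (complex.Re dg).
Proof.
move=> [dg1 <-].
have H : (fun h : R => h^-1 *: (((fun s => complex.Re (g (toC s))) \o shift r) (h *: 1)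
      - complex.Re (g (toC r)))) @ 0^' --> complex.Re ('D_1 g (toC r)).
  have -> : (fun h : R => h^-1 *: (((fun s => complex.Re (g (toC s))) \o shift r) (h *: 1)
      - complex.Re (g (toC r))))
    = (fun z => complex.Re z) \o (fun h : C => h^-1 *: ((g \o shift (toC r)) (h *: 1) - g (toC r)))
      \o toC.
    apply/funext => h /=.
    rewrite -raddfB /= [h *: 1]mulr1 [_%:A]mulr1 -rmorphD -fmorphV.
    by case: (g _ - _) => a b /=; rewrite mul0r subr0.
  apply: (cvg_comp _ _ real_complex_dnbhs0).
  by apply: (cvg_comp _ _ dg1); exact: Re_continuous.
apply: DeriveDef; first by apply/cvg_ex; exists (complex.Re ('D_1 g (toC r))).
exact: cvg_lim H.
Qed.

(** The real mean value theorem is applied to the real part of [c * f] along the segment; [c = 1]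
    and [c = 'i] recover both components of [f]. *)
Lemma zero_derivative_segment (f : C -> C) (a b : C) :
  (forall r : R, 0 <= r <= 1 -> is_derive (a + (toC r) * (b - a)) (1 : C) f 0) ->
  f a = f b.
Proof.
move=> df.
have K (c : C) : complex.Re (c * f a) = complex.Re (c * f b).
  pose g (z : C) := c * f (a + z *: (b - a)).
  have dg (r : R) : 0 <= r <= 1 ->
      is_derive r (1 : R) (fun s : R => complex.Re (g (toC s))) 0.
    move=> r01; rewrite (_ : 0 = complex.Re (0 : C))//; apply: is_derive_Re.
    have dfr := df r r01.
    have H : is_derive (toC r) (1 : C) (f \o (fun z => a + z *: (b - a))) 0.
      rewrite -(scaler0 C^o (b - a)).
      apply: (is_derive_comp1 (c := fun z : C => a + z *: (b - a)) (df r r01)).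
      exact: (is_derive_line a (b - a) (toC r)).
    apply: (is_derive_ext (is_derive_mul (is_derive_cst c _ _) H)) => //.
    by rewrite mul0r add0r mulr0.
  have d01 (r : R) : r \in `]0, 1[%R ->
      is_derive r (1 : R) (fun s : R => complex.Re (g (toC s))) 0.
    by move=> r01; apply: dg; rewrite !ltW ?(itvP r01).
  have c01 : {within `[0, 1], continuous (fun s : R => complex.Re (g (toC s)))}.
    apply: derivable_within_continuous => r r01.
    by apply: ex_derive; apply: dg; rewrite !(itvP r01).
  have [r _] := MVT_segment ler01 d01 c01.
  rewrite mul0r => /eqP; rewrite subr_eq0 => /eqP.
  by rewrite /g /= !scale0r addr0 scale1r addrC subrK.
apply/eqP; rewrite eq_complex; apply/andP; split; apply/eqP.
  by have := K 1; rewrite !mul1r.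
have := K 'i; rewrite ![_ * f _]mulrC !ReiNIm; exact: oppr_inj.
Qed.

(** Discs are convex, so [zero_derivative_segment] makes [f] locally constant; the set where [f]
    takes the value [f a] is then open and closed in [D]. *)
Lemma zero_derivative_constant (f : C -> C) (D : set C) (a : C) :
  open D -> connected D -> D a ->
  (forall t, D t -> is_derive t (1 : C) f 0) -> forall t, D t -> f t = f a.
Proof.
move=> oD cD Da df.
have lc t : D t -> \forall s \near t, D s /\ f s = f t.
  move=> Dt; have : nbhs t D by exact: open_nbhs_nbhs.
  move=> /nbhs_ballP[e /= e0 be].
  apply/nbhs_ballP; exists e => //= s ts; split; first exact: be.
  apply/esym/zero_derivative_segment => r /andP[r0 r1]; apply: df; apply: be.
  rewrite /ball /= opprD addrA subrr sub0r normrN normrM normc_real (ger0_norm r0).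
  apply: le_lt_trans ts; rewrite distrC; apply: ler_piMl => //.
  by rewrite -[1]/((1 : R)%:C) lecR.
pose B := [set t | D t /\ f t = f a].
have oB : open B.
  rewrite openE => t [Dt fta]; rewrite /interior.
  by apply: filterS (lc t Dt) => s [Ds fs]; split=> //; rewrite fs.
have oB' : open [set t | D t /\ f t <> f a].
  rewrite openE => t [Dt fta]; rewrite /interior.
  by apply: filterS (lc t Dt) => s [Ds fs]; split=> //; rewrite fs.
have BD : B = D.
  apply: cD; first by exists a.
  - by exists B => //; apply/seteqP; split=> [t [Dt ft]|t []].
  - exists (~` [set t | D t /\ f t <> f a]); first exact: open_closedC.
    apply/seteqP; split=> [t [Dt ft]|t [Dt ft]]; first by split=> // -[].
    by split=> //; apply: contrapT => nft; apply: ft.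
by move=> t; rewrite -{1}BD => -[].
Qed.

End ComplexAnalysis.

(** * The exponential series of a complex matrix *)

Section MatrixExponential.
Context {R : realType}.
Local Notation C := (complexField R).
Local Notation toC := (real_complex R : R -> C).

Definition entries_le p q (r : R) (A : 'M[C]_(p, q)) :=
  forall i j, `|A i j| <= toC r.

(** Each further factor costs one sum over [N] indices, whence the ratio [N r] of the dominating
    real exponential series. *)
Lemma entries_leX N r (A : 'M[C]_N) k : 0 <= r -> entries_le r A ->
  entries_le ((N%:R * r) ^+ k) (A ^+ k).
Proof.
move=> r0 Ar; elim: k => [|k IH] i j.
  rewrite expr0 expr0 -idmxE mxE; case: (i == j); first by rewrite normr1.
  by rewrite normr0 -[0]/(toC 0) lecR.
rewrite exprSr -mulmxE mxE.
apply: le_trans (ler_norm_sum _ _ _) _.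
apply: (@le_trans _ _ (\sum_(l < N) toC ((N%:R * r) ^+ k) * toC r)).
  by apply: ler_sum => l _; rewrite normrM ler_pM.
rewrite sumr_const card_ord -rmorphM -rmorphMn lecR exprS mulrC.
by rewrite -mulrnAl -mulr_natl mulrC.
Qed.

Definition exp_term N (A : 'M[C]_N) (k : nat) : 'M[C]_N := k`!%:R^-1 *: A ^+ k.

Definition exp_sum N (A : 'M[C]_N) (q : nat) : 'M[C]_N :=
  \sum_(k < q) exp_term A k.

Lemma exp_term_le N r (A : 'M[C]_N) k i j : 0 <= r -> entries_le r A ->
  `|exp_term A k i j| <= toC (exp_coeff (N%:R * r) k).
Proof.
move=> r0 Ar; rewrite mxE normrM normfV normr_nat /exp_coeff /= mulrC rmorphM.
rewrite fmorphV rmorph_nat ler_wpM2r ?invr_ge0 ?ler0n//.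
exact: entries_leX.
Qed.

Lemma entries_le_bound N (A : 'M[C]_N) : exists2 r, 0 <= r & entries_le r A.
Proof.
exists (\sum_i \sum_j complex.Re `|A i j|).
  apply: sumr_ge0 => i _; apply: sumr_ge0 => j _.
  by rewrite -lecR RRe_real ?normr_real// normr_ge0.
have H i j : toC (complex.Re `|A i j|) = `|A i j|.
  by apply: RRe_real; exact: normr_real.
have P i j : 0 <= complex.Re `|A i j| by rewrite -lecR H normr_ge0.
move=> i j; rewrite -H lecR (bigD1 i) //= (bigD1 j) //= -addrA lerDl.
apply: addr_ge0; apply: sumr_ge0 => k _; first exact: (P i k).
by apply: sumr_ge0 => l _; exact: (P k l).
Qed.

(** Real and imaginary parts are dominated separately by the same real series. *)
Lemma cvg_series_complex (c : nat -> C) (b : nat -> R) :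
  (forall k, `|c k| <= toC (b k)) -> cvgn (series b) ->
  exists l : C, (fun q => \sum_(k < q) c k) @ \oo --> l.
Proof.
move=> cb sb.
have b0 k : 0 <= b k.
  by rewrite -lecR; apply: le_trans (cb k); exact: (normr_ge0 (c k)).
have H (u : nat -> R) : (forall k, `|u k| <= b k) -> cvgn (series u).
  move=> ub; apply: (@normed_cvg _ R^o).
  by apply: (series_le_cvg _ b0 ub sb) => k; exact: normr_ge0.
have bRe k : `|complex.Re (c k)| <= b k.
  by rewrite -lecR; apply: le_trans (cb k); exact: normc_ge_Re.
have bIm k : `|complex.Im (c k)| <= b k.
  rewrite -lecR -[complex.Im _]opprK -ReiNIm normrN.
  apply: le_trans (cb k); apply: le_trans (normc_ge_Re _) _.
  by rewrite normrM [`|'i|]normc_def /= expr0n add0r expr1n sqrtr1 mulr1.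
have /cvg_ex[/= lr hr] := H _ bRe; have /cvg_ex[/= li hi] := H _ bIm.
exists (lr +i* li); rewrite (_ : (fun q => _) = fun q =>
    (series (fun k => complex.Re (c k)) q +i* series (fun k => complex.Im (c k)) q : C)).
  exact: cvg_complex.
apply/funext => q; rewrite /series /= !big_mkord.
apply/eqP; rewrite eq_complex /= !raddf_sum /=.
by apply/andP; split; apply/eqP/eq_bigr.
Qed.

(** The entrywise limit of the partial sums. The default value 0 of [xget] never occurs, by
    [exp_sum_cvg]. *)
Definition mexp N (A : 'M[C]_N) : 'M[C]_N :=
  \matrix_(i, j) xget 0 [set l : C | (fun q => exp_sum A q i j) @ \oo --> l].

Lemma exp_sum_cvg N (A : 'M[C]_N) i j :
  (fun q => exp_sum A q i j) @ \oo --> mexp A i j.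
Proof.
have [r r0 Ar] := entries_le_bound A.
have [|l lP] := @cvg_series_complex (fun k => exp_term A k i j) _
  (fun k => exp_term_le k i j r0 Ar); first exact: is_cvg_series_exp_coeff.
have E : (fun q => exp_sum A q i j) = (fun q => \sum_(k < q) exp_term A k i j).
  by apply/funext => q; rewrite /exp_sum summxE.
have ex : exists l, [set l : C | (fun q => exp_sum A q i j) @ \oo --> l] l.
  by exists l; rewrite /mkset E.
by rewrite mxE; exact: (xgetPex 0 ex).
Qed.

Lemma mexp_unique N (A : 'M[C]_N) i j (l : C) :
  (fun q => exp_sum A q i j) @ \oo --> l -> mexp A i j = l.
Proof. by move=> H; exact: (cvg_scalar_unique (@exp_sum_cvg _ A i j) H).
Qed.

(** Some partial sum lies within 1 of the limit, and all partial sums are bounded by the real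
    exponential at [N r]. *)
Lemma mexp_le N r : 0 <= r -> exists b : R, forall A : 'M[C]_N,
  entries_le r A -> entries_le b (mexp A).
Proof.
move=> r0; exists (1 + expR (N%:R * r)) => A Ar i j.
have /cvgrPdist_lt /(_ 1 ltr01) H := @exp_sum_cvg _ A i j.
have [q /= qP] := filter_ex H.
rewrite -(subrK (exp_sum A q i j) (mexp A i j)) rmorphD.
apply: le_trans (ler_normD _ _) (lerD (ltW qP) _).
rewrite /exp_sum summxE; apply: le_trans (ler_norm_sum _ _ _) _.
apply: (@le_trans _ _ (\sum_(k < q) toC (exp_coeff (N%:R * r) k))).
  by apply: ler_sum => k _; exact: exp_term_le.
rewrite -rmorph_sum lecR /=.
have sb := @is_cvg_series_exp_coeff R (N%:R * r).
have nd : nondecreasing_seq (series (exp_coeff (N%:R * r))).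
  apply/nondecreasing_seqP => k; rewrite seriesSr lerDl exp_coeff_ge0//.
  by rewrite mulr_ge0.
by have := nondecreasing_cvgn_le nd sb q; rewrite /series /= big_mkord.
Qed.

(** [P] intertwines the powers, hence the partial sums, and limits are unique. *)
Lemma mexp_intertwine p q (P : 'M[C]_(p, q)) (A : 'M[C]_q) (B : 'M[C]_p) :
  P *m A = B *m P -> P *m mexp A = mexp B *m P.
Proof.
move=> PA; apply/matrixP => i j.
have PX k : P *m A ^+ k = B ^+ k *m P.
  elim: k => [|k IH]; first by rewrite !expr0 -!idmxE mulmx1 mul1mx.
  by rewrite !exprS -!mulmxE mulmxA PA -mulmxA IH mulmxA.
have PS k : P *m exp_sum A k = exp_sum B k *m P.
  rewrite mulmx_sumr mulmx_suml; apply: eq_bigr => l _.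
  by rewrite -scalemxAr PX scalemxAl.
have H1 : (fun k => (P *m exp_sum A k) i j) @ \oo --> (P *m mexp A) i j.
  rewrite mxE (_ : (fun k => _) = fun k => \sum_l P i l * exp_sum A k l j).
    by apply: cvg_bigsum => l _; apply: cvgMr; exact: exp_sum_cvg.
  by apply/funext => k; rewrite mxE.
have H2 : (fun k => (P *m exp_sum A k) i j) @ \oo --> (mexp B *m P) i j.
  rewrite mxE (_ : (fun k => _) = fun k => \sum_l exp_sum B k i l * P l j).
    by apply: cvg_bigsum => l _; apply: cvgMl; exact: exp_sum_cvg.
  by apply/funext => k; rewrite PS mxE.
exact: (cvg_scalar_unique H1 H2).
Qed.

Lemma mexp0 N : mexp (0 : 'M[C]_N) = 1%:M.
Proof.
apply/matrixP => i j; apply: mexp_unique.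
apply: cvg_near_cst; exists 1%N => // q /= q1.
rewrite -(prednK q1) /exp_sum big_ord_recl big1 ?addr0.
  by rewrite /exp_term fact0 invr1 scale1r expr0 idmxE.
by move=> k _; rewrite /exp_term exprS mul0r scaler0.
Qed.

(** The corner of the power [k + 1] is [(k + 1) B^k]; divided by [(k + 1)!] it is the term of index
    [k] of the series of [B]. The partial sums therefore correspond with a shift by one. *)
Lemma mexp_jordan N (B : 'M[C]_N) : ursubmx (mexp (block_mx B 1%:M 0 B)) = mexp B.
Proof.
have jX k : (block_mx B 1%:M 0 B) ^+ k.+1 =
    block_mx (B ^+ k.+1) (k.+1%:R *: B ^+ k) 0 (B ^+ k.+1).
  elim: k => [|k IH]; first by rewrite !expr1 expr0 scale1r.
  rewrite exprS IH -mulmxE mulmx_block !mulmx0 !mul0mx !mul1mx !addr0 ?add0r.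
  rewrite -scalemxAr mulmxE -!exprS; congr block_mx.
  by rewrite -[X in _ + X]scale1r -scalerDl natr1.
have jS q i j : exp_sum (block_mx B 1%:M 0 B) q.+1 (lshift N i) (rshift N j)
    = exp_sum B q i j.
  rewrite /exp_sum !summxE big_ord_recl /exp_term expr0 -idmxE [X in X + _]mxE [X in _ * X + _]mxE.
  rewrite (_ : (_ == _) = false) ?mulr0 ?add0r; last first.
    by apply/eqP => /(congr1 val) /= E; have := ltn_ord i; rewrite E -ltn_subRL subnn.
  apply: eq_bigr => k _; rewrite lift0 jX [LHS]mxE [RHS]mxE block_mxEur mxE mulrA; congr (_ * _).
  rewrite factS natrM invfM mulrAC mulVf ?mul1r//.
apply/matrixP => i j; apply/esym/mexp_unique.
rewrite [ursubmx _ _ _]mxE [usubmx _ _ _]mxE.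
rewrite (_ : (fun q => _) = fun q =>
    exp_sum (block_mx B 1%:M 0 B) q.+1 (lshift N i) (rshift N j)).
  have S1 : (fun q => q.+1) @ \oo --> \oo.
    by move=> P [M _ MP]; exists M => // q /= Mq; apply: MP => /=; exact: leqW.
  exact: (cvg_comp _ _ S1 (@exp_sum_cvg _ (block_mx B 1%:M 0 B) _ _)).
by apply/funext => q; rewrite jS.
Qed.

End MatrixExponential.

(* What the flows use of the exponential series and of the ground field; the
   first property, naturality with respect to linear maps, replaces most
   computations with the series. *)
Record exponential (C : numClosedFieldType) := Exponential {
  exp_of :> forall N : nat, 'M[C]_N -> 'M[C]_N;
  exp_intertwine : forall p q (P : 'M[C]_(p, q)) (A : 'M[C]_q) (B : 'M[C]_p),
    P *m A = B *m P -> P *m exp_of A = exp_of B *m P;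
  exp_jordan : forall N (B : 'M[C]_N),
    ursubmx (exp_of (block_mx B 1%:M 0 B)) = exp_of B;
  exp_zero : forall N, exp_of (0 : 'M[C]_N) = 1%:M;
  exp_bounded : forall N (r : C), exists b : C, forall A : 'M[C]_N,
    (forall i j, `|A i j| <= r) -> forall i j, `|exp_of A i j| <= b;
  constant_of_derive0 : forall f : C -> C,
    (forall t, is_derive t (1 : C) f 0) -> forall s t, f s = f t;
  constant_on_connected : forall (f : C -> C) (D : set C) (a : C),
    open D -> connected D -> D a ->
    (forall t, D t -> is_derive t (1 : C) f 0) -> forall t, D t -> f t = f a }.

(** * Differentiability and group law of the exponential, from naturality *)

Section Exponential.
Context {C : numClosedFieldType} (E : exponential C).
Local Notation exp := (exp_of E).

Lemma mx_norm_entry p q (M : 'M[C]_(p, q)) i j : `|M i j| <= `|M|.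
Proof.
rewrite [leRHS]/Num.Def.normr /= mx_normE -[leLHS]nngE num_le.
exact: (le_bigmax _ _ (i, j)).
Qed.

Lemma mx_norm_le p q (M : 'M[C]_(p, q)) (b : C) : 0 <= b ->
  (forall i j, `|M i j| <= b) -> `|M| <= b.
Proof.
move=> b0 H; rewrite [leLHS]/Num.Def.normr /= mx_normE.
rewrite -[leRHS]/((NngNum b0)%:num) num_le; apply/bigmax_leP; split=> [|ij _].
  exact: b0.
by rewrite -num_le /=; exact: H.
Qed.

Definition exp_ur p q (A : 'M[C]_p) (H : 'M[C]_(p, q)) (D : 'M[C]_q) :=
  ursubmx (exp (block_mx A H 0 D)).

(** Naturality for the inclusion of the first summand and for the projection onto the second one
    keeps the exponential block triangular and identifies its diagonal blocks. *)
Lemma exp_block p q (A : 'M[C]_p) (H : 'M[C]_(p, q)) (D : 'M[C]_q) :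
  exp (block_mx A H 0 D) = block_mx (exp A) (exp_ur A H D) 0 (exp D).
Proof.
set M := block_mx A H 0 D.
have H1 : M *m col_mx 1%:M 0 = col_mx 1%:M 0 *m A.
  by rewrite mul_block_col !mulmx1 !mulmx0 !addr0 mul_col_mx mul1mx mul0mx.
have H2 : row_mx 0 1%:M *m M = D *m row_mx 0 1%:M.
  by rewrite mul_row_block !mul0mx !mul1mx !add0r mul_mx_row mulmx1 mulmx0.
have := exp_intertwine E (esym H1); have := exp_intertwine E H2.
rewrite -[exp M]submxK mul_row_block mul_block_col mul_mx_row mul_col_mx.
rewrite !mul0mx !mul1mx !mulmx0 !mulmx1 !addr0 !add0r.
move=> /eq_row_mx[-> ->] /eq_col_mx[<- _].
by rewrite /exp_ur.
Qed.

(** Naturality for the block diagonal map with blocks 1 and [Q]. Together with [exp_ur_mull] it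
    replaces manipulations of an integral formula for the corner. *)
Lemma exp_ur_mulr p q r (A : 'M[C]_p) (H : 'M[C]_(p, q)) (D : 'M[C]_q)
    (Q : 'M[C]_(q, r)) (D' : 'M[C]_r) : D *m Q = Q *m D' ->
  exp_ur A H D *m Q = exp_ur A (H *m Q) D'.
Proof.
move=> DQ.
have H1 : block_mx A H 0 D *m block_mx 1%:M 0 0 Q
    = block_mx 1%:M 0 0 Q *m block_mx A (H *m Q) 0 D'.
  by rewrite !mulmx_block !mulmx0 !mul0mx !mulmx1 !mul1mx !addr0 !add0r DQ.
have := exp_intertwine E (esym H1); rewrite !exp_block !mulmx_block.
by rewrite !mulmx0 !mul0mx !mulmx1 !mul1mx !addr0 !add0r => /eq_block_mx[].
Qed.

Lemma exp_ur_mull p q r (A : 'M[C]_p) (H : 'M[C]_(p, q)) (D : 'M[C]_q)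
    (P : 'M[C]_(r, p)) (A' : 'M[C]_r) : P *m A = A' *m P ->
  P *m exp_ur A H D = exp_ur A' (P *m H) D.
Proof.
move=> PA.
have H1 : block_mx P 0 0 1%:M *m block_mx A H 0 D
    = block_mx A' (P *m H) 0 D *m block_mx P 0 0 1%:M.
  by rewrite !mulmx_block !mulmx0 !mul0mx !mulmx1 !mul1mx !addr0 !add0r PA.
have := exp_intertwine E H1; rewrite !exp_block !mulmx_block.
by rewrite !mulmx0 !mul0mx !mulmx1 !mul1mx !addr0 !add0r => /eq_block_mx[].
Qed.

(** The Frechet derivative of the exponential at [A] in the direction [H]; [exp_is_diff] proves
    this. *)
Definition exp_diff N (A H : 'M[C]_N) := exp_ur A H A.

(** All combinations [x H1 + y H2] come from one corner, that of the row [(H1 H2)] over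
    [diag(A, A)], through right multiplication by the column of the scalars [x] and [y]; this is
    visibly linear in [x] and [y]. *)
Lemma exp_diff_is_linear N (A : 'M[C]_N) : linear (exp_diff A).
Proof.
move=> a H1 H2; set D := block_mx A 0 0 A.
have DQ (x y : C) : D *m col_mx x%:M y%:M = col_mx x%:M y%:M *m A.
  rewrite mul_block_col !mul0mx addr0 add0r mul_col_mx.
  by rewrite !scalar_mxC.
have F (x y : C) : exp_diff A (x *: H1 + y *: H2)
    = exp_ur A (row_mx H1 H2) D *m col_mx x%:M y%:M.
  by rewrite (exp_ur_mulr _ _ (DQ x y)) mul_row_col !mul_mx_scalar.
have := F a 1; rewrite scale1r => ->.
have := F 1 0; rewrite scale1r scale0r addr0 => ->.
have := F 0 1; rewrite scale1r scale0r add0r => ->.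
rewrite scalemxAr -mulmxDr scale_col_mx add_col_mx !scale_scalar_mx.
by rewrite mulr1 mulr0 !raddf0 add0r addr0.
Qed.
HB.instance Definition _ N A :=
  GRing.isLinear.Build _ _ _ _ _ (@exp_diff_is_linear N A).

(** The far corner of its exponential is the second order Taylor remainder at [A] in the direction
    [c G], with the factor [c^2] taken out. *)
Definition jordan3 N (A G : 'M[C]_N) (c : C) : 'M[C]_(N + (N + N)) :=
  block_mx (A + c *: G) (row_mx G 0) 0 (block_mx A G 0 A).

Definition exp_rem N (A G : 'M[C]_N) (c : C) : 'M[C]_N :=
  rsubmx (ursubmx (exp (jordan3 A G c))).

(** The matrix [S = diag(c^2, c, 1)] intertwines [jordan3] with [M], which has [c G] above its
    diagonal; this accounts for the factor [c^2]. The row [(1 1 1)] intertwines [M] with [A + c G],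
    and the last block of that identity says that the corner of [exp M] is the Taylor remainder. *)
Lemma exp_remE N (A G : 'M[C]_N) c :
  exp (A + c *: G) - exp A - exp_diff A (c *: G) = c ^+ 2 *: exp_rem A G c.
Proof.
pose S := block_mx (c ^+ 2)%:M 0 0 (block_mx c%:M 0 0 1%:M) : 'M[C]_(N + (N + N)).
pose M := block_mx (A + c *: G) (row_mx (c *: G) 0) 0
            (block_mx A (c *: G) 0 A) : 'M[C]_(N + (N + N)).
have MS : S *m jordan3 A G c = M *m S.
  rewrite /jordan3 /M /S !mulmx_block !mul_row_block !mul_mx_row.
  rewrite !mulmx0 !mul0mx !addr0 !add0r !mulmx1 !mul1mx.
  congr block_mx; first by rewrite scalar_mxC.
    congr row_mx.
    by rewrite mul_scalar_mx mul_mx_scalar scalerA expr2.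
  rewrite row_mx0 add0r.
  by congr block_mx; rewrite ?scalar_mxC ?mul_scalar_mx.
have := exp_intertwine E MS.
have PM : row_mx 1%:M (row_mx 1%:M 1%:M) *m M
    = (A + c *: G) *m row_mx 1%:M (row_mx 1%:M 1%:M).
  rewrite /M mul_row_block !mul_row_block !mulmx0 !mul1mx !addr0 add_row_mx add0r.
  rewrite !mul_mx_row !mulmx1.
  by congr (row_mx _ (row_mx _ _)); rewrite addrC.
have := exp_intertwine E PM.
rewrite /M /jordan3 !exp_block -/(exp_diff A (c *: G)) mul_row_block mul_row_block.
rewrite !mul_mx_row !mulmx0 !mul1mx !mulmx1 !addr0.
set U := exp_ur _ _ _; rewrite -[U]hsubmxK add_row_mx => /eq_row_mx[_ /eq_row_mx[_ UE]].
rewrite /S !mulmx_block => /eq_block_mx[_ + _ _].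
rewrite !mulmx0 !mul0mx !addr0 !add0r => UE'.
rewrite -UE addrA addrK addrK.
move: UE'; rewrite mul_row_block !mulmx0 add0r mulmx1.
set U' := exp_ur _ _ _; rewrite -[U']hsubmxK mul_mx_row => /eq_row_mx[_ <-].
rewrite mul_scalar_mx /exp_rem /jordan3 -/(exp_ur _ _ _) -/U'.
by [].
Qed.

Lemma row_mx_entry_le p q r (A : 'M[C]_(p, q)) (B : 'M[C]_(p, r)) (b : C) :
  (forall i j, `|A i j| <= b) -> (forall i j, `|B i j| <= b) ->
  forall i j, `|row_mx A B i j| <= b.
Proof. by move=> HA HB i j; rewrite mxE; case: splitP => k _. Qed.

Lemma block_mx_entry_le p q r s (A : 'M[C]_(p, q)) (B : 'M[C]_(p, r))
    (A' : 'M[C]_(s, q)) (B' : 'M[C]_(s, r)) (b : C) :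
  (forall i j, `|A i j| <= b) -> (forall i j, `|B i j| <= b) ->
  (forall i j, `|A' i j| <= b) -> (forall i j, `|B' i j| <= b) ->
  forall i j, `|block_mx A B A' B' i j| <= b.
Proof.
move=> *; rewrite mxE; case: splitP => k _; exact: row_mx_entry_le.
Qed.

(** For [G] and [c] of norm at most 1 the entries of [jordan3] are at most [|A| + 1], so that
    [exp_bounded] applies uniformly. *)
Lemma exp_rem_bounded N (A : 'M[C]_N) : exists2 b : C, 0 <= b &
  forall G c, `|G| <= 1 -> `|c| <= 1 -> `|exp_rem A G c| <= b.
Proof.
have [b bP] := exp_bounded E (N + (N + N)) (`|A| + 1).
have r0 : 0 <= `|A| + 1 by rewrite addr_ge0.
exists `|b| => [|G c G1 c1]; first exact: normr_ge0.
apply: mx_norm_le => // i j; rewrite /exp_rem mxE mxE mxE.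
apply: (le_trans (bP _ _ _ _)); last first.
  rewrite real_ler_norm//; apply: ger0_real; apply: le_trans (bP 0 _ (lshift _ i) (lshift _ i)) => //.
  by move=> k l; rewrite mxE normr0.
have GE k l : `|G k l| <= `|A| + 1.
  by rewrite (le_trans (mx_norm_entry _ _ _))// (le_trans G1)// lerDr.
have AE k l : `|A k l| <= `|A| + 1.
  by rewrite (le_trans (mx_norm_entry _ _ _))// lerDl.
apply: block_mx_entry_le => k l; last 1 first.
- by apply: block_mx_entry_le => // ? ?; rewrite mxE normr0.
- rewrite !mxE (le_trans (ler_normD _ _))// lerD ?mx_norm_entry// normrM.
  rewrite -[1]mulr1 ler_pM// (le_trans (mx_norm_entry _ _ _))//.
- by apply: row_mx_entry_le => // ? ?; rewrite mxE normr0.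
- by rewrite mxE normr0.
Qed.

Lemma exp_is_diff N (A : 'M[C]_N) :
  differentiable (exp (N := N)) A /\ 'd (exp (N := N)) A = exp_diff A :> (_ -> _).
Proof.
have cL : continuous (exp_diff A) by exact: linear_mx_continuous.
suff H : exp (N := N) \o shift A = (cst (exp A) + exp_diff A) +o_ (0 : 'M[C]_N) id.
  have dE := diff_unique cL H; split=> //.
  by apply/diff_locallyP; rewrite dE.
have [b b0 bP] := exp_rem_bounded A.
apply/eqaddoP => e e0.
have d0 : 0 < e / (b + 1) by rewrite divr_gt0// ltr_wpDl.
near=> H.
have [->|H0] := eqVneq H 0.
  rewrite /= !fctE /= linear0 add0r addr0 subrr normr0 mulr_ge0// ltW//.
have c0 : 0 < `|H| by rewrite normr_gt0.
(* Taking [c] to be the norm of [H] and [G] its normalisation, [exp_remE] bounds the error by a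
   constant times the square of the norm. *)
have HE : H = `|H| *: (`|H|^-1 *: H) by rewrite scalerA divff ?scale1r// gt_eqF.
have -> : (exp (N := N) \o shift A - (cst (exp A) + exp_diff A)) H
    = `|H| ^+ 2 *: exp_rem A (`|H|^-1 *: H) `|H|.
  by rewrite -exp_remE -HE !fctE /= opprD addrA [H + A]addrC.
have H1 : `|H| < 1 by near: H; exact: (@nbhs0_lt C 'M[C]_N _ ltr01).
have He : `|H| < e / (b + 1) by near: H; exact: (@nbhs0_lt C 'M[C]_N _ d0).
rewrite normrZ normrX normr_id expr2 -mulrA mulrC -mulrA.
rewrite [leRHS]mulrC ler_wpM2l// mulrC.
apply: (@le_trans _ _ (`|H| * (b + 1))).
  rewrite ler_wpM2l//; apply: (le_trans (bP _ _ _ _)).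
  - by rewrite normrZ normfV normr_id mulVf ?lexx// gt_eqF.
  - by rewrite normr_id ltW.
  - by rewrite lerDl.
by rewrite -ler_pdivlMr ?ltW// ltr_wpDl.
Unshelve. all: by end_near. Qed.

Lemma exp_differentiable N (A : 'M[C]_N) : differentiable (exp (N := N)) A.
Proof. by have [] := exp_is_diff A. Qed.

Lemma exp_comm N (A B : 'M[C]_N) : A *m B = B *m A -> A *m exp B = exp B *m A.
Proof. exact: exp_intertwine. Qed.

(** The direction [A] commutes with the base point [t A], so it factors out of [exp_diff]; the
    remaining corner has the identity as direction and is computed by [exp_jordan]. *)
Lemma exp_curve N (A : 'M[C]_N) (t : C) :
  is_derive t (1 : C) (fun s : C => exp (s *: A)) (A *m exp (t *: A)).
Proof.
have H : is_derive t (1 : C) (fun s : C => s *: A) A.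
  by have := is_derive_line 0 A t; under eq_fun do rewrite add0r.
apply: (is_derive_eq (is_derive_curve (exp_differentiable (t *: A)) H)).
have [_ ->] := exp_is_diff (t *: A).
have AA : A *m (t *: A) = (t *: A) *m A by rewrite -scalemxAr -scalemxAl.
rewrite /exp_diff.
have := exp_ur_mull 1%:M (t *: A) AA; rewrite !mulmx1 => <-.
by rewrite /exp_ur exp_jordan.
Qed.

Lemma constant_mx_of_derive0 p q (f : C -> 'M[C]_(p, q)) :
  (forall t, is_derive t (1 : C) f 0) -> forall s t, f s = f t.
Proof.
move=> df s t; apply/matrixP => i j.
apply: (constant_of_derive0 E (f := fun s => f s i j)) => u.
by have := is_derive_coord i j (df u); rewrite mxE.
Qed.

(** The addition law in a form whose left side has zero derivative in [t]; inverses and [expD] are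
    read off from it. *)
Lemma exp_mulN N (A : 'M[C]_N) (s t : C) :
  exp ((s + t) *: A) *m exp ((- t) *: A) = exp (s *: A).
Proof.
pose f t := exp ((s + t) *: A) *m exp ((- t) *: A).
rewrite -/(f t) (@constant_mx_of_derive0 _ _ f _ t 0).
  by rewrite /f addr0 oppr0 scale0r exp_zero mulmx1.
move=> u.
have H1 : is_derive u (1 : C) (fun t => exp ((s + t) *: A))
    (A *m exp ((s + u) *: A)).
  have := is_derive_comp1 (c := fun t => s + t) (dc := 1) (exp_curve A (s + u)).
  rewrite scale1r; apply.
  by have := is_derive_line s 1 u; under eq_fun do rewrite [_ *: _]mulr1.
have H2 : is_derive u (1 : C) (fun t => exp ((- t) *: A))
    (- (A *m exp ((- u) *: A))).
  have := is_derive_comp1 (c := fun t => - t) (dc := -1) (exp_curve A (- u)).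
  by rewrite scaleN1r; apply; exact: is_deriveNid.
apply: (is_derive_eq (is_derive_mulmx H1 H2)).
rewrite mulmxN [A *m exp ((s + u) *: A)]exp_comm ?mulmxA ?subrr//.
by rewrite -scalemxAr -scalemxAl.
Qed.

Lemma expN N (A : 'M[C]_N) : exp A *m exp (- A) = 1%:M.
Proof.
by have := exp_mulN A 0 1; rewrite add0r scale0r exp_zero scale1r scaleN1r.
Qed.

Lemma exp_unitmx N (A : 'M[C]_N) : exp A \in unitmx.
Proof. by have /mulmx1_unit[] := expN A. Qed.

Lemma exp_inv N (A : 'M[C]_N) : invmx (exp A) = exp (- A).
Proof. by rewrite -[LHS]mulmx1 -(expN A) mulKmx// exp_unitmx. Qed.

Lemma expD N (A : 'M[C]_N) (s t : C) :
  exp ((s + t) *: A) = exp (s *: A) *m exp (t *: A).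
Proof.
rewrite -(exp_mulN A s t) -mulmxA.
by have := exp_mulN A 0 (- t); rewrite add0r opprK scale0r exp_zero => ->; rewrite mulmx1.
Qed.

End Exponential.

Lemma mexp_bounded (R : realType) N (r : complexField R) :
  exists b : complexField R, forall A : 'M[complexField R]_N,
    (forall i j, `|A i j| <= r) -> forall i j, `|mexp A i j| <= b.
Proof.
have [r0|r0] := boolP (0 <= r); last first.
  (* If [r] is not nonnegative, the hypothesis on [A] is contradictory as soon as an index [i]
     exists, since it gives [0 <= |A i i| <= r]. *)
  by exists 0 => A Ar i; case/negP: r0; apply: le_trans (Ar i i).
have rE : (complex.Re r)%:C = r by apply: RRe_real; exact: ger0_real.
have [|b bP] := @mexp_le R N (complex.Re r); first by rewrite -lecR rE.
by exists b%:C => A Ar; apply: bP => i j; rewrite rE.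
Qed.

Definition complex_exponential (R : realType) : exponential (complexField R) :=
  @Exponential (complexField R) (@mexp R) (@mexp_intertwine R) (@mexp_jordan R)
    (@mexp0 R) (@mexp_bounded R)
    (fun f df s t => zero_derivative_segment (fun r _ => df _))
    (@zero_derivative_constant R).

(** * The integral of a conjugated matrix, and the derivative of matrix powers *)

Section ExponentialIntegral.
Context {C : numClosedFieldType} (E : exponential C) {N : nat}.
Local Notation exp := (exp_of E).
Implicit Types A B T Y G : 'M[C]_N.

(* [exp_ur] is the upper right block of [exp (t [[-A, B], [0, -A]])], so that
   this is the integral of [e^(-sA) B e^(sA)] for [s] from [0] to [t]. *)
Definition exp_int (t : C) A B : 'M[C]_N :=
  exp_ur E (- (t *: A)) (t *: B) (- (t *: A)) *m exp (t *: A).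

Lemma exp_opp_comm A t : A *m exp (- (t *: A)) = exp (- (t *: A)) *m A.
Proof. by apply: exp_comm; rewrite mulmxN mulNmx -scalemxAr -scalemxAl. Qed.

Lemma exp_scale_comm A t : A *m exp (t *: A) = exp (t *: A) *m A.
Proof. by apply: exp_comm; rewrite -scalemxAr -scalemxAl. Qed.

Lemma exp_opp_mul A t : exp (- (t *: A)) *m exp (t *: A) = 1%:M.
Proof. by have := expN E (- (t *: A)); rewrite opprK. Qed.

(** The integrated form of [d/ds (e^(-sA) B e^(sA)) = - [A, e^(-sA) B e^(sA)]]; it is the corner of
    the statement that [M] commutes with the exponential of [t M]. *)
Lemma exp_int_comm t A B :
  A *m exp_int t A B - exp_int t A B *m A
  = B - exp (- (t *: A)) *m B *m exp (t *: A).
Proof.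
pose M := block_mx (- A) B 0 (- A).
have tM : t *: M = block_mx (- (t *: A)) (t *: B) 0 (- (t *: A)).
  by rewrite scale_block_mx scaler0 scalerN.
have /(exp_comm E) : M *m (t *: M) = (t *: M) *m M.
  by rewrite -scalemxAr -scalemxAl.
rewrite tM exp_block !mulmx_block => /eq_block_mx[_ + _ _].
rewrite /exp_int; set U := exp_ur _ _ _ _ => UE.
rewrite mulmxA -(mulmxA U) -exp_scale_comm mulmxA -mulmxBl.
have -> : A *m U - U *m A = B *m exp (- (t *: A)) - exp (- (t *: A)) *m B.
  move: UE; rewrite mulNmx mulmxN => UE.
  transitivity (A *m U + (exp (- (t *: A)) *m B - U *m A) - exp (- (t *: A)) *m B).
    by rewrite addrA addrAC addrK.
  by rewrite -UE addNKr.
by rewrite mulmxBl -(mulmxA B) exp_opp_mul mulmx1.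
Qed.

Lemma exp_int0 A B : exp_int 0 A B = 0.
Proof.
rewrite /exp_int /exp_ur !scale0r oppr0 block_mx0 exp_zero scalar_mx_block.
by rewrite block_mxKur mul0mx.
Qed.

(** The integral is split at [s]; algebraically this is the corner of [expD] for the block matrix
    [M]. *)
Lemma exp_intD s t A B :
  exp_int (s + t) A B
  = exp_int s A B + exp_int t A (exp (- (s *: A)) *m B *m exp (s *: A)).
Proof.
have UE : exp_ur E (- ((s + t) *: A)) ((s + t) *: B) (- ((s + t) *: A))
  = exp (- (s *: A)) *m exp_ur E (- (t *: A)) (t *: B) (- (t *: A))
    + exp_ur E (- (s *: A)) (s *: B) (- (s *: A)) *m exp (- (t *: A)).
  pose M := block_mx (- A) B 0 (- A).
  have rM r : r *: M = block_mx (- (r *: A)) (r *: B) 0 (- (r *: A)).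
    by rewrite scale_block_mx scaler0 scalerN.
  have := expD E M s t; rewrite !rM !exp_block mulmx_block.
  by move=> /eq_block_mx[].
have U'E : exp_ur E (- (t *: A)) (t *: (exp (- (s *: A)) *m B *m exp (s *: A)))
      (- (t *: A))
  = exp (- (s *: A)) *m exp_ur E (- (t *: A)) (t *: B) (- (t *: A))
      *m exp (s *: A).
  have c1 : exp (- (s *: A)) *m (- (t *: A)) = (- (t *: A)) *m exp (- (s *: A)).
    by rewrite mulmxN mulNmx -scalemxAr -scalemxAl exp_opp_comm.
  have c2 : (- (t *: A)) *m exp (s *: A) = exp (s *: A) *m (- (t *: A)).
    by rewrite mulmxN mulNmx -scalemxAr -scalemxAl exp_scale_comm.
  rewrite (exp_ur_mull E _ _ c1) (exp_ur_mulr E _ _ c2).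
  by rewrite -scalemxAr -scalemxAl.
rewrite /exp_int UE U'E mulmxDl addrC; congr (_ + _).
  by rewrite addrC expD mulmxA -(mulmxA (exp_ur _ _ _ _)) exp_opp_mul mulmx1.
by rewrite expD mulmxA.
Qed.

Lemma exp_int_intertwine G t A B A' B' : G *m A = A' *m G -> G *m B = B' *m G ->
  G *m exp_int t A B = exp_int t A' B' *m G.
Proof.
move=> GA GB; rewrite /exp_int mulmxA.
have GA' : G *m (- (t *: A)) = (- (t *: A')) *m G.
  by rewrite mulmxN mulNmx -scalemxAr -scalemxAl GA.
rewrite (exp_ur_mull E _ _ GA') -mulmxA.
rewrite (_ : exp (t *: A') *m G = G *m exp (t *: A)); last first.
  by apply/esym/exp_intertwine; rewrite -scalemxAr -scalemxAl GA.
rewrite mulmxA (exp_ur_mulr E _ _ (esym GA')) -scalemxAr -scalemxAl GB.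
by [].
Qed.

Lemma exp_int_differentiable (V : normedModType C) (t : V -> C)
    (A B : V -> 'M[C]_N) x :
  differentiable t x -> differentiable A x -> differentiable B x ->
  differentiable (fun y => exp_int (t y) (A y) (B y)) x.
Proof.
move=> dt dA dB.
have dZ (F : V -> 'M[C]_N) : differentiable F x ->
    differentiable (fun y => t y *: F y) x.
  move=> dF; apply: differentiable_mx => i j; under eq_fun do rewrite mxE.
  by apply: differentiableM => //; exact: differentiable_entry.
have dNA : differentiable (fun y => - (t y *: A y)) x.
  by apply: differentiableN; exact: dZ.
have dexp q (F : V -> 'M[C]_q) : differentiable F x ->
    differentiable (fun y => exp (F y)) x.
  move=> dF; apply: (differentiable_comp (g := exp (N := q))) => //.
  exact: exp_differentiable.
apply: differentiable_mulmx; last by apply: dexp; exact: dZ.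
apply: differentiable_mx => i j.
rewrite (_ : (fun y => _) = fun y => exp (block_mx (- (t y *: A y)) (t y *: B y)
   0 (- (t y *: A y))) (lshift N i) (rshift N j)); last first.
  by apply/funext => y; rewrite /exp_ur mxE mxE.
apply: differentiable_entry; apply: dexp; apply: differentiable_mx => k l.
case: (splitP k) => k' kE; case: (splitP l) => l' lE.
- rewrite (_ : (fun y => _) = fun y => (- (t y *: A y)) k' l').
    exact: differentiable_entry.
  apply/funext => y; rewrite (_ : k = lshift N k'); last exact: val_inj.
  by rewrite (_ : l = lshift N l') ?block_mxEul//; exact: val_inj.
- rewrite (_ : (fun y => _) = fun y => (t y *: B y) k' l').
    by apply: differentiable_entry; exact: dZ.
  apply/funext => y; rewrite (_ : k = lshift N k'); last exact: val_inj.
  by rewrite (_ : l = rshift N l') ?block_mxEur//; exact: val_inj.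
- rewrite (_ : (fun y => _) = fun y => 0); first exact: differentiable_cst.
  apply/funext => y; rewrite (_ : k = rshift N k'); last exact: val_inj.
  by rewrite (_ : l = lshift N l') ?block_mxEdl ?mxE//; exact: val_inj.
- rewrite (_ : (fun y => _) = fun y => (- (t y *: A y)) k' l').
    exact: differentiable_entry.
  apply/funext => y; rewrite (_ : k = rshift N k'); last exact: val_inj.
  by rewrite (_ : l = rshift N l') ?block_mxEdr//; exact: val_inj.
Qed.

Lemma exp_curve0 q (A : 'M[C]_q) :
  is_derive (0 : C) (1 : C) (fun s : C => exp (s *: A)) A.
Proof.
by apply: (is_derive_eq (exp_curve E A 0)); rewrite scale0r exp_zero mulmx1.
Qed.

Lemma exp_opp_curve0 q (A : 'M[C]_q) :
  is_derive (0 : C) (1 : C) (fun s : C => exp (- (s *: A))) (- A).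
Proof. by under eq_fun do rewrite -scalerN; exact: exp_curve0. Qed.

Lemma exp_int_derive0 A B :
  is_derive (0 : C) (1 : C) (fun t => exp_int t A B) B.
Proof.
pose M := block_mx (- A) B 0 (- A).
have tM t : t *: M = block_mx (- (t *: A)) (t *: B) 0 (- (t *: A)).
  by rewrite scale_block_mx scaler0 scalerN.
have dU : is_derive (0 : C) (1 : C)
    (fun t => exp_ur E (- (t *: A)) (t *: B) (- (t *: A))) B.
  apply: is_derive_mx => i j.
  have := is_derive_coord (lshift N i) (rshift N j) (exp_curve0 M).
  rewrite /M block_mxEur => H; apply: (is_derive_ext H) => // t.
  by rewrite -/M tM /exp_ur mxE mxE.
apply: (is_derive_eq (is_derive_mulmx dU (exp_curve0 A))).
rewrite scale0r exp_zero mulmx1 /exp_ur !scale0r oppr0 block_mx0 exp_zero.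
by rewrite scalar_mx_block block_mxKur mul0mx addr0.
Qed.

(** The derivative of the power [Y^k] in the direction [T], see [is_derive_expr_mx]. *)
Definition pow_diff (k : nat) Y T : 'M[C]_N :=
  \sum_(a < k) Y ^+ a *m T *m Y ^+ (k - a.+1).

(** A telescoping sum. It turns a commutator with [Y^k] into one with [Y], which is what a change of
    [X] contributes to the moment map. *)
Lemma pow_diff_comm k Y T :
  Y *m pow_diff k Y T - pow_diff k Y T *m Y = Y ^+ k *m T - T *m Y ^+ k.
Proof.
pose f a := Y ^+ a *m T *m Y ^+ (k - a).
rewrite mulmx_sumr mulmx_suml -sumrB.
transitivity (\sum_(a < k) (f a.+1 - f a)).
  apply: eq_bigr => a _; rewrite /f mulmxE !mulrA -exprS; congr (_ - _).
  by rewrite -!mulrA -exprSr subnSK.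
rewrite -(big_mkord xpredT (fun a => f a.+1 - f a)) telescope_sumr//.
by rewrite /f subnn subn0 expr0 mulmxE mulr1 mul1r.
Qed.

Lemma pow_diff_intertwine k G Y T Y' T' : G *m Y = Y' *m G -> G *m T = T' *m G ->
  G *m pow_diff k Y T = pow_diff k Y' T' *m G.
Proof.
move=> GY GT; have GX a : G *m Y ^+ a = Y' ^+ a *m G.
  elim: a => [|a IH]; first by rewrite !expr0 -!idmxE mulmx1 mul1mx.
  by rewrite !exprS -!mulmxE mulmxA GY -!mulmxA IH.
rewrite mulmx_sumr mulmx_suml; apply: eq_bigr => a _.
by rewrite !mulmxA GX -(mulmxA _ G) GT -!mulmxA GX.
Qed.

Lemma pow_diff_linear k Y : linear (pow_diff k Y).
Proof.
move=> a T T'; rewrite /pow_diff scaler_sumr -big_split /=.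
by apply: eq_bigr => l _; rewrite mulmxDr mulmxDl -scalemxAr -scalemxAl.
Qed.
HB.instance Definition _ k Y :=
  GRing.isLinear.Build _ _ _ _ _ (@pow_diff_linear k Y).

Lemma expr_mx_differentiable (V : normedModType C) (Y : V -> 'M[C]_N) k x :
  differentiable Y x -> differentiable (fun y => Y y ^+ k) x.
Proof.
move=> dY; elim: k => [|k IH].
  by under eq_fun do rewrite expr0; exact: differentiable_cst.
by under eq_fun do rewrite exprS -mulmxE; exact: differentiable_mulmx.
Qed.

Lemma pow_diff_differentiable (V : normedModType C) (Y T : V -> 'M[C]_N) k x :
  differentiable Y x -> differentiable T x ->
  differentiable (fun y => pow_diff k (Y y) (T y)) x.
Proof.
move=> dY dT; apply: differentiable_bigsum => a _.
apply: differentiable_mulmx; last exact: expr_mx_differentiable.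
by apply: differentiable_mulmx => //; exact: expr_mx_differentiable.
Qed.

Lemma is_derive_expr_mx (V : normedModType C) (Y : V -> 'M[C]_N) k x v
    (dY : 'M[C]_N) : is_derive x v Y dY ->
  is_derive x v (fun y => Y y ^+ k) (pow_diff k (Y x) dY).
Proof.
move=> H; elim: k => [|k IH].
  under eq_fun do rewrite expr0; rewrite /pow_diff big_ord0.
  exact: is_derive_cst.
under eq_fun do rewrite exprSr -mulmxE.
apply: (is_derive_eq (is_derive_mulmx IH H)).
rewrite /pow_diff big_ord_recr /= subnn expr0 -idmxE mulmx1; congr (_ + _).
rewrite mulmx_suml; apply: eq_bigr => a _; rewrite mulmxE -mulrA -exprSr.
by rewrite subnSK// subSn// ltnW.
Qed.

End ExponentialIntegral.

(** * Representations of the cyclic quiver as block matrices *)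

Section BlockMatrices.
Context {C : numClosedFieldType} {m n : nat}.
Local Notation N := (\sum_(i < m) n)%N.
Local Notation cmvec := (@cm_vector C m n).
Implicit Types (z : cmvec) (T : 'M[C]_N).

(* The maps of the quiver representation [z] assembled into matrices acting on
   [V_0 (+) ... (+) V_(m-1)]. *)
Definition blockY z : 'M[C]_N :=
  \mxblock_(i < m, j < m) (if j == ordS i then cmY z i else 0 : 'M[C]_n).
Definition blockv z : 'M[C]_(N, 1) := \mxcol_(i < m) cmv z i.
Definition blockw z : 'M[C]_(1, N) := \mxrow_(i < m) cmw z i.
Definition block_of T (i j : 'I_m) : 'M[C]_n := submxblock T i j.

Lemma block_of_mulYl z T i j :
  block_of (blockY z *m T) i j = cmY z i *m block_of T (ordS i) j.
Proof.
rewrite /block_of -{1}(submxblockK T) mul_mxblock mxblockK (bigD1 (ordS i)) //=.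
by rewrite eqxx big1 ?addr0// => l /negbTE ->; rewrite mul0mx.
Qed.

Lemma block_of_mulYr z T i j :
  block_of (T *m blockY z) i j = block_of T i (ord_pred j) *m cmY z (ord_pred j).
Proof.
rewrite /block_of -{1}(submxblockK T) mul_mxblock mxblockK (bigD1 (ord_pred j)) //=.
rewrite ord_predK eqxx big1 ?addr0// => l lj; case: eqP => [jl|]; last by rewrite mulmx0.
by case/eqP: lj; rewrite jl ordSK.
Qed.

Lemma mxtrace_mulY z T :
  \tr (blockY z *m T) = \sum_i \tr (cmY z i *m block_of T (ordS i) i).
Proof.
rewrite -(submxblockK (blockY z *m T)) mxtrace_mxblock.
by apply: eq_bigr => i _; rewrite -block_of_mulYl.
Qed.

Lemma block_of_mul_vw z z' i j :
  block_of (blockv z *m blockw z') i j = cmv z i *m cmw z' j.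
Proof. by rewrite /block_of mul_mxcol_mxrow mxblockK. Qed.

Lemma blockv_block z : forall i, submxcol (blockv z) i = cmv z i.
Proof. by move=> i; rewrite mxcolK. Qed.

Lemma blockw_block z : forall i, submxrow (blockw z) i = cmw z i.
Proof. by move=> i; rewrite mxrowK. Qed.

Lemma iterSr_ordS k (i : 'I_m) : iter k (@ordS m) (ordS i) = ordS (iter k (@ordS m) i).
Proof. by rewrite -iterSr. Qed.

Lemma block_of_1 (i j : 'I_m) : block_of 1%:M i j = if i == j then 1%:M else 0.
Proof.
apply/matrixP => a b; rewrite !mxE -val_eqE /= tagnat.eq_Rank.
by case: eqP => _; rewrite !mxE ?val_eqE.
Qed.

Lemma block_of_Yexp z k i j : block_of (blockY z ^+ k) i j =
  if j == iter k (@ordS m) i then \prod_(0 <= l < k) cmY z (iter l (@ordS m) i) else 0.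
Proof.
elim: k j => [|k IH] j.
  by rewrite expr0 big_geq//= -!idmxE block_of_1 eq_sym.
rewrite exprSr -mulmxE block_of_mulYr IH big_nat_recr //= -mulmxE.
rewrite -(inj_eq (can_inj (@ordSK m)) (ord_pred j)) ord_predK.
case: eqP => [jE|_]; last by rewrite mul0mx.
by congr (_ *m cmY z _); rewrite jE ordSK.
Qed.

(** A path of length [k] that starts at [i] in the cyclic quiver can only end at [i + k], so all
    other blocks of [Y^k] in row [i] vanish. *)
Lemma cm_hamiltonianE k z :
  cm_hamiltonian k z = - (blockw z *m blockY z ^+ k *m blockv z) ord0 ord0.
Proof.
rewrite /cm_hamiltonian; congr (- _).
rewrite -(submxblockK (blockY z ^+ k)) mul_mxrow_mxblock mul_mxrow_mxcol summxE.
under [RHS]eq_bigr => j _ do rewrite mulmx_suml summxE.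
rewrite exchange_big; apply: eq_bigr => i _.
rewrite [RHS](bigD1 (iter k (@ordS m) i)) //= [X in _ = _ + X]big1 ?addr0 => [|j ji].
  by rewrite [submxblock _ _ _](block_of_Yexp z k) eqxx.
by rewrite [submxblock _ _ _](block_of_Yexp z k i j) (negbTE ji) mulmx0 mul0mx mxE.
Qed.

Lemma gauge_blockY g z : (forall i, g i \in unitmx) ->
  (\mxdiag_(i < m) g i) *m blockY z = blockY (gauge g z) *m (\mxdiag_(i < m) g i).
Proof.
move=> ug; rewrite mul_mxdiag_mxblock mul_mxblock_mxdiag; apply/eq_mxblockP => i j.
rewrite /gauge !cmE; case: eqP => [->|_]; last by rewrite mulmx0 mul0mx.
by rewrite mulmxKV.
Qed.

Lemma gauge_blockv g z : (\mxdiag_(i < m) g i) *m blockv z = blockv (gauge g z).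
Proof. by rewrite mul_mxdiag_mxcol /gauge /blockv !cmE. Qed.

Lemma gauge_blockw g z : (forall i, g i \in unitmx) ->
  blockw z = blockw (gauge g z) *m (\mxdiag_(i < m) g i).
Proof.
move=> ug; rewrite mul_mxrow_mxdiag; apply/eq_mxrowP => i.
by rewrite /gauge !cmE mulmxKV.
Qed.

Lemma block_of_gauge g T T' i j : (\mxdiag_(i < m) g i) *m T = T' *m (\mxdiag_(i < m) g i) ->
  g i *m block_of T i j = block_of T' i j *m g j.
Proof.
rewrite -{1}(submxblockK T) -{1}(submxblockK T') mul_mxdiag_mxblock mul_mxblock_mxdiag.
by move=> /eq_mxblockP /(_ i j).
Qed.

End BlockMatrices.

(** * The explicit Hamiltonian flow on the representation space *)

Section Flow.
Context {C : numClosedFieldType} (E : exponential C) {m n : nat}.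
Local Notation N := (\sum_(i < m) n)%N.
Local Notation cmvec := (@cm_vector C m n).
Local Notation exp := (exp_of E).
Implicit Types (z : cmvec) (lam : 'I_m -> C).

(** The time integral of [pow_diff k Y (v(s) w(s))] along the solution, taken inside [pow_diff] by
    linearity. *)
Definition flow_int k t z : 'M[C]_N :=
  pow_diff k (blockY z) (exp_int E t (blockY z ^+ k) (blockv z *m blockw z)).

(** The solution of Hamilton's equations in closed form: [Y] is constant, and [X_i] sits at block
    [(i + 1, i)] because it maps [V_i] to [V_(i+1)]. *)
Definition flow k t z : cmvec :=
  mk_cm (fun i => cmX z i - block_of (flow_int k t z) (ordS i) i)
        (cmY z)
        (fun i => submxcol (exp (- (t *: blockY z ^+ k)) *m blockv z) i)
        (fun i => submxrow (blockw z *m exp (t *: blockY z ^+ k)) i).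

(** The Hamiltonian vector field of [cm_hamiltonian k] for [cm_form], as [ham_field_form] shows. *)
Definition ham_field k z : cmvec :=
  mk_cm (fun i => - block_of (pow_diff k (blockY z) (blockv z *m blockw z)) (ordS i) i)
        (fun=> 0)
        (fun i => - submxcol (blockY z ^+ k *m blockv z) i)
        (fun i => submxrow (blockw z *m blockY z ^+ k) i).

Lemma flow_blockY k t z : blockY (flow k t z) = blockY z.
Proof. by rewrite /blockY /flow !cmE. Qed.

Lemma flow_blockv k t z :
  blockv (flow k t z) = exp (- (t *: blockY z ^+ k)) *m blockv z.
Proof. by rewrite /blockv /flow !cmE submxcolK. Qed.

Lemma flow_blockw k t z :
  blockw (flow k t z) = blockw z *m exp (t *: blockY z ^+ k).
Proof. by rewrite /blockw /flow !cmE submxrowK. Qed.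

Lemma flow0 k z : flow k 0 z = z.
Proof.
rewrite -[RHS]mk_cmK /flow /flow_int exp_int0 !scale0r oppr0 exp_zero mul1mx mulmx1.
congr mk_cm; apply/funext => i; rewrite ?mxcolK ?mxrowK//.
by rewrite linear0 /block_of submxblock0 subr0.
Qed.

Lemma flowD k s t z : flow k (s + t) z = flow k t (flow k s z).
Proof.
rewrite {2}/flow flow_blockY flow_blockv flow_blockw.
rewrite {1}/flow; congr mk_cm; apply/funext => i.
- rewrite /flow_int flow_blockY flow_blockv flow_blockw exp_intD linearD /=.
  rewrite /block_of submxblockD opprD addrA /flow cmXK; congr (_ - _ - submxblock _ _ _).
  by rewrite !mulmxA.
- by rewrite /flow cmYK.
- by rewrite mulmxA -!scalerN addrC expD.
- by rewrite -mulmxA expD.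
Qed.

Lemma gauge_vw g z : (forall i, g i \in unitmx) ->
  (\mxdiag_(i < m) g i) *m (blockv z *m blockw z)
  = blockv (gauge g z) *m blockw (gauge g z) *m (\mxdiag_(i < m) g i).
Proof. by move=> ug; rewrite mulmxA gauge_blockv -mulmxA -gauge_blockw. Qed.

Lemma gauge_Yexp g z k : (forall i, g i \in unitmx) ->
  (\mxdiag_(i < m) g i) *m blockY z ^+ k
  = blockY (gauge g z) ^+ k *m (\mxdiag_(i < m) g i).
Proof.
move=> ug; elim: k => [|k IH]; first by rewrite !expr0 -idmxE mulmx1 mul1mx.
by rewrite !exprS -!mulmxE mulmxA gauge_blockY// -!mulmxA IH.
Qed.

(** The block diagonal matrix of the [g i] intertwines [Y] and [v w] with their transforms, and
    every ingredient of [flow] is natural for intertwiners. *)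
Lemma flow_gauge k t g z : (forall i, g i \in unitmx) ->
  flow k t (gauge g z) = gauge g (flow k t z).
Proof.
move=> ug; set G := \mxdiag_(i < m) g i.
have GI : G *m flow_int k t z = flow_int k t (gauge g z) *m G.
  apply: pow_diff_intertwine; first exact: gauge_blockY.
  by apply: exp_int_intertwine; [exact: gauge_Yexp|exact: gauge_vw].
have Ge s : G *m exp (s *: blockY z ^+ k) = exp (s *: blockY (gauge g z) ^+ k) *m G.
  by apply: exp_intertwine; rewrite -scalemxAr -scalemxAl gauge_Yexp.
rewrite {2}/gauge {1}/flow; congr mk_cm; apply/funext => i.
- rewrite /flow cmXK mulmxBr mulmxBl; congr (_ - _); first by rewrite /gauge cmXK.
  by rewrite (block_of_gauge _ _ GI) mulmxK.
- by rewrite /flow cmYK /gauge cmYK.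
- rewrite -gauge_blockv /flow cmvK -scaleNr mulmxA -Ge -mulmxA scaleNr.
  by rewrite -[_ *m blockv z]submxcolK mul_mxdiag_mxcol !mxcolK.
- apply: (can_inj (mulmxK (ug i))); rewrite mulmxKV// /flow cmwK.
  rewrite [in RHS](gauge_blockw z ug) -mulmxA Ge mulmxA.
  by rewrite -[blockw _ *m exp _]submxrowK mul_mxrow_mxdiag !mxrowK.
Qed.

(** By [pow_diff_comm] and [exp_int_comm] the commutator of [Y] with [flow_int] is [v w] at time 0
    minus [v w] at time [t]. Its diagonal blocks say that the change of the [X] terms compensates
    that of [v_i w_i]. *)
Lemma flow_level lam k t z : cm_level lam z -> cm_level lam (flow k t z).
Proof.
move=> zL i; rewrite -(zL i).
set J := flow_int k t z; set A := blockY z ^+ k; set B := blockv z *m blockw z.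
have cJ : blockY z *m J - J *m blockY z = B - exp (- (t *: A)) *m B *m exp (t *: A).
  by rewrite pow_diff_comm exp_int_comm.
have := congr1 (fun T => block_of T i i) cJ.
rewrite /block_of !submxblockB -/(block_of _ _ _) block_of_mulYl.
rewrite -/(block_of _ _ _) block_of_mulYr -/(block_of B _ _) block_of_mul_vw.
rewrite /B mulmxA -mulmxA -flow_blockv -flow_blockw -/(block_of _ _ _) block_of_mul_vw.
move=> cE; rewrite {1 2 3 4}/flow cmYK cmXK mulmxBr mulmxBl -/J ord_predK.
move: (cmv z i *m _) (cmv (flow k t z) i *m _) (_ *m block_of _ _ _) (block_of _ _ _ *m _) cE.
move=> c c' p q cE; rewrite (_ : c' = c - (p - q)); last by rewrite cE opprB addrC subrK.
move: (_ *m _) (_ *m _) => a b.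
by apply/matrixP => r s; rewrite !mxE; ring.
Qed.

Lemma cm_parts_differentiable (z : cmvec) :
  [/\ differentiable (fun z : cmvec => z.1.1.1) z,
      differentiable (fun z : cmvec => z.1.1.2) z,
      differentiable (fun z : cmvec => z.1.2) z &
      differentiable (fun z : cmvec => z.2) z].
Proof.
have d0 : differentiable (fun z : cmvec => z) z by exact: ex_diff.
have d1 := differentiable_fst d0; have d11 := differentiable_fst d1.
split; [exact: differentiable_fst|exact: differentiable_snd| |].
  exact: differentiable_snd.
exact: differentiable_snd.
Qed.

Lemma blockY_differentiable (z : cmvec) : differentiable (@blockY C m n) z.
Proof.
have [d1 d2 d3 d4] := cm_parts_differentiable z.
apply: differentiable_mx => a b; rewrite /blockY.
case: (eqVneq (tagnat.sig1 b) (ordS (tagnat.sig1 a))) => [ab|ab]; last first.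
  rewrite (_ : (fun y => _) = fun y => 0); first exact: differentiable_cst.
  by apply/funext => y; rewrite mxE (negbTE ab) mxE.
rewrite (_ : (fun y => _) = fun y : cmvec =>
    y.1.1.2 (tagnat.sig1 a) (mxvec_index (tagnat.sig2 a) (tagnat.sig2 b))).
  by apply: differentiable_entry.
by apply/funext => y; rewrite mxE ab eqxx /cmY !mxE.
Qed.

Lemma blockv_differentiable (z : cmvec) : differentiable (@blockv C m n) z.
Proof.
have [d1 d2 d3 d4] := cm_parts_differentiable z.
apply: differentiable_mx => a b; rewrite /blockv /cmv.
under eq_fun do rewrite !mxE; exact: differentiable_entry.
Qed.

Lemma blockw_differentiable (z : cmvec) : differentiable (@blockw C m n) z.
Proof.
have [d1 d2 d3 d4] := cm_parts_differentiable z.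
apply: differentiable_mx => a b; rewrite /blockw /cmw.
under eq_fun do rewrite !mxE; exact: differentiable_entry.
Qed.

Lemma mk_cm_differentiable (V : normedModType C) (X Y : V -> 'I_m -> 'M[C]_n)
    (v : V -> 'I_m -> 'cV[C]_n) (w : V -> 'I_m -> 'rV[C]_n) x :
  (forall i, differentiable (X^~ i) x) -> (forall i, differentiable (Y^~ i) x) ->
  (forall i, differentiable (v^~ i) x) -> (forall i, differentiable (w^~ i) x) ->
  differentiable (fun y => mk_cm (X y) (Y y) (v y) (w y)) x.
Proof.
move=> dX dY dv dw; apply: differentiable_pair; first apply: differentiable_pair;
  first apply: differentiable_pair; apply: differentiable_mx => i j.
- case/mxvec_indexP: j => a b; under eq_fun do rewrite mxE mxvecE.
  exact: differentiable_entry.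
- case/mxvec_indexP: j => a b; under eq_fun do rewrite mxE mxvecE.
  exact: differentiable_entry.
- by under eq_fun do rewrite !mxE; exact: differentiable_entry.
- by under eq_fun do rewrite !mxE; exact: differentiable_entry.
Qed.

Lemma is_derive_mk_cm (V : normedModType C) (X Y : V -> 'I_m -> 'M[C]_n)
    (v : V -> 'I_m -> 'cV[C]_n) (w : V -> 'I_m -> 'rV[C]_n) x h
    (dX dY : 'I_m -> 'M[C]_n) (dv : 'I_m -> 'cV[C]_n) (dw : 'I_m -> 'rV[C]_n) :
  (forall i, is_derive x h (X^~ i) (dX i)) -> (forall i, is_derive x h (Y^~ i) (dY i)) ->
  (forall i, is_derive x h (v^~ i) (dv i)) -> (forall i, is_derive x h (w^~ i) (dw i)) ->
  is_derive x h (fun y => mk_cm (X y) (Y y) (v y) (w y)) (mk_cm dX dY dv dw).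
Proof.
move=> HX HY Hv Hw; apply: is_derive_pair; first apply: is_derive_pair;
  first apply: is_derive_pair; apply: is_derive_mx => i j.
- case/mxvec_indexP: j => a b; rewrite mxE mxvecE.
  under eq_fun do rewrite mxE mxvecE; exact: is_derive_coord.
- case/mxvec_indexP: j => a b; rewrite mxE mxvecE.
  under eq_fun do rewrite mxE mxvecE; exact: is_derive_coord.
- by rewrite !mxE; under eq_fun do rewrite !mxE; exact: is_derive_coord.
- by rewrite !mxE; under eq_fun do rewrite !mxE; exact: is_derive_coord.
Qed.

Lemma cmX_differentiable i (z : cmvec) : differentiable (fun z : cmvec => cmX z i) z.
Proof.
have [d1 d2 d3 d4] := cm_parts_differentiable z.
apply: differentiable_mx => a b; under eq_fun do rewrite /cmX !mxE.
exact: differentiable_entry.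
Qed.

Lemma cmY_differentiable i (z : cmvec) : differentiable (fun z : cmvec => cmY z i) z.
Proof.
have [d1 d2 d3 d4] := cm_parts_differentiable z.
apply: differentiable_mx => a b; under eq_fun do rewrite /cmY !mxE.
exact: differentiable_entry.
Qed.

Lemma cmv_differentiable i (z : cmvec) : differentiable (fun z : cmvec => cmv z i) z.
Proof.
have [d1 d2 d3 d4] := cm_parts_differentiable z.
apply: differentiable_mx => a b; under eq_fun do rewrite /cmv !mxE.
exact: differentiable_entry.
Qed.

Lemma cmw_differentiable i (z : cmvec) : differentiable (fun z : cmvec => cmw z i) z.
Proof.
have [d1 d2 d3 d4] := cm_parts_differentiable z.
apply: differentiable_mx => a b; under eq_fun do rewrite /cmw !mxE.
exact: differentiable_entry.
Qed.

Lemma differentiable_snd_comp (U V W : normedModType C) (F : V -> W) (p : U * V) :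
  differentiable F p.2 -> differentiable (fun p : U * V => F p.2) p.
Proof.
move=> dF; apply: (differentiable_comp (f := snd) (g := F)) => //.
by apply: (differentiable_snd (f := id)); exact: ex_diff.
Qed.

Lemma flow_differentiable k (p : C * cmvec) :
  differentiable (fun p : C * cmvec => flow k p.1 p.2) p.
Proof.
have dY : differentiable (fun p : C * cmvec => blockY p.2) p.
  by apply: differentiable_snd_comp; exact: blockY_differentiable.
have dA := expr_mx_differentiable k dY.
have dv : differentiable (fun p : C * cmvec => blockv p.2) p.
  by apply: differentiable_snd_comp; exact: blockv_differentiable.
have dw : differentiable (fun p : C * cmvec => blockw p.2) p.
  by apply: differentiable_snd_comp; exact: blockw_differentiable.
have dt : differentiable (fun p : C * cmvec => p.1) p.
  by apply: (differentiable_fst (f := id)); exact: ex_diff.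
have dJ : differentiable (fun p : C * cmvec => flow_int k p.1 p.2) p.
  apply: pow_diff_differentiable => //; apply: exp_int_differentiable => //.
  exact: differentiable_mulmx.
have dtA : differentiable (fun p : C * cmvec => p.1 *: blockY p.2 ^+ k) p.
  apply: differentiable_mx => i j; under eq_fun do rewrite mxE.
  by apply: differentiableM => //; exact: differentiable_entry.
have dexp (F : C * cmvec -> 'M[C]_N) : differentiable F p ->
    differentiable (fun y => exp (F y)) p.
  move=> dF; apply: (differentiable_comp (g := exp (N := N))) => //.
  exact: exp_differentiable.
apply: mk_cm_differentiable => i.
- apply: differentiableB.
    by apply: (differentiable_snd_comp (F := fun z => cmX z i)); exact: cmX_differentiable.
  apply: differentiable_mx => a b; under eq_fun do rewrite !mxE.
  exact: differentiable_entry.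
- by apply: (differentiable_snd_comp (F := fun z => cmY z i)); exact: cmY_differentiable.
- apply: differentiable_mx => a b; under eq_fun do rewrite mxE.
  apply: differentiable_entry; apply: differentiable_mulmx => //.
  by apply: dexp; exact: differentiableN.
- apply: differentiable_mx => a b; under eq_fun do rewrite mxE.
  apply: differentiable_entry; apply: differentiable_mulmx => //.
  exact: dexp.
Qed.

Lemma flow_derive0 k z :
  is_derive (0 : C) (1 : C) (fun t => flow k t z) (ham_field k z).
Proof.
have dJ : is_derive (0 : C) (1 : C) (fun t => flow_int k t z)
    (pow_diff k (blockY z) (blockv z *m blockw z)).
  apply: (is_derive_lin (L := pow_diff k (blockY z))).
    exact: linear_mx_continuous.
  exact: exp_int_derive0.
have dv := is_derive_mulmx (exp_opp_curve0 E (blockY z ^+ k)) (is_derive_cst (blockv z) (0 : C^o) 1).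
have dw := is_derive_mulmx (is_derive_cst (blockw z) (0 : C^o) 1) (exp_curve0 E (blockY z ^+ k)).
apply: is_derive_mk_cm => i.
- have dB : is_derive (0 : C) (1 : C) (fun t => block_of (flow_int k t z) (ordS i) i)
      (block_of (pow_diff k (blockY z) (blockv z *m blockw z)) (ordS i) i).
    apply: is_derive_mx => a b; rewrite !mxE; under eq_fun do rewrite !mxE.
    exact: is_derive_coord.
  apply: (is_derive_ext (is_deriveB (is_derive_cst (cmX z i) (0 : C^o) 1) dB)) => //.
  by rewrite sub0r.
- exact: (is_derive_cst (cmY z i) (0 : C^o) 1).
- apply: is_derive_mx => a b; under eq_fun do rewrite mxE.
  apply: (is_derive_eq (is_derive_coord _ _ dv)).
  by rewrite mulmx0 addr0 mulNmx !mxE.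
- apply: is_derive_mx => a b; under eq_fun do rewrite mxE.
  apply: (is_derive_eq (is_derive_coord _ _ dw)).
  by rewrite mul0mx add0r !mxE.
Qed.

End Flow.

(** * Descent of a flow to the orbit space of a level set *)

Section OrbitSpace.
Context {C : numClosedFieldType} {V : normedModType C} {L : set V} {e : equiv_rel L}.
Local Notation Q := (orbit_space e).

Lemma level_nbhsP (x : L) (A : set L) :
  nbhs x A <-> exists2 O : set V, nbhs (val x) O & forall y : L, O (val y) -> A y.
Proof.
split.
  rewrite nbhsE => -[B [[P oP <-] /= Px] BA]; exists P; first exact: open_nbhs_nbhs.
  by move=> y Oy; exact: BA.
case=> O; rewrite nbhsE => -[P [oP Px] PO] OA; rewrite nbhsE.
exists (val @^-1` P); last by move=> y /PO /OA.
by split; [exists P|].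
Qed.

Lemma val_level_continuous : continuous (val : L -> V).
Proof. by move=> x A Ax; apply/level_nbhsP; exists A. Qed.

Hypothesis orbits : forall x y : L, e x y -> exists g : V -> V,
  [/\ {for val x, continuous g}, val y = g (val x) &
      forall z : L, exists2 w : L, val w = g (val z) & e z w].

(** If [x] is equivalent to [y] in [A], the ambient map that carries [x] to [y] pulls a
    neighbourhood of [y] back to one of [x] whose points are all equivalent to points of [A]. *)
Lemma orbit_map_open (A : set L) : open A -> open ((\pi_Q : L -> Q) @` A).
Proof.
move=> oA; rewrite /open /= /quotient_open openE => x [y Ay yx].
have /(eqmodP e)/= exy : \pi_Q x = \pi_Q y by rewrite yx.
have [g [cg yE gL]] := orbits exy.
have /level_nbhsP[W Oy OA] : nbhs y A by apply: open_nbhs_nbhs.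
apply/level_nbhsP; exists (g @^-1` W); first by apply: cg; rewrite -yE.
move=> z /= Oz; have [w wE ezw] := gL z.
exists w; first by apply: OA; rewrite wE.
by apply/esym/(eqmodP e).
Qed.

Variables (F : C * V -> V) (lift : C -> L -> L).
Hypothesis liftE : forall t x, val (lift t x) = F (t, val x).
Hypothesis dF : forall p, differentiable F p.
Hypothesis lift_equiv : forall t x y, e x y -> e (lift t x) (lift t y).

Definition orbit_flow (t : C) (q : Q) : Q := \pi_Q (lift t (repr q)).

Lemma orbit_flow_pi t (x : L) : orbit_flow t (\pi_Q x) = \pi_Q (lift t x).
Proof.
apply/(eqmodP e)/lift_equiv/(eqmodP e); exact: (reprK (\pi_Q x)).
Qed.

Lemma lift_near t (x : L) (A : set L) : nbhs (lift t x) A ->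
  exists2 B : set (C * V), nbhs (t, val x) B &
    forall s (y : L), B (s, val y) -> A (lift s y).
Proof.
move=> /level_nbhsP[W Ox OA]; exists (F @^-1` W).
  by apply: (differentiable_continuous (dF (t, val x))); rewrite -liftE.
by move=> s y Oy; apply: OA; rewrite liftE.
Qed.

(** Joint continuity requires product neighbourhoods in [C * Q]; as the projection is open, images
    of neighbourhoods in the level provide them. *)
Lemma orbit_flow_continuous :
  continuous (fun p : C * Q => orbit_flow p.1 p.2).
Proof.
move=> [t q]; elim/quotW: q => x A /=; rewrite orbit_flow_pi => Ax.
have Ax' := @pi_continuous L {eq_quot e} (lift t x) A Ax.
have [B [[B1 B2] /= [tB1 xB2] B12] BA] := lift_near Ax'.
have [P [oP Px] PB2] : exists2 P, open_nbhs (val x) P & P `<=` B2.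
  by move: xB2; rewrite nbhsE.
have nP : nbhs (\pi_Q x : Q) ((\pi_Q : L -> Q) @` (val @^-1` P : set L)).
  apply: open_nbhs_nbhs; split; last by exists x.
  by apply: orbit_map_open; exists P.
exists (B1, (\pi_Q : L -> Q) @` (val @^-1` P : set L)) => //=.
move=> [s q] /= [B1s [y Oy <-]]; rewrite orbit_flow_pi; apply: BA; apply: B12.
by split=> //; exact: PB2.
Qed.

(** A local extension of [f] at the endpoint, composed with the ambient map [F], is a local
    extension of the pulled back function. *)
Lemma orbit_flow_holomorphic (U : set Q) (f : Q -> C) : open U ->
  holomorphic_on U f ->
  holomorphic_on_time [set p | U (orbit_flow p.1 p.2)]
                      (fun p => f (orbit_flow p.1 p.2)).
Proof.
move=> oU hf t x /=; rewrite orbit_flow_pi => /hf[H [dH Hf]].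
exists (fun p => H (F p)); split.
  rewrite liftE in dH.
  have dHF : nbhs (t, val x) [set p | differentiable H (F p)].
    exact: (differentiable_continuous (dF (t, val x)) dH).
  by apply: (filterS _ dHF) => p /= dHp; exact: (differentiable_comp (dF p) dHp).
have [B [[B1 B2] /= [tB1 xB2] B12] BA] := lift_near Hf.
exists (B1, val @^-1` B2) => /=; first by split=> //; exact: val_level_continuous.
move=> [s y] /= [B1s B2y]; rewrite orbit_flow_pi -(BA s y) ?liftE//.
by apply: B12.
Qed.

Lemma orbit_flow_complete :
  (forall x, lift 0 x = x) -> (forall s t x, lift (s + t) x = lift s (lift t x)) ->
  complete_flow orbit_flow.
Proof.
move=> l0 lD; have piP q : exists x, q = \pi_Q x by exists (repr q); rewrite reprK.
split.
- by move=> q; have [x ->] := piP q; rewrite orbit_flow_pi l0.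
- by move=> s t q; have [x ->] := piP q; rewrite !orbit_flow_pi lD.
- exact: orbit_flow_continuous.
- exact: orbit_flow_holomorphic.
Qed.

End OrbitSpace.

(** * The complete flow on the Calogero-Moser space *)

Section CompleteFlow.
Context {C : numClosedFieldType} (E : exponential C) {m n : nat} {lam : 'I_m -> C}.
Local Notation L := (@cm_level C m n lam).
Local Notation Q := (@cm_space C m n lam).
Local Notation cmvec := (@cm_vector C m n).

Lemma gauge_differentiable g (z : cmvec) : differentiable (gauge g) z.
Proof.
apply: mk_cm_differentiable => i.
- apply: differentiable_mulmx; last exact: differentiable_cst.
  apply: differentiable_mulmx; first exact: differentiable_cst.
  exact: cmX_differentiable.
- apply: differentiable_mulmx; last exact: differentiable_cst.
  apply: differentiable_mulmx; first exact: differentiable_cst.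
  exact: cmY_differentiable.
- apply: differentiable_mulmx; first exact: differentiable_cst.
  exact: cmv_differentiable.
- apply: differentiable_mulmx; last exact: differentiable_cst.
  exact: cmw_differentiable.
Qed.

Lemma gauge_level g z : (forall i, g i \in unitmx) -> L z -> L (gauge g z).
Proof.
move=> ug zL i; rewrite /gauge !cmE ord_predK.
rewrite !mulmxA !(mulmxKV (ug _)) -!mulmxBl -!(mulmxA (g i)) -!mulmxBr zL.
by rewrite mul_mx_scalar -scalemxAl mulmxV// scalemx1.
Qed.

Lemma cm_orbits (x y : L) : same_cm_equiv lam x y -> exists g : cmvec -> cmvec,
  [/\ {for val x, continuous g}, val y = g (val x) &
      forall z : L, exists2 w : L, val w = g (val z) & same_cm_equiv lam z w].
Proof.
move=> /asboolP[g ug yE]; exists (gauge g); split.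
- exact: (differentiable_continuous (gauge_differentiable g _)).
- exact: yE.
- move=> z; exists (level_point (gauge_level ug (set_mem (valP z)))); first by [].
  by apply/asboolP; exists g.
Qed.

Definition level_flow k t (x : L) : L :=
  level_point (flow_level E k t (set_mem (valP x))).

Lemma level_flow_equiv k t (x y : L) : same_cm_equiv lam x y ->
  same_cm_equiv lam (level_flow k t x) (level_flow k t y).
Proof.
move=> /asboolP[g ug yE]; apply/asboolP; exists g => //=.
by rewrite -flow_gauge// -yE.
Qed.

Definition cm_flow k : C -> Q -> Q := orbit_flow (e := same_cm_equiv lam) (level_flow k).

Lemma cm_flow_complete k : complete_flow (cm_flow k).
Proof.
apply: (@orbit_flow_complete _ _ _ _ cm_orbits (fun p => flow E k p.1 p.2) (level_flow k)).
- by [].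
- exact: flow_differentiable.
- exact: level_flow_equiv.
- by move=> x; apply: val_inj; exact: flow0.
- by move=> s t x; apply: val_inj; rewrite addrC; exact: flowD.
Qed.

End CompleteFlow.

Lemma differentiable_pow (C : numFieldType) (V : normedModType C) (f : V -> C) k x :
  differentiable f x -> differentiable (fun y => f y ^+ k) x.
Proof.
move=> df; elim: k => [|k IH].
  by under eq_fun do rewrite expr0; exact: differentiable_cst.
by under eq_fun do rewrite exprS; exact: differentiableM.
Qed.

(** * Coordinates, tangent vectors and curves of the phase space *)

Section PhaseSpace.
Context {C : numClosedFieldType} {m n : nat}.
Local Notation V := (@phase_vector C m n).
Implicit Types (x h : V) (lam : 'I_m -> C).

Lemma phase_parts_differentiable x :
  [/\ forall j, differentiable (fun x : V => nu x j) x,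
      forall j, differentiable (fun x : V => mu x j) x,
      forall j r, differentiable (fun x : V => phi x j r) x &
      forall r j, differentiable (fun x : V => psi x r j) x].
Proof.
have d0 : differentiable (fun x : V => x) x by exact: ex_diff.
have d1 := differentiable_fst d0; have d11 := differentiable_fst d1.
split=> [j|j|j r|r j]; apply: differentiable_entry.
- exact: differentiable_fst.
- exact: differentiable_snd.
- exact: differentiable_snd.
- exact: differentiable_snd.
Qed.

Lemma is_derive_phase_parts (W : normedModType C) (c : W -> V) t v (dc : V) :
  is_derive t v c dc ->
  [/\ forall j, is_derive t v (fun s => nu (c s) j) (nu dc j),
      forall j, is_derive t v (fun s => mu (c s) j) (mu dc j),
      forall j r, is_derive t v (fun s => phi (c s) j r) (phi dc j r) &
      forall r j, is_derive t v (fun s => psi (c s) r j) (psi dc r j)].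
Proof.
move=> d0; have d1 := is_derive_fst d0; have d11 := is_derive_fst d1.
split=> [j|j|j r|r j]; apply: is_derive_coord.
- exact: is_derive_fst.
- exact: is_derive_snd.
- exact: is_derive_snd.
- exact: is_derive_snd.
Qed.

Lemma is_derive_phase (W : normedModType C) (c : W -> V) t v (dc : V) :
  (forall j, is_derive t v (fun s => nu (c s) j) (nu dc j)) ->
  (forall j, is_derive t v (fun s => mu (c s) j) (mu dc j)) ->
  (forall j r, is_derive t v (fun s => phi (c s) j r) (phi dc j r)) ->
  (forall r j, is_derive t v (fun s => psi (c s) r j) (psi dc r j)) ->
  is_derive t v c dc.
Proof.
move=> H1 H2 H3 H4.
have -> : c = fun s => ((c s).1.1.1, (c s).1.1.2, (c s).1.2, (c s).2).
  by apply/funext => s; case: (c s) => [[[]]].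
rewrite [dc](_ : _ = (dc.1.1.1, dc.1.1.2, dc.1.2, dc.2)); last by case: dc {H1 H2 H3 H4} => [[[]]].
apply: is_derive_pair; first apply: is_derive_pair; first apply: is_derive_pair;
  apply: is_derive_mx => a b; rewrite ?[a]ord1.
- exact: H1.
- exact: H2.
Qed.

Lemma phase_vectorP x x' : (forall j, nu x j = nu x' j) -> (forall j, mu x j = mu x' j) ->
  (forall j r, phi x j r = phi x' j r) -> (forall r j, psi x r j = psi x' r j) -> x = x'.
Proof.
case: x x' => [[[a b] c] d] [[[a' b'] c'] d'] /= H1 H2 H3 H4.
have -> : a = a' by apply/rowP => j; exact: H1.
have -> : b = b' by apply/rowP => j; exact: H2.
have -> : c = c' by apply/matrixP => j r; exact: H3.
by have -> : d = d' by apply/matrixP => r j; exact: H4.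
Qed.

Lemma nuD x h j : nu (x + h) j = nu x j + nu h j. Proof. by rewrite /nu mxE. Qed.
Lemma muD x h j : mu (x + h) j = mu x j + mu h j. Proof. by rewrite /mu mxE. Qed.
Lemma phiD x h j r : phi (x + h) j r = phi x j r + phi h j r.
Proof. by rewrite /phi mxE. Qed.
Lemma psiD x h r j : psi (x + h) r j = psi x r j + psi h r j.
Proof. by rewrite /psi mxE. Qed.
Lemma nuZ a h j : nu (a *: h) j = a * nu h j. Proof. by rewrite /nu mxE. Qed.
Lemma muZ a h j : mu (a *: h) j = a * mu h j. Proof. by rewrite /mu mxE. Qed.
Lemma phiZ a h j r : phi (a *: h) j r = a * phi h j r. Proof. by rewrite /phi mxE. Qed.
Lemma psiZ a h r j : psi (a *: h) r j = a * psi h r j. Proof. by rewrite /psi mxE. Qed.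

Lemma hreg_near x : hreg x -> \forall y \near x, hreg y.
Proof.
move=> xreg; have [d1 _ _ _] := phase_parts_differentiable x.
apply: (near_neq0 (f := fun y : V => (\prod_j nu y j) *
  \prod_(j < n) \prod_(k < n | (j < k)%N) (nu y j ^+ m - nu y k ^+ m))) xreg.
apply: differentiableM; first exact: differentiable_bigprod.
apply: differentiable_bigprod => j _; apply: differentiable_bigprod => k _.
by apply: differentiableB; exact: differentiable_pow.
Qed.

Definition phase_dmom x h (j : 'I_n) : C :=
  \sum_r (phi h j r * psi x r j + phi x j r * psi h r j).

Lemma phase_moment_diff x h : 'd (@phase_moment C m n) x h = \row_j phase_dmom x h j.
Proof.
have [_ _ d3 d4] := phase_parts_differentiable x.
apply: diff_is_derive.
  apply: differentiable_mx => i j; rewrite /phase_moment.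
  under eq_fun do rewrite mxE.
  by apply: differentiable_bigsum => r _; exact: differentiableM.
have [_ _ i3 i4] := is_derive_phase_parts (is_derive_id x h).
apply: is_derive_mx => i j; rewrite mxE /phase_moment.
under eq_fun do rewrite mxE.
by apply: is_derive_bigsum => r _; exact: is_derive_mul.
Qed.

Lemma phase_tangentP lam (x : phase_level lam) h :
  tangent (@phase_moment C m n) x h <-> forall j, phase_dmom (val x) h j = 0.
Proof.
rewrite /tangent /= phase_moment_diff; split=> [/rowP H j|H].
  by have := H j; rewrite !mxE.
by apply/rowP => j; rewrite !mxE.
Qed.

(** The line [x + s h] pushed back into the level: [psi_j] is rescaled until its pairing with
    [phi_j] equals [c] again. *)
Definition phase_curve x h (c : C) (s : C) : V :=
  (x.1.1.1 + s *: h.1.1.1, x.1.1.2 + s *: h.1.1.2, x.1.2 + s *: h.1.2,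
   \matrix_(r, j) (c / (\sum_q phi (x + s *: h) j q * psi (x + s *: h) q j)
                   * psi (x + s *: h) r j)).

(** For tangent [h] the pairings are constant to first order, so the correction factor has
    derivative 0 and the velocity is still [h]. This explicit curve does the work of an implicit
    function theorem. *)
Lemma phase_curveP lam (x : phase_level lam) h :
  \sum_r lam r != 0 -> tangent (@phase_moment C m n) x h ->
  exists c : C -> V, [/\ c 0 = val x, is_derive (0 : C) (1 : C) c h &
    \forall s \near (0 : C), phase_level lam (c s)].
Proof.
move=> lam0 /phase_tangentP th; set c0 := - \sum_r lam r.
have c00 : c0 != 0 by rewrite oppr_eq0.
have [xreg /rowP xmom] := set_mem (valP x).
have momE j : \sum_q phi (val x) j q * psi (val x) q j = c0.
  by have := xmom j; rewrite !mxE.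
pose c := phase_curve (val x) h c0.
have cE0 : c 0 = val x.
  apply: phase_vectorP => [j|j|j r|r j]; rewrite /c /phase_curve ?scale0r ?addr0.
  - by [].
  - by [].
  - by [].
  - by rewrite {1}/psi mxE momE divff// mul1r.
have line : is_derive (0 : C) (1 : C) (fun s : C => val x + s *: h) h.
  exact: is_derive_line.
have [i1 i2 i3 i4] := is_derive_phase_parts line.
have dD j : is_derive (0 : C) (1 : C)
    (fun s : C => \sum_q phi (val x + s *: h) j q * psi (val x + s *: h) q j) 0.
  apply: (is_derive_eq (is_derive_bigsum (fun r _ => is_derive_mul (i3 j r) (i4 r j)))).
  by rewrite scale0r addr0; exact: th.
have D0 j : \sum_q phi (val x + (0 : C) *: h) j q * psi (val x + (0 : C) *: h) q j = c0.
  by rewrite scale0r addr0.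
have dc : is_derive (0 : C) (1 : C) c h.
  apply: is_derive_phase => r j.
    have dV : is_derive (0 : C) (1 : C) (fun s : C =>
        (\sum_q phi (val x + s *: h) j q * psi (val x + s *: h) q j)^-1) 0.
      have D0' : \sum_q phi (val x + (0 : C) *: h) j q * psi (val x + (0 : C) *: h) q j != 0.
        by rewrite D0.
      have [dD1 dD2] := dD j.
      apply: DeriveDef; first exact: derivableV.
      by rewrite deriveV// dD2 scaler0.
    apply: (is_derive_ext (is_derive_mul (is_derive_mul (is_derive_cst c0 _ _) dV) (i4 r j))).
      by move=> s; rewrite /c /phase_curve /psi /= mxE.
    by rewrite D0 mul0r mulr0 addr0 mul0r add0r divff// mul1r.
exists c; split=> //.
have cc : c s @[s --> (0 : C)] --> val x.
  have dcd : differentiable c 0 by apply/derivable1_diffP; have [] := dc.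
  by rewrite -cE0; exact: (differentiable_continuous dcd).
have hc : \forall s \near (0 : C), hreg (c s) by exact: (cc _ (hreg_near xreg)).
have Dj j : \forall s \near (0 : C),
    \sum_q phi (val x + s *: h) j q * psi (val x + s *: h) q j != 0.
  apply: near_neq0; last by rewrite D0.
  by apply/derivable1_diffP; have [] := dD j.
have Dc : \forall s \near (0 : C), forall j,
    \sum_q phi (val x + s *: h) j q * psi (val x + s *: h) q j != 0.
  exact: (@filter_forall _ _ (fun j (s : C) =>
    \sum_q phi (val x + s *: h) j q * psi (val x + s *: h) q j != 0) (nbhs (0 : C)) _ Dj).
near=> s; split; first by near: s.
apply/rowP => j; rewrite !mxE -[RHS]/c0.
have Ds : \sum_q phi (val x + s *: h) j q * psi (val x + s *: h) q j != 0.
  by move: j; near: s.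
rewrite -[RHS](divfK Ds) mulr_sumr; apply: eq_bigr => r _.
by rewrite /c /phase_curve [psi _ r j]/psi /= mxE phiD phiZ /phi /= !mxE; ring.
Unshelve. all: by end_near. Qed.

(** Both functions agree along the curve of [phase_curveP], whose velocity is [h]. *)
Lemma diff_unique_on_level lam (x : phase_level lam) (F F' : V -> C) h :
  \sum_r lam r != 0 -> tangent (@phase_moment C m n) x h ->
  differentiable F (val x) -> differentiable F' (val x) ->
  (\forall y \near x, F (val y) = F' (val y)) ->
  'd F (val x) h = 'd F' (val x) h.
Proof.
move=> lam0 th dF dF' /level_nbhsP[W xW FF'].
have [c [c0 dc cL]] := phase_curveP lam0 th.
move: dF dF' xW; rewrite -c0 => dF dF' xW.
have cc : {for (0 : C), continuous c}.
  have dcd : differentiable c 0 by apply/derivable1_diffP; have [] := dc.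
  exact: (differentiable_continuous dcd).
have Ec : \forall s \near (0 : C), (F \o c) s = (F' \o c) s.
  have cW : \forall s \near (0 : C), W (c s) by exact: (cc _ xW).
  by apply: filterS2 cW cL => s Ws Ls; exact: (FF' (level_point Ls) Ws).
have [_ E1] := is_derive_curve dF dc; have [_ E2] := is_derive_curve dF' dc.
by rewrite -E1 -E2; exact: near_eq_derive.
Qed.

End PhaseSpace.

(** A basis of a complement of [S] in [T], indexed by ['I_d] as [reduced_dim] requires. *)
Lemma quotient_basis (F : fieldType) (U : vectType F) (T S : {vspace U}) d :
  (S <= T)%VS -> (\dim T = d + \dim S)%N ->
  exists b : 'I_d -> U, (forall i, b i \in T) /\
    forall h, h \in T -> exists! a : 'rV[F]_d, h - \sum_i a ord0 i *: b i \in S.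
Proof.
move=> ST dT; pose W := (T :\: S)%VS.
have dW : \dim W = d.
  apply: (@addIn (\dim S)); rewrite -dT -(dimv_cap_compl T S) addnC.
  by rewrite (capv_idPr ST).
have bW := vbasisP W; pose b (i : 'I_d) := (vbasis W)`_i.
have bi i : b i \in W by rewrite vbasis_mem// mem_nth// size_tuple dW.
have WT : (W <= T)%VS by exact: diffvSl.
exists b; split=> [i|h hT]; first exact: (subvP WT).
have : h \in (W + S)%VS by rewrite addv_diff (addv_idPl ST).
move=> /memv_addP[w wW [s sS ->]].
pose c : 'rV[F]_d := \row_i coord (vbasis W) (cast_ord (esym dW) i) w.
have wE : w = \sum_i c ord0 i *: b i.
  rewrite {1}(coord_vbasis wW).
  rewrite (reindex (cast_ord (esym dW))) /=; last first.
    by exists (cast_ord dW) => i _; rewrite ?cast_ordK ?cast_ordKV.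
  by apply: eq_bigr => i _; rewrite mxE.
exists c; split; first by rewrite -wE addrC addKr.
move=> a aS; apply/rowP => i.
have D0 : \sum_i (c ord0 i - a ord0 i) *: b i = 0.
  apply/eqP; rewrite -memv0 -(capv_diff T S) memv_cap; apply/andP; split.
    by apply: memv_suml => j _; apply: memvZ.
  under eq_bigr do rewrite scalerBl; rewrite sumrB -wE.
  by rewrite -(addrK s w) addrAC memvB.
have /freeP fb := basis_free bW.
have := fb (fun i => c ord0 (cast_ord dW i) - a ord0 (cast_ord dW i)) _ (cast_ord (esym dW) i).
rewrite cast_ordKV => /(_ _)/eqP; rewrite subr_eq0 => H; apply/eqP/H.
rewrite -[RHS]D0 (reindex (cast_ord (esym dW))) /=; last first.
  by exists (cast_ord dW) => j _; rewrite ?cast_ordK ?cast_ordKV.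
by apply: eq_bigr => j _; rewrite cast_ordKV.
Qed.

(** * The radical of the form on tangent vectors of the phase level *)

Section ReducedPhaseSpace.
Context {C : numClosedFieldType} {m n : nat}.
Local Notation V := (@phase_vector C m n).
Implicit Types (x h : V) (lam : 'I_m -> C).

Definition mk_phase (a b : 'I_n -> C) (c : 'I_n -> 'I_m -> C) (d : 'I_m -> 'I_n -> C) : V :=
  (\row_j a j, \row_j b j, \matrix_(j, r) c j r, \matrix_(r, j) d r j).

Lemma nu_mk a b c d j : nu (mk_phase a b c d) j = a j. Proof. by rewrite /nu mxE. Qed.
Lemma mu_mk a b c d j : mu (mk_phase a b c d) j = b j. Proof. by rewrite /mu mxE. Qed.
Lemma phi_mk a b c d j r : phi (mk_phase a b c d) j r = c j r.
Proof. by rewrite /phi mxE. Qed.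
Lemma psi_mk a b c d r j : psi (mk_phase a b c d) r j = d r j.
Proof. by rewrite /psi mxE. Qed.
Definition mk_phaseE := (nu_mk, mu_mk, phi_mk, psi_mk).

(** The velocity at the identity of the action of the torus by [rescale], with rates [e j]. *)
Definition phase_scaling x (e : 'I_n -> C) : V :=
  mk_phase (fun=> 0) (fun=> 0) (fun j r => e j * phi x j r) (fun r j => - (e j * psi x r j)).

Lemma phase_scaling_dmom x e j : phase_dmom x (phase_scaling x e) j = 0.
Proof. by rewrite /phase_dmom big1// => r _; rewrite !mk_phaseE; ring. Qed.

Lemma phase_scaling_form x e h : (forall j, phase_dmom x h j = 0) ->
  phase_form (phase_scaling x e) h = 0.
Proof.
move=> th; rewrite /phase_form big1// => j _; rewrite !mk_phaseE.
transitivity (- (e j * phase_dmom x h j)); last by rewrite th mulr0 oppr0.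
rewrite /phase_dmom mulr_sumr mul0r mulr0 subrr mulr0 sub0r; congr (- _).
by apply: eq_bigr => r _; rewrite !mk_phaseE; ring.
Qed.

(** Coordinate directions in [mu] and [nu] are tangent and kill those parts of [h]. For [phi] and
    [psi] an arbitrary test direction is first made tangent; the correction term is what produces
    the rates [e j]. *)
Lemma phase_radical x h (c : C) : (0 < m)%N -> c != 0 ->
  (forall j, \sum_r phi x j r * psi x r j = c) ->
  (forall h', (forall j, phase_dmom x h' j = 0) -> phase_form h h' = 0) ->
  exists e, h = phase_scaling x e.
Proof.
move=> m0 c0 momx hh; have m0' : m%:R != 0 :> C by rewrite pnatr_eq0 -lt0n.
pose del (j k : 'I_n) : C := (k == j)%:R.
have E0 : forall j, nu h j = 0.
  move=> j; have := hh (mk_phase (fun=> 0) (del j) (fun _ _ => 0) (fun _ _ => 0)) _.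
  rewrite /phase_form (bigD1 j) //= [X in _ + X = 0]big1 ?addr0 => [|k /negbTE kj]; last first.
    rewrite !mk_phaseE /del kj mul0r mulr0 subrr mulr0 sub0r big1 ?oppr0// => r _.
    by rewrite !mk_phaseE mul0r mulr0 subrr.
  rewrite !mk_phaseE /del eqxx big1 => [|r _]; last by rewrite !mk_phaseE mul0r mulr0 subrr.
  rewrite mulr0 mul1r !sub0r subr0 mulrN => /(_ _)/eqP; rewrite oppr_eq0 mulf_eq0 (negbTE m0') /=.
  move=> H; apply/eqP/H => k; rewrite /phase_dmom big1// => r _.
  by rewrite !mk_phaseE mul0r mulr0 addr0.
have E1 : forall j, mu h j = 0.
  move=> j; have := hh (mk_phase (del j) (fun=> 0) (fun _ _ => 0) (fun _ _ => 0)) _.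
  rewrite /phase_form (bigD1 j) //= [X in _ + X = 0]big1 ?addr0 => [|k /negbTE kj]; last first.
    rewrite !mk_phaseE /del kj mul0r mulr0 subrr mulr0 sub0r big1 ?oppr0// => r _.
    by rewrite !mk_phaseE mul0r mulr0 subrr.
  rewrite !mk_phaseE /del eqxx big1 => [|r _]; last by rewrite !mk_phaseE mul0r mulr0 subrr.
  rewrite mul0r mulr1 !subr0 => /(_ _)/eqP; rewrite mulf_eq0 (negbTE m0') /=.
  move=> H; apply/eqP/H => k; rewrite /phase_dmom big1// => r _.
  by rewrite !mk_phaseE mul0r mulr0 addr0.
pose e j := - (\sum_r phi x j r * psi h r j) / c.
have F j (al : 'I_m -> C) (be : 'I_m -> C) :
    \sum_r (phi h j r * be r - al r * psi h r j)
    = e j * \sum_r (al r * psi x r j + phi x j r * be r).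
  set g := \sum_r (al r * _ + _).
  (* The pairing of [phi_j] with [psi_j] is [c], so subtracting [g / c] times [phi_j] cancels the
     derivative [g] of the moment. *)
  pose al' r := al r - g / c * phi x j r.
  have := hh (mk_phase (fun=> 0) (fun=> 0) (fun k r => del j k * al' r)
    (fun r k => del j k * be r)) _.
  rewrite /phase_form (bigD1 j) //= [X in _ + X = 0]big1 ?addr0 => [|k /negbTE kj]; last first.
    rewrite !mk_phaseE !mulr0 mul0r subrr mulr0 sub0r big1 ?oppr0// => r _.
    by rewrite !mk_phaseE /del kj !mul0r mulr0 subrr.
  rewrite !mk_phaseE E0 E1 !mul0r subrr mulr0 sub0r => /(_ _)/eqP.
  rewrite oppr_eq0 => H.
  have {}H : \sum_r (phi h j r * be r - al' r * psi h r j) = 0.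
    apply/eqP; have -> : \sum_r (phi h j r * be r - al' r * psi h r j) =
      \sum_r (phi h j r * (del j j * be r) - del j j * al' r * psi h r j).
      by apply: eq_bigr => r _; rewrite /del eqxx !mul1r.
    move: H; under eq_bigr do rewrite !mk_phaseE; apply => k.
    rewrite /phase_dmom; have [->|kj] := eqVneq k j; last first.
      by rewrite big1// => r _; rewrite !mk_phaseE /del (negbTE kj) !mul0r mulr0 addr0.
    transitivity (g - g / c * \sum_r phi x j r * psi x r j); last by rewrite momx divfK// subrr.
    rewrite {1}/g mulr_sumr -sumrB; apply: eq_bigr => r _.
    by rewrite !mk_phaseE /del eqxx !mul1r /al'; ring.
  rewrite -[LHS]subr0 -[X in _ - X = _]H -sumrB /e -mulrA mulNr mulr_suml -sumrN.
  by apply: eq_bigr => r _; rewrite /al'; ring.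
exists e; apply: phase_vectorP => [j|j|j r|r j]; rewrite !mk_phaseE//.
- have := F j (fun=> 0) (fun s => (s == r)%:R).
  rewrite (bigD1 r) //= big1 ?addr0 => [|s /negbTE sr]; last by rewrite sr mulr0 mul0r subrr.
  rewrite (bigD1 r) //= big1 ?addr0 => [|s /negbTE sr]; last by rewrite sr mulr0 mul0r addr0.
  by rewrite eqxx !mulr1 !mul0r subr0 add0r.
- have := F j (fun s => (s == r)%:R) (fun=> 0).
  rewrite (bigD1 r) //= big1 ?addr0 => [|s /negbTE sr]; last by rewrite sr mulr0 mul0r subrr.
  rewrite (bigD1 r) //= big1 ?addr0 => [|s /negbTE sr]; last by rewrite sr mulr0 mul0r addr0.
  by rewrite eqxx !mul1r !mulr0 sub0r addr0 => <-; rewrite opprK.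
Qed.

Lemma phase_radicalP lam (x : phase_level lam) h : (0 < m)%N -> \sum_r lam r != 0 ->
  radical (@phase_moment C m n) (@phase_form C m n) x h <->
  exists e, h = phase_scaling (val x) e.
Proof.
move=> m0 lam0; have [_ /rowP xmom] := set_mem (valP x); split.
  move=> [th hh]; apply: (phase_radical (c := - \sum_r lam r)) => //.
  - by rewrite oppr_eq0.
  - by move=> j; have := xmom j; rewrite !mxE.
  - by move=> h' /phase_tangentP; exact: hh.
move=> [e ->]; split; first by apply/phase_tangentP => j; exact: phase_scaling_dmom.
by move=> h' /phase_tangentP th'; exact: phase_scaling_form.
Qed.

End ReducedPhaseSpace.

(** * The dimension of the reduced phase space *)

Section ReducedDimension.
Context {C : numClosedFieldType} {m n : nat}.
Local Notation V := (@phase_vector C m n).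
Implicit Types (x h : V) (lam : 'I_m -> C).

Definition dmom_row x h : 'rV[C]_n := \row_j phase_dmom x h j.

Lemma dmom_row_is_linear x : linear (dmom_row x).
Proof.
move=> a h h'; apply/rowP => j; rewrite !mxE /phase_dmom mulr_sumr -big_split /=.
by apply: eq_bigr => r _; rewrite phiD phiZ psiD psiZ; ring.
Qed.
HB.instance Definition _ x := GRing.isLinear.Build _ _ _ _ _ (@dmom_row_is_linear x).

Definition scaling_row x (e : 'rV[C]_n) : V := phase_scaling x (e ord0).

Lemma scaling_row_is_linear x : linear (scaling_row x).
Proof.
move=> a e e'; apply: phase_vectorP => [j|j|j r|r j];
  rewrite ?nuD ?nuZ ?muD ?muZ ?phiD ?phiZ ?psiD ?psiZ !mk_phaseE ?mxE; ring.
Qed.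
HB.instance Definition _ x := GRing.isLinear.Build _ _ _ _ _ (@scaling_row_is_linear x).

(** The ambient space has dimension [2 n + 2 m n]. The differential of the moment is onto, which
    removes [n], and the scalings are injective in their rates, which removes [n] more. *)
Lemma phase_reduced_dim lam (x : phase_level lam) : (0 < m)%N -> \sum_r lam r != 0 ->
  reduced_dim (@phase_moment C m n) (@phase_form C m n) x (2 * (m * n)).
Proof.
move=> m0 lam0; have [_ /rowP xmom] := set_mem (valP x).
set c := - \sum_r lam r in xmom; have c0 : c != 0 by rewrite oppr_eq0.
have momE j : \sum_r phi (val x) j r * psi (val x) r j = c.
  by have := xmom j; rewrite !mxE.
pose f : 'Hom(V, 'rV[C]_n) := linfun (dmom_row (val x)).
pose g : 'Hom('rV[C]_n, V) := linfun (scaling_row (val x)).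
have TP h : (h \in lker f) <-> tangent (@phase_moment C m n) x h.
  rewrite memv_ker lfunE /=; split=> [/eqP/rowP H|/phase_tangentP H].
    by apply/phase_tangentP => j; have := H j; rewrite !mxE.
  by apply/eqP/rowP => j; rewrite !mxE H.
have SP h : (h \in limg g) <->
    radical (@phase_moment C m n) (@phase_form C m n) x h.
  rewrite (phase_radicalP x h m0 lam0); split=> [/memv_imgP[e _ ->]|[e ->]].
    by exists (e ord0); rewrite lfunE.
  apply/memv_imgP; exists (\row_j e j); rewrite ?memvf// lfunE /=.
  rewrite /scaling_row; apply: phase_vectorP => *; rewrite !mk_phaseE ?mxE//.
have ST : (limg g <= lker f)%VS.
  by apply/subvP => h /SP[th _]; apply/TP.
have sf : limg f = fullv.
  apply/eqP; rewrite eqEsubv subvf; apply/subvP => y _; apply/memv_imgP.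
  exists (mk_phase (fun=> 0) (fun=> 0) (fun j r => y ord0 j / c * phi (val x) j r)
            (fun _ _ => 0)); rewrite ?memvf// lfunE /=.
  apply/rowP => j; rewrite mxE -[LHS](divfK c0) -(momE j) mulr_sumr.
  by apply: eq_bigr => r _; rewrite !mk_phaseE momE; ring.
have ig : lker g = 0%VS.
  apply/eqP; rewrite -subv0; apply/subvP => e; rewrite memv_ker lfunE memv0 /=.
  move=> /eqP E; apply/eqP/rowP => j; rewrite mxE; apply: (mulIf c0).
  rewrite mul0r -(momE j) mulr_sumr big1// => r _; rewrite mulrA.
  have := congr1 (fun h => phi h j r) E; rewrite mk_phaseE => ->.
  by rewrite /phi mxE mul0r.
have dT : \dim (lker f) = (2 * (m * n) + \dim (limg g))%N.
  have := limg_ker_dim f fullv; have := limg_ker_dim g fullv.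
  rewrite ig capv0 capfv sf dimv0 add0n !dimvf => -> dV.
  have dimV : dim V = (1 * n + 1 * n + n * m + m * n)%N by [].
  have dimR : dim 'rV[C]_n = (1 * n)%N by [].
  by move: dV; rewrite dimV dimR; lia.
have [b [bT bP]] := quotient_basis ST dT.
exists b; split=> [i|h /TP hT]; first by apply/TP.
have [a [aP aU]] := bP h hT; exists a; split; first by apply/SP.
by move=> a' /SP; exact: aU.
Qed.

End ReducedDimension.

(** * Moment map, gauge directions and Hamiltonian fields on representations *)

Section SymplecticCalogeroMoser.
Context {C : numClosedFieldType} (E : exponential C) {m n : nat}.
Local Notation N := (\sum_(i < m) n)%N.
Local Notation cmvec := (@cm_vector C m n).
Local Notation exp := (exp_of E).
Implicit Types (z h : cmvec) (lam : 'I_m -> C).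

Definition cm_moment z (i : 'I_m) : 'M[C]_n :=
  cmY z i *m cmX z i - cmX z (ord_pred i) *m cmY z (ord_pred i) - cmv z i *m cmw z i.

Definition cm_dmom z h (i : 'I_m) : 'M[C]_n :=
  (cmY h i *m cmX z i + cmY z i *m cmX h i)
  - (cmX h (ord_pred i) *m cmY z (ord_pred i) + cmX z (ord_pred i) *m cmY h (ord_pred i))
  - (cmv h i *m cmw z i + cmv z i *m cmw h i).

(* [sum_i (tr (dY_i /\ dX_i) + dw_i /\ dv_i)] *)
Definition cm_form h h' : C :=
  \sum_i (\tr (cmY h i *m cmX h' i) - \tr (cmY h' i *m cmX h i)
          + (\tr (cmw h i *m cmv h' i) - \tr (cmw h' i *m cmv h i))).

(** The velocity of the gauge action along the one-parameter group of the [g i], see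
    [gauge_curve]. *)
Definition gauge_dir (g : 'I_m -> 'M[C]_n) z : cmvec :=
  mk_cm (fun i => g (ordS i) *m cmX z i - cmX z i *m g i)
        (fun i => g i *m cmY z i - cmY z i *m g (ordS i))
        (fun i => g i *m cmv z i)
        (fun i => - (cmw z i *m g i)).

Lemma is_derive_cm_parts (W : normedModType C) (c : W -> cmvec) t v (dc : cmvec) :
  is_derive t v c dc ->
  [/\ forall i, is_derive t v (fun s => cmX (c s) i) (cmX dc i),
      forall i, is_derive t v (fun s => cmY (c s) i) (cmY dc i),
      forall i, is_derive t v (fun s => cmv (c s) i) (cmv dc i) &
      forall i, is_derive t v (fun s => cmw (c s) i) (cmw dc i)].
Proof.
move=> d0; have d1 := is_derive_fst d0; have d11 := is_derive_fst d1.
have d2 := is_derive_snd d0; have d12 := is_derive_snd d1.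
have d111 := is_derive_fst d11; have d112 := is_derive_snd d11.
split=> i; apply: is_derive_mx => a b; rewrite !mxE.
- by under eq_fun do rewrite !mxE; exact: (is_derive_coord i (mxvec_index a b) d111).
- by under eq_fun do rewrite !mxE; exact: (is_derive_coord i (mxvec_index a b) d112).
- by under eq_fun do rewrite !mxE; exact: (is_derive_coord i a d12).
- by under eq_fun do rewrite !mxE; exact: (is_derive_coord i b d2).
Qed.

Lemma is_derive_cm_moment (W : normedModType C) (c : W -> cmvec) t v (dc : cmvec) i :
  is_derive t v c dc ->
  is_derive t v (fun s => cm_moment (c s) i) (cm_dmom (c t) dc i).
Proof.
move=> /is_derive_cm_parts[iX iY iv iw].
apply: is_deriveB; first apply: is_deriveB; exact: is_derive_mulmx.
Qed.

(** Gauge directions, [ham_field] and images under [cm_point] are all shown to be tangent by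
    exhibiting a curve that stays in the level. *)
Lemma cm_dmom_of_level lam (c : C -> cmvec) (dc : cmvec) i :
  is_derive (0 : C) (1 : C) c dc -> (\forall s \near (0 : C), cm_level lam (c s)) ->
  cm_dmom (c 0) dc i = 0.
Proof.
move=> dcc cL; have [_ <-] := is_derive_cm_moment i dcc.
rewrite -(derive_cst ((lam i)%:M : 'M[C]_n) (0 : C^o) 1); apply: near_eq_derive.
by apply: (@filterS _ (nbhs (0 : C)) _ _ _ _ cL) => s; exact.
Qed.

Lemma gauge_curve g z :
  is_derive (0 : C) (1 : C) (fun s : C => gauge (fun i => exp (s *: g i)) z) (gauge_dir g z).
Proof.
have de i := exp_curve0 E (g i).
have dn i : is_derive (0 : C) (1 : C) (fun s : C => invmx (exp (s *: g i))) (- g i).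
  by apply: (is_derive_ext (exp_opp_curve0 E (g i))) => // s; rewrite exp_inv.
have e0 i : exp ((0 : C) *: g i) = 1%:M by rewrite scale0r exp_zero.
have n0 i : invmx (exp ((0 : C) *: g i)) = 1%:M by rewrite e0 invmx1.
have ci p q (M : 'M[C]_(p, q)) := is_derive_cst M (0 : C^o) 1.
apply: is_derive_mk_cm => i.
- apply: (is_derive_eq (is_derive_mulmx (is_derive_mulmx (de (ordS i)) (ci _ _ (cmX z i))) (dn i))).
  by rewrite e0 n0 mulmx1 mulmx0 addr0 mul1mx mulmxN.
- apply: (is_derive_eq (is_derive_mulmx (is_derive_mulmx (de i) (ci _ _ (cmY z i))) (dn (ordS i)))).
  by rewrite e0 n0 mulmx1 mulmx0 addr0 mul1mx mulmxN.
- apply: (is_derive_eq (is_derive_mulmx (de i) (ci _ _ (cmv z i)))).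
  by rewrite mulmx0 addr0.
- apply: (is_derive_eq (is_derive_mulmx (ci _ _ (cmw z i)) (dn i))).
  by rewrite mul0mx add0r mulmxN.
Qed.

Lemma gauge_dir_dmom lam g z i : cm_level lam z -> cm_dmom z (gauge_dir g z) i = 0.
Proof.
move=> zL; have e0 : gauge (fun i => exp ((0 : C) *: g i)) z = z.
  rewrite -[RHS]gauge1; congr gauge; apply/funext => j.
  by rewrite scale0r exp_zero.
have := @cm_dmom_of_level lam _ _ i (gauge_curve g z); rewrite e0; apply.
near=> s; apply: gauge_level => // j; exact: exp_unitmx.
Unshelve. all: by end_near. Qed.

Lemma flow_tangent lam k z i : cm_level lam z -> cm_dmom z (ham_field k z) i = 0.
Proof.
move=> zL; have := @cm_dmom_of_level lam _ _ i (flow_derive0 E k z).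
rewrite flow0; apply; near=> s; exact: flow_level.
Unshelve. all: by end_near. Qed.

Lemma sum_ordS (U : nmodType) (F : 'I_m -> U) : \sum_i F (ordS i) = \sum_i F i.
Proof.
rewrite [RHS](reindex (@ordS m)) //; exists (@ord_pred m) => i _.
  exact: ordSK.
exact: ord_predK.
Qed.

(** The moment map identity, by cyclicity of the trace and a shift of the index along the cycle. In
    particular gauge directions are orthogonal to everything tangent to the level. *)
Lemma cm_form_gauge_dir g z h :
  cm_form (gauge_dir g z) h = \sum_i \tr (g i *m cm_dmom z h i).
Proof.
have tB q (A B : 'M[C]_q) : \tr (A - B) = \tr A - \tr B by exact: linearB.
have tN q (A : 'M[C]_q) : \tr (- A) = - \tr A by exact: linearN.
transitivity (\sum_i (\tr (g i *m (cmY h i *m cmX z i + cmY z i *m cmX h i))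
    - \tr (g (ordS i) *m (cmX h i *m cmY z i + cmX z i *m cmY h i))
    - \tr (g i *m (cmv h i *m cmw z i + cmv z i *m cmw h i)))).
  apply: eq_bigr => i _; rewrite /gauge_dir !cmE.
  rewrite !mulmxBl !mulmxBr !mulmxDr !mulNmx !tB !tN !mxtraceD.
  rewrite -!mulmxA.
  rewrite (mxtrace_mulC (cmY z i) (g (ordS i) *m cmX h i)) -!mulmxA.
  rewrite (mxtrace_mulC (cmY h i) (g (ordS i) *m cmX z i)) -!mulmxA.
  rewrite (mxtrace_mulC (cmY h i) (cmX z i *m g i)) -!mulmxA.
  rewrite (mxtrace_mulC (cmX z i) (g i *m cmY h i)) -!mulmxA.
  rewrite (mxtrace_mulC (cmw z i) (g i *m cmv h i)) -!mulmxA.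
  rewrite (mxtrace_mulC (cmw h i) (g i *m cmv z i)) -!mulmxA.
  ring.
rewrite !sumrB (_ : \sum_i \tr (g (ordS i) *m _) = \sum_i
   \tr (g i *m (cmX h (ord_pred i) *m cmY z (ord_pred i)
                + cmX z (ord_pred i) *m cmY h (ord_pred i)))).
  by rewrite -!sumrB; apply: eq_bigr => i _; rewrite /cm_dmom !mulmxBr !tB.
by rewrite -[RHS]sum_ordS; apply: eq_bigr => i _; rewrite ordSK.
Qed.

Lemma cm_formC h h' : cm_form h h' = - cm_form h' h.
Proof. by rewrite /cm_form -sumrN; apply: eq_bigr => i _; ring. Qed.

Lemma cm_formB h1 h2 h : cm_form (h1 - h2) h = cm_form h1 h - cm_form h2 h.
Proof.
have bX z z' i : cmX (z - z') i = cmX z i - cmX z' i by rewrite /cmX !linearB.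
have bY z z' i : cmY (z - z') i = cmY z i - cmY z' i by rewrite /cmY !linearB.
have bv z z' i : cmv (z - z') i = cmv z i - cmv z' i by rewrite /cmv !linearB.
have bw z z' i : cmw (z - z') i = cmw z i - cmw z' i by rewrite /cmw !linearB.
rewrite /cm_form -sumrB; apply: eq_bigr => i _.
rewrite bX bY bv bw !mulmxBl !mulmxBr.
have tB q (A B : 'M[C]_q) : \tr (A - B) = \tr A - \tr B by exact: linearB.
by rewrite !tB; ring.
Qed.

(** The differential of [cm_hamiltonian k] at [z], by the product rule; see
    [is_derive_cm_hamiltonian]. *)
Definition cm_dham k z h : C :=
  - (blockw h *m blockY z ^+ k *m blockv z
     + blockw z *m pow_diff k (blockY z) (blockY h) *m blockv z
     + blockw z *m blockY z ^+ k *m blockv h) ord0 ord0.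

Lemma is_derive_blocks (W : normedModType C) (c : W -> cmvec) t v (dc : cmvec) :
  is_derive t v c dc ->
  [/\ is_derive t v (fun s => blockY (c s)) (blockY dc),
      is_derive t v (fun s => blockv (c s)) (blockv dc) &
      is_derive t v (fun s => blockw (c s)) (blockw dc)].
Proof.
move=> /is_derive_cm_parts[_ iY iv iw]; split; apply: is_derive_mx => a b.
- rewrite mxE; under eq_fun do rewrite mxE.
  case: eqP => _; last by rewrite mxE; exact: is_derive_cst.
  exact: is_derive_coord.
- by rewrite mxE; under eq_fun do rewrite mxE; exact: is_derive_coord.
- by rewrite mxE; under eq_fun do rewrite mxE; exact: is_derive_coord.
Qed.

Lemma is_derive_cm_hamiltonian (W : normedModType C) k (c : W -> cmvec) t v (dc : cmvec) :
  is_derive t v c dc ->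
  is_derive t v (fun s => cm_hamiltonian k (c s)) (cm_dham k (c t) dc).
Proof.
move=> /is_derive_blocks[iY iv iw]; under eq_fun do rewrite cm_hamiltonianE.
apply: is_deriveN.
have H := is_derive_mulmx (is_derive_mulmx iw (is_derive_expr_mx k iY)) iv.
apply: (is_derive_eq (is_derive_coord ord0 ord0 H)).
by rewrite mulmxDl.
Qed.

Lemma cm_hamiltonian_differentiable k z : differentiable (@cm_hamiltonian C m n k) z.
Proof.
rewrite (_ : @cm_hamiltonian C m n k = fun z =>
   - (blockw z *m blockY z ^+ k *m blockv z) ord0 ord0); last first.
  by apply/funext => y; rewrite cm_hamiltonianE.
apply: differentiableN; apply: differentiable_entry.
apply: differentiable_mulmx; last exact: blockv_differentiable.
apply: differentiable_mulmx; first exact: blockw_differentiable.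
by apply: expr_mx_differentiable; exact: blockY_differentiable.
Qed.

Lemma tr_blockw_mul (w : 'M[C]_(1, N)) h :
  \sum_i \tr (submxrow w i *m cmv h i) = (w *m blockv h) ord0 ord0.
Proof.
rewrite -{2}(submxrowK w) mul_mxrow_mxcol summxE; apply: eq_bigr => i _.
by rewrite [in LHS](mx11_scalar (_ *m _)) mxtrace_scalar.
Qed.

Lemma tr_mul_blockv (v : 'M[C]_(N, 1)) h :
  \sum_i \tr (cmw h i *m submxcol v i) = (blockw h *m v) ord0 ord0.
Proof.
rewrite -{2}(submxcolK v) mul_mxrow_mxcol summxE; apply: eq_bigr => i _.
by rewrite [in LHS](mx11_scalar (_ *m _)) mxtrace_scalar.
Qed.

(** [pow_diff k Y] is self-adjoint for the trace pairing: cyclicity matches the term of index [a]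
    with that of index [k - 1 - a]. *)
Lemma pow_diff_trace k (Y T : 'M[C]_N) (v : 'M[C]_(N, 1)) (w : 'M[C]_(1, N)) :
  \tr (T *m pow_diff k Y (v *m w)) = (w *m pow_diff k Y T *m v) ord0 ord0.
Proof.
rewrite /pow_diff mulmx_sumr linear_sum /= mulmx_sumr mulmx_suml summxE.
rewrite [RHS](reindex_inj rev_ord_inj) /=; apply: eq_bigr => a _.
rewrite -[RHS]trace_mx11 subnSK// subKn//; last exact: ltnW.
rewrite !mulmxA mxtrace_mulC !mulmxA.
by rewrite -!mulmxA [in RHS]mxtrace_mulC !mulmxA.
Qed.

Lemma ham_field_form k z h : cm_form (ham_field k z) h = - cm_dham k z h.
Proof.
rewrite /cm_form /ham_field !cmE.
transitivity (\tr (blockY h *m pow_diff k (blockY z) (blockv z *m blockw z))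
  + ((blockw z *m blockY z ^+ k *m blockv h) ord0 ord0
     + (blockw h *m (blockY z ^+ k *m blockv z)) ord0 ord0)).
  rewrite mxtrace_mulY -tr_blockw_mul -tr_mul_blockv -!big_split /=.
  have tN q (A : 'M[C]_q) : \tr (- A) = - \tr A by exact: linearN.
  by apply: eq_bigr => i _; rewrite mul0mx mxtrace0 !mulmxN !tN !opprK add0r.
rewrite pow_diff_trace /cm_dham opprK [in RHS]mxE [in RHS]mxE mulmxA.
by ring.
Qed.

(** The field of [H_l] does not move [Y], so only the variations of [v] and [w] count, and they
    contribute [w Y^(k+l) v] with opposite signs. *)
Lemma ham_fields_orthogonal k l z : cm_form (ham_field k z) (ham_field l z) = 0.
Proof.
rewrite ham_field_form /cm_dham opprK.
have -> : blockY (ham_field l z) = 0.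
  rewrite /blockY /ham_field !cmE -[RHS]mxblock0; apply/eq_mxblockP => i j.
  by case: eqP.
have -> : blockv (ham_field l z) = - (blockY z ^+ l *m blockv z).
  by rewrite /blockv /ham_field !cmE mxcolN submxcolK.
have -> : blockw (ham_field l z) = blockw z *m blockY z ^+ l.
  by rewrite /blockw /ham_field !cmE submxrowK.
rewrite linear0 mulmx0 mul0mx addr0 mulmxN -!mulmxA !(mulmxA (blockY z ^+ _)).
by rewrite mulmxE -!exprD addnC subrr mxE.
Qed.

End SymplecticCalogeroMoser.

(** * Difference equations on the cycle of length [m] *)

Section CyclicEquations.
Context {F : fieldType} {m : nat}.
Implicit Types (a b : F) (c u : 'I_m -> F).

(** Iterating the equation once around the cycle determines [u i] up to the factor [b^m - a^m]; the
    witness is the resulting geometric sum. *)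
Lemma cyclic_solve a b c : b ^+ m - a ^+ m != 0 ->
  exists u : 'I_m -> F, forall i, b * u (ordS i) - a * u i = c i.
Proof.
move=> D0; set D := b ^+ m - a ^+ m in D0 *.
exists (fun i => D^-1 * \sum_(p < m) a ^+ p * b ^+ (m - p.+1) * c (iter p.+1 (@ord_pred m) i)).
move=> i; pose T p := a ^+ p * b ^+ (m - p) * c (iter p (@ord_pred m) i).
rewrite mulrCA [a * _]mulrCA -mulrBr !mulr_sumr -sumrB.
transitivity (D^-1 * (T 0%N - T m)); last first.
  rewrite /T subnn iter_ord_pred_m /= !expr0 mulr1 subn0 mul1r -mulrBl -/D.
  by rewrite mulKf.
congr (_ * _); transitivity (- \sum_(p < m) (T p.+1 - T p)); last first.
  by rewrite -(big_mkord xpredT (fun p => T p.+1 - T p)) telescope_sumr// opprB.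
rewrite -sumrN; apply: eq_bigr => p _; rewrite opprB /T; congr (_ - _).
  rewrite iterSr ordSK -(subnSK (ltn_ord p)) exprS; ring.
by rewrite exprS; ring.
Qed.

(** One turn around the cycle gives [u_i b^m = a^m u_i]. *)
Lemma cyclic_unique a b u : b ^+ m - a ^+ m != 0 ->
  (forall i, u i * b = a * u (ord_pred i)) -> forall i, u i = 0.
Proof.
move=> D0 uE i.
have H k : u i * b ^+ k = a ^+ k * u (iter k (@ord_pred m) i).
  elim: k => [|k IH]; first by rewrite !expr0 mul1r mulr1.
  by rewrite exprSr mulrA IH -mulrA uE mulrA -exprSr.
have := H m; rewrite iter_ord_pred_m mulrC => /eqP.
by rewrite -subr_eq0 -mulrBl mulf_eq0 (negbTE D0) /= => /eqP.
Qed.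

(** Partial sums solve the equation away from the last index; there the vanishing total closes the
    cycle. *)
Lemma cyclic_primitive c : \sum_i c i = 0 ->
  exists u : 'I_m -> F, forall i, u (ordS i) - u i = c i.
Proof.
move=> c0; exists (fun i => \sum_(r < m | (r < i)%N) c r) => i.
have E : \sum_(r < m | (r < i.+1)%N) c r = c i + \sum_(r < m | (r < i)%N) c r.
  rewrite (bigD1 i) ?ltnSn//=; congr (_ + _); apply: eq_bigl => r.
  by rewrite ltnS andbC -ltn_neqAle.
have [iltm|mlei] := ltnP i.+1 m.
  rewrite (eq_bigl (fun r : 'I_m => (r < i.+1)%N)) ?E ?addrK// => r.
  by rewrite /= modn_small.
have im : i.+1 = m by apply/eqP; rewrite eqn_leq mlei andbT ltn_ord.
rewrite big1 => [|r]; last by rewrite /= im modnn ltn0.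
rewrite sub0r; apply/eqP; rewrite eqr_oppLR -addr_eq0 addrC -E -[X in _ == X]c0; apply/eqP.
by apply: eq_bigl => r; rewrite im ltn_ord.
Qed.

Lemma sum_upto (a : 'I_m -> F) :
  \sum_(i < m) \sum_(r < m | (r <= i)%N) a r = \sum_(r < m) (m - r)%:R * a r.
Proof.
rewrite (exchange_big_dep xpredT) //=; apply: eq_bigr => r _.
rewrite -(big_geq_mkord _ _ xpredT (fun=> a r)) sumr_const_nat mulr_natl.
by [].
Qed.

End CyclicEquations.

(** * [cm_point] is a symplectic map *)

Section CalogeroMoserPoint.
Context {C : numClosedFieldType} (E : exponential C) {m n : nat}.
Local Notation cmvec := (@cm_vector C m n).
Local Notation V := (@phase_vector C m n).
Implicit Types (lam : 'I_m -> C) (x h : V) (z eta : cmvec).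

Lemma cmXB z z' i : cmX (z - z') i = cmX z i - cmX z' i.
Proof. by rewrite /cmX !linearB. Qed.
Lemma cmYB z z' i : cmY (z - z') i = cmY z i - cmY z' i.
Proof. by rewrite /cmY !linearB. Qed.
Lemma cmvB z z' i : cmv (z - z') i = cmv z i - cmv z' i.
Proof. by rewrite /cmv !linearB. Qed.
Lemma cmwB z z' i : cmw (z - z') i = cmw z i - cmw z' i.
Proof. by rewrite /cmw !linearB. Qed.

Lemma cm_dmomB z eta eta' i : cm_dmom z (eta - eta') i = cm_dmom z eta i - cm_dmom z eta' i.
Proof.
rewrite /cm_dmom cmXB cmYB cmvB cmwB cmXB cmYB !mulmxBl !mulmxBr.
by apply/matrixP => a b; do ![rewrite [in LHS]mxE]; do ![rewrite [in RHS]mxE]; ring.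
Qed.

Lemma diag_entry_differentiable x j k r : differentiable (fun y : V => diag_entry y j k r) x.
Proof.
by have [_ _ d3 d4] := phase_parts_differentiable x; exact: differentiableM.
Qed.

Lemma cm_point_differentiable lam x : hreg x -> differentiable (cm_point lam : V -> cmvec) x.
Proof.
move=> /hregP[nu0 nuD]; have [d1 d2 d3 d4] := phase_parts_differentiable x.
have dde j k r := diag_entry_differentiable x j k r.
apply: mk_cm_differentiable => i; apply: differentiable_mx => j k.
- under eq_fun do rewrite !mxE; have [_|_] := eqVneq j k.
    by under eq_fun do rewrite mulr1n; exact: d1.
  by under eq_fun do rewrite mulr0n; exact: differentiable_cst.
- under eq_fun do rewrite mxE; have [_|jk] := eqVneq j k; last first.
    apply: differentiableN; apply: differentiable_bigsum => l _.
    apply: differentiableM; last first.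
      apply: differentiableV; last exact: nuD.
      by apply: differentiableB; exact: differentiable_pow.
    apply: differentiableM; last exact: differentiable_pow.
    by apply: differentiableM; [exact: dde|exact: differentiable_pow].
  have da r : differentiable (fun y : V => lam r + diag_entry y j j r) x.
    by apply: differentiableD; [exact: differentiable_cst|exact: dde].
  apply: differentiableD; first apply: differentiableD; first exact: d2.
    apply: differentiableM; first by apply: differentiableV.
    exact: differentiable_bigsum.
  apply: differentiableM; first by apply: differentiableV.
  apply: differentiable_bigsum => r _; apply: differentiableM; last exact: da.
  exact: differentiable_cst.
- by under eq_fun do rewrite mxE; exact: d3.
- by under eq_fun do rewrite mxE; exact: d4.
Qed.

(** By [sum_upto] the partial sums in [Y_diag] add up to weights [m - r], which the weights
    [(r - m) / m], taken [m] times, cancel. *)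
Lemma sum_Y_diag lam x j : (0 < m)%N -> \sum_i Y_diag lam x i j = m%:R * mu x j.
Proof.
move=> m0; have m0' : m%:R != 0 :> C by rewrite pnatr_eq0 -lt0n.
rewrite /Y_diag !big_split /= -!mulr_sumr sum_upto !sumr_const card_ord.
rewrite -[mu x j *+ m]mulr_natl -addrA -mulrDr -[RHS]addr0; congr (_ + _).
rewrite (_ : _ + _ = 0) ?mulr0// -[X in _ + X]mulr_natl mulr_sumr -big_split big1// => r _ /=.
by rewrite natrB ?(ltnW (ltn_ord r))//; field.
Qed.

Lemma is_derive_unique (U W : normedModType C) (f : U -> W) p v df df' :
  is_derive p v f df -> is_derive p v f df' -> df = df'.
Proof. by move=> [_ <-] [_ <-]. Qed.

(** Of the variation of the [Y_i] only the diagonals summed over [i] are recorded: with [X] diagonal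
    and independent of [i], the symplectic form sees nothing else. *)
Lemma cm_point_diff lam x h : (0 < m)%N -> hreg x ->
  let eta := 'd (cm_point lam : V -> cmvec) x h in
  [/\ forall i, cmX eta i = diag_mx (\row_j nu h j),
      forall j, \sum_i cmY eta i j j = m%:R * mu h j,
      forall i, cmv eta i = \col_j phi h j i &
      forall i, cmw eta i = \row_j psi h i j].
Proof.
move=> m0 xreg eta.
have dP := is_derive_diff h (cm_point_differentiable lam xreg); rewrite -/eta in dP.
have [i1 i2 i3 i4] := is_derive_phase_parts (is_derive_id x h).
have [pX pY pv pw] := is_derive_cm_parts dP.
split=> [i|j|i|i].
- apply: is_derive_unique (pX i) _; apply: is_derive_mx => j k.
  rewrite !mxE; under eq_fun do rewrite /cm_point cmXK !mxE.
  by case: eqP => _; [exact: i1|exact: is_derive_cst].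
- have H1 := is_derive_bigsum (P := xpredT) (fun i _ => is_derive_coord j j (pY i)).
  apply: (is_derive_unique H1).
  rewrite (_ : (fun y => _) = fun y : V => m%:R * mu y j).
    apply: (is_derive_eq (is_derive_mul (is_derive_cst (m%:R : C) _ _) (i2 j))).
    by rewrite mul0r add0r.
  apply/funext => y; rewrite -(sum_Y_diag lam)//; apply: eq_bigr => i _.
  by rewrite /cm_point cmYK mxE eqxx.
- apply: is_derive_unique (pv i) _; apply: is_derive_mx => j k.
  by rewrite !mxE; under eq_fun do rewrite /cm_point cmvK !mxE; exact: i3.
- apply: is_derive_unique (pw i) _; apply: is_derive_mx => j k.
  by rewrite !mxE; under eq_fun do rewrite /cm_point cmwK !mxE; exact: i4.
Qed.

Lemma cm_point_tangent lam (x : phase_level lam) h i : \sum_r lam r != 0 ->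
  tangent (@phase_moment C m n) x h ->
  cm_dmom (cm_point lam (val x)) ('d (cm_point lam : V -> cmvec) (val x) h) i = 0.
Proof.
move=> lam0 th; have [c [c0 dc cL]] := phase_curveP lam0 th.
have [xreg _] := set_mem (valP x); rewrite -c0 in xreg *.
have dP : differentiable (cm_point lam : V -> cmvec) (c 0).
  exact: cm_point_differentiable.
apply: (cm_dmom_of_level (lam := lam) i (is_derive_curve dP dc)).
by apply: (@filterS _ (nbhs (0 : C)) _ _ _ _ cL) => s /= cs; exact: cm_point_level.
Qed.

Lemma cm_point_symplectic lam x h h' : (0 < m)%N -> hreg x ->
  cm_form ('d (cm_point lam : V -> cmvec) x h) ('d (cm_point lam : V -> cmvec) x h')
  = phase_form h h'.
Proof.
move=> m0 xreg; have [X Y v w] := cm_point_diff lam h m0 xreg.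
have [X' Y' v' w'] := cm_point_diff lam h' m0 xreg.
have trD (A : 'M[C]_n) (d : 'I_n -> C) : \tr (A *m diag_mx (\row_j d j)) = \sum_j A j j * d j.
  by apply: eq_bigr => j _; rewrite mul_mx_diag !mxE.
have tr1 (a b : 'I_n -> C) : \tr ((\row_j a j) *m (\col_j b j)) = \sum_j a j * b j.
  by rewrite trace_mx11 mxE; apply: eq_bigr => j _; rewrite !mxE.
rewrite /cm_form.
under eq_bigr do rewrite X X' v v' w w' !trD !tr1 -!sumrB -big_split /=.
rewrite exchange_big /phase_form; apply: eq_bigr => j _ /=.
rewrite big_split /= !sumrB -!mulr_suml Y Y'; congr (_ + _); first ring.
by rewrite opprB; congr (_ - _); apply: eq_bigr => r _; rewrite mulrC.
Qed.

End CalogeroMoserPoint.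

(** * Tangent vectors modulo gauge directions *)

Section TangentDecomposition.
Context {C : numClosedFieldType} (E : exponential C) {m n : nat}.
Local Notation cmvec := (@cm_vector C m n).
Local Notation V := (@phase_vector C m n).
Implicit Types (lam : 'I_m -> C) (z eta : cmvec).
Hypothesis m0 : (0 < m)%N.

Lemma sum_ord_pred (U : nmodType) (F : 'I_m -> U) : \sum_i F (ord_pred i) = \sum_i F i.
Proof. by rewrite -[LHS]sum_ordS; apply: eq_bigr => i _; rewrite ordSK. Qed.

Lemma cm_vectorP z z' : (forall i, cmX z i = cmX z' i) -> (forall i, cmY z i = cmY z' i) ->
  (forall i, cmv z i = cmv z' i) -> (forall i, cmw z i = cmw z' i) -> z = z'.
Proof.
by move=> *; rewrite -(mk_cmK z) -(mk_cmK z'); congr mk_cm; apply/funext.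
Qed.

(* The infinitesimal version of the slice [X_0 = ... = X_(m-1) = diag nu]. *)
Lemma gauge_fixing (d : 'I_n -> C) (X : 'I_m -> 'M[C]_n) :
  (forall j, d j != 0) -> (forall j k, j != k -> d j ^+ m - d k ^+ m != 0) ->
  exists (g : 'I_m -> 'M[C]_n) (e : 'I_n -> C), forall i,
    X i - (g (ordS i) *m diag_mx (\row_j d j) - diag_mx (\row_j d j) *m g i)
    = diag_mx (\row_j e j).
Proof.
move=> d0 dD; have m0' : m%:R != 0 :> C by rewrite pnatr_eq0 -lt0n.
(* The mean of the diagonal entries over the cycle, which makes the right side of [cyclic_primitive]
   sum to zero. Off the diagonal [cyclic_solve] removes the entry altogether. *)
pose e j := m%:R^-1 * \sum_i X i j j.
have H (jk : 'I_n * 'I_n) : exists u : 'I_m -> C, forall i,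
    d jk.2 * u (ordS i) - d jk.1 * u i
    = X i jk.1 jk.2 - (if jk.1 == jk.2 then e jk.1 else 0).
  case: jk => j k /=; have [<-{k}|jk] := eqVneq j k; last first.
    by have [|u uE] := @cyclic_solve _ m (d j) (d k) (fun i => X i j k);
      [rewrite dD// eq_sym|exists u => i; rewrite uE subr0].
  have [|u uE] := @cyclic_primitive _ m (fun i => (X i j j - e j) / d j).
    rewrite -mulr_suml sumrB sumr_const card_ord -mulr_natl /e mulVKf// subrr mul0r.
    by [].
  by exists u => i; rewrite -mulrBr uE mulrC divfK.
have [u uP] := choice H.
exists (fun i => \matrix_(j, k) u (j, k) i), e => i; apply/matrixP => j k.
rewrite [LHS]mxE [in X in _ + X]mxE [in X in _ - X]mxE mul_mx_diag mul_diag_mx !mxE.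
rewrite [_ * d k]mulrC opprB; have := uP (j, k) i; rewrite /= => uE.
have -> : d j * u (j, k) i = d k * u (j, k) (ordS i) - (X i j k - (if j == k then e j else 0)).
  by rewrite -uE opprB addrC subrK.
by case: eqP => _; rewrite ?mulr1n ?mulr0n; ring.
Qed.

Lemma cm_dmom_diag (a b : 'I_n -> C) z eta i j k :
  (forall i, cmX z i = diag_mx (\row_j a j)) -> (forall i, cmX eta i = diag_mx (\row_j b j)) ->
  cm_dmom z eta i j k =
    (cmY eta i j k * a k + cmY z i j k * b k)
    - (b j * cmY z (ord_pred i) j k + a j * cmY eta (ord_pred i) j k)
    - (cmv eta i j ord0 * cmw z i ord0 k + cmv z i j ord0 * cmw eta i ord0 k).
Proof.
move=> zX eX; rewrite /cm_dmom !zX !eX.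
rewrite [LHS]mxE [X in X + _]mxE [X in _ + X]mxE [X in X + _ + _]mxE [X in _ + X + _]mxE.
rewrite [X in _ + _ - X]mxE [X in _ - X - _]mxE !mul_mx_diag !mul_diag_mx.
rewrite ![fun_of_matrix (mulmx _ _) _ _]mxE !big_ord1.
by rewrite !mxE.
Qed.

(** Without [X], [v] and [w] parts the linearised moment equations become
    [(Y_i)_jk d_k = d_j (Y_(i-1))_jk]. Off the diagonal [cyclic_unique] applies; on the diagonal the
    entry is independent of [i], and its sum over [i] vanishes. *)
Lemma cm_dmom_inj (d : 'I_n -> C) z zeta :
  (forall j, d j != 0) -> (forall j k, j != k -> d j ^+ m - d k ^+ m != 0) ->
  (forall i, cmX z i = diag_mx (\row_j d j)) -> (forall i, cm_dmom z zeta i = 0) ->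
  (forall i, cmX zeta i = 0) -> (forall j, \sum_i cmY zeta i j j = 0) ->
  (forall i, cmv zeta i = 0) -> (forall i, cmw zeta i = 0) -> zeta = 0.
Proof.
move=> nu0 nuD zX tz X0 Ys v0 w0.
have m0' : m%:R != 0 :> C by rewrite pnatr_eq0 -lt0n.
have X0' i : cmX zeta i = diag_mx (\row_j 0).
  by rewrite X0; apply/matrixP => j k; rewrite !mxE mul0rn.
have z0 p q j k : (0 : 'M[C]_(p, q)) j k = 0 by rewrite mxE.
have Yrec i j k : cmY zeta i j k * d k = d j * cmY zeta (ord_pred i) j k.
  have := cm_dmom_diag i j k zX X0'; rewrite tz v0 w0 !z0 !mulr0 !mul0r !addr0 !subr0 add0r.
  by move=> /esym/eqP; rewrite subr_eq0 => /eqP.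
have Y0 i : cmY zeta i = 0.
  apply/matrixP => j k; rewrite [RHS]mxE; have [<-{k}|jk] := eqVneq j k; last first.
    apply: (@cyclic_unique _ _ (d j) (d k) (fun i => cmY zeta i j k)) => //.
    by apply: nuD; rewrite eq_sym.
  have Yc i' : cmY zeta i' j j = cmY zeta (ord_pred i') j j.
    by apply: (mulIf (nu0 j)); rewrite Yrec mulrC.
  have Yc' p : cmY zeta i j j = cmY zeta (iter p (@ordS m) i) j j.
    by elim: p => //= p ->; rewrite [RHS]Yc ordSK.
  have : \sum_(i' < m) cmY zeta i j j = 0.
    (* From [i] one reaches [i'] in [m - i + i'] successor steps modulo [m]. *)
    rewrite -[RHS](Ys j); apply: eq_bigr => i' _; rewrite (Yc' (m - i + i')%N).
    congr (cmY zeta _ j j); apply: val_inj; rewrite /= iter_ordSE addnA subnKC ?modnDl ?modn_small//.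
    exact: ltnW.
  by rewrite sumr_const card_ord -mulr_natl => /eqP; rewrite mulf_eq0 (negbTE m0') => /eqP.
apply: cm_vectorP => i; rewrite ?X0 ?v0 ?w0 ?Y0.
- by rewrite /cmX row0 linear0.
- by rewrite /cmY row0 linear0.
- by rewrite /cmv row0 trmx0.
- by rewrite /cmw row0.
Qed.

(** After [gauge_fixing] the [X] part is diagonal and independent of [i]. Then [h] is read off from
    the components, and [cm_dmom_inj] shows that nothing remains. *)
Lemma cm_tangent_decomposition lam (x : phase_level lam) eta : \sum_r lam r != 0 ->
  (forall i, cm_dmom (cm_point lam (val x)) eta i = 0) ->
  exists h g, tangent (@phase_moment C m n) x h /\
    eta = 'd (cm_point lam : V -> cmvec) (val x) h + gauge_dir g (cm_point lam (val x)).
Proof.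
move=> lam0 teta; set z := cm_point lam (val x) in teta *.
have m0' : m%:R != 0 :> C by rewrite pnatr_eq0 -lt0n.
have [xreg _] := set_mem (valP x); have /hregP[nu0 nuD] := xreg.
have zL : cm_level lam z by apply: cm_point_level; exact: set_mem (valP x).
have [g [e gE]] := gauge_fixing (cmX eta) nu0 nuD.
pose eta' := eta - gauge_dir g z.
have zX i : cmX z i = diag_mx (\row_j nu (val x) j) by rewrite /z /cm_point cmXK.
have zv i j : cmv z i j ord0 = phi (val x) j i by rewrite /z /cm_point cmvK mxE.
have zw i j : cmw z i ord0 j = psi (val x) i j by rewrite /z /cm_point cmwK mxE.
have X' i : cmX eta' i = diag_mx (\row_j e j).
  by rewrite cmXB /gauge_dir cmXK !zX gE.
have t' i : cm_dmom z eta' i = 0.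
  by rewrite cm_dmomB teta (gauge_dir_dmom E g i zL) subrr.
pose h : V := mk_phase e (fun j => m%:R^-1 * \sum_i cmY eta' i j j)
   (fun j r => cmv eta' r j ord0) (fun r j => cmw eta' r ord0 j).
have th : tangent (@phase_moment C m n) x h.
  apply/phase_tangentP => j.
  (* Summed over [i], the diagonal terms in [X] and [Y] cancel around the cycle and leave the
     differential of the phase moment. *)
  have : \sum_i cm_dmom z eta' i j j = 0 by apply: big1 => i _; rewrite t' mxE.
  under eq_bigr do rewrite (cm_dmom_diag _ _ _ zX X') zv zw.
  rewrite !sumrB.
  have -> : \sum_i (e j * cmY z (ord_pred i) j j + nu (val x) j * cmY eta' (ord_pred i) j j)
    = \sum_i (cmY eta' i j j * nu (val x) j + cmY z i j j * e j).
    rewrite (sum_ord_pred (fun i => e j * cmY z i j j + nu (val x) j * cmY eta' i j j)).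
    by apply: eq_bigr => i _; ring.
  rewrite subrr sub0r => /eqP; rewrite oppr_eq0 => /eqP H; rewrite -[RHS]H /phase_dmom.
  by apply: eq_bigr => r _; rewrite !mk_phaseE.
exists h, g; split=> //; apply/eqP; rewrite -subr_eq -subr_eq0 -/eta'; apply/eqP.
set zeta := eta' - _.
have [dX dY dv dw] := cm_point_diff lam h m0 xreg.
have X0 i : cmX zeta i = 0.
  rewrite cmXB X' dX; apply/matrixP => j k; rewrite !mxE; case: eqP => _; last by rewrite subrr.
  by rewrite nu_mk subrr.
have v0 i : cmv zeta i = 0.
  rewrite cmvB dv; apply/matrixP => j k; rewrite [k]ord1.
  by rewrite [LHS]mxE [X in _ + X]mxE [X in _ - X]mxE phi_mk [RHS]mxE subrr.
have w0 i : cmw zeta i = 0.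
  rewrite cmwB dw; apply/matrixP => j k; rewrite [j]ord1.
  by rewrite [LHS]mxE [X in _ + X]mxE [X in _ - X]mxE psi_mk [RHS]mxE subrr.
have tz i : cm_dmom z zeta i = 0 by rewrite cm_dmomB t' cm_point_tangent// subrr.
apply: (cm_dmom_inj nu0 nuD zX tz X0) => // j.
have -> : \sum_i' cmY zeta i' j j = \sum_i' (cmY eta' i' j j - cmY ('d (cm_point lam : V -> cmvec) (val x) h) i' j j).
  by apply: eq_bigr => i' _; rewrite cmYB !mxE.
by rewrite sumrB dY mu_mk mulVKf// subrr.
Qed.

End TangentDecomposition.

Lemma differential_at_eq (C : numClosedFieldType) (V W : normedModType C) (L : set V)
    (e : equiv_rel L) (mom : V -> W) (f : orbit_space e -> C) (x : L) (F' l : V -> C) h :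
  (forall F, differentiable F (val x) -> (\forall y \near x, F (val y) = F' (val y)) ->
    'd F (val x) h = 'd F' (val x) h) ->
  (forall y : L, F' (val y) = f (\pi_(orbit_space e) y)%qT) ->
  differential_at mom f x l -> tangent mom x h -> l h = 'd F' (val x) h.
Proof.
move=> uniq F'E [F [dF Ff lF]] th; rewrite lF//; apply: uniq => //.
by apply: (@filterS _ (nbhs x) _ _ _ _ Ff) => y ->; rewrite F'E.
Qed.

(** * Hamiltonian vectors on the phase space and Poisson commutation *)

Section HamiltonianVectors.
Context {C : numClosedFieldType} (E : exponential C) {m n : nat}.
Local Notation cmvec := (@cm_vector C m n).
Local Notation V := (@phase_vector C m n).
Variables (lam : 'I_m -> C).
Implicit Types (x : @phase_level C m n lam) (z eta : cmvec).
Hypothesis m0 : (0 < m)%N.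
Hypothesis lam0 : \sum_r lam r != 0.
Local Notation Psi := (cm_point lam : V -> cmvec).
Local Notation hamvec := (hamiltonian_vector (@phase_moment C m n) (@phase_form C m n)).

Lemma gauge_dirD g g' z :
  gauge_dir (fun i => g i + g' i) z = gauge_dir g z + gauge_dir g' z :> cmvec.
Proof.
suff <- : gauge_dir (fun i => g i + g' i) z - gauge_dir g' z = gauge_dir g z by rewrite subrK.
apply: cm_vectorP => i;
  rewrite ?cmXB ?cmYB ?cmvB ?cmwB /gauge_dir !cmE !(mulmxDl, mulmxDr).
- by apply/matrixP => j k; do ![rewrite [in LHS]mxE]; do ![rewrite [in RHS]mxE]; ring.
- by apply/matrixP => j k; do ![rewrite [in LHS]mxE]; do ![rewrite [in RHS]mxE]; ring.
- by rewrite addrK.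
- by rewrite opprD addrK.
Qed.

Lemma cm_form_gauge_tangent x g eta :
  (forall i, cm_dmom (cm_point lam (val x)) eta i = 0) ->
  cm_form (gauge_dir g (cm_point lam (val x))) eta = 0.
Proof.
by move=> te; rewrite cm_form_gauge_dir big1// => i _; rewrite te mulmx0 mxtrace0.
Qed.

(** Scaling the pairs [(phi_j, psi_j)] acts on representations as a diagonal gauge transformation.
    Both sides have the same [X], [v], [w] parts and diagonal sums of [Y], so [cm_dmom_inj]
    identifies them. *)
Lemma diff_cm_point_scaling x e :
  'd Psi (val x) (phase_scaling (val x) e)
  = gauge_dir (fun=> diag_mx (\row_j e j)) (cm_point lam (val x)).
Proof.
have [xreg _] := set_mem (valP x); have /hregP[nu0 nuD] := xreg.
have [dX dY dv dw] := cm_point_diff lam (phase_scaling (val x) e) m0 xreg.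
have zL : cm_level lam (cm_point lam (val x)).
  by apply: cm_point_level; exact: set_mem (valP x).
apply/eqP; rewrite -subr_eq0; apply/eqP.
apply: (cm_dmom_inj m0 (z := cm_point lam (val x)) nu0 nuD).
- by move=> i; rewrite /cm_point cmXK.
- move=> i; rewrite cm_dmomB (gauge_dir_dmom E _ i zL) cm_point_tangent ?subrr//.
  by apply/phase_tangentP => j; exact: phase_scaling_dmom.
- move=> i; rewrite cmXB dX /gauge_dir cmXK /cm_point cmXK diag_mxC subrr subr0.
  by apply/matrixP => j k; rewrite !mxE nu_mk mul0rn.
- move=> j; under eq_bigr do rewrite cmYB mxE.
  rewrite big_split /= dY mu_mk mulr0 add0r big1// => i _.
  rewrite /gauge_dir cmYK; move: (cmY (cm_point _ _) i) => M.
  by rewrite mul_mx_diag mul_diag_mx !mxE mulrC subrr oppr0.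
- move=> i; rewrite cmvB dv /gauge_dir cmvK mul_diag_mx /cm_point cmvK.
  by apply/matrixP => j k; rewrite [LHS]mxE [X in X + _]mxE phi_mk [X in _ + X]mxE !mxE subrr.
- move=> i; rewrite cmwB dw /gauge_dir cmwK mul_mx_diag /cm_point cmwK.
  apply/matrixP => j k; rewrite [LHS]mxE [X in X + _]mxE psi_mk [X in _ + X]mxE !mxE.
  by rewrite mulrC subrr.
Qed.

Lemma diff_hamiltonian k x h :
  differentiable (cm_hamiltonian k \o Psi) (val x) /\
  'd (cm_hamiltonian k \o Psi) (val x) h
  = cm_dham k (cm_point lam (val x)) ('d Psi (val x) h).
Proof.
have [xreg _] := set_mem (valP x); have dP := cm_point_differentiable lam xreg.
have dH : differentiable (cm_hamiltonian k \o Psi) (val x).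
  by apply: differentiable_comp => //; exact: cm_hamiltonian_differentiable.
split=> //; apply: diff_is_derive => //.
exact: (is_derive_cm_hamiltonian k (is_derive_diff h dP)).
Qed.

Lemma hamiltonian_differential k x :
  differential_at (@phase_moment C m n) (@hamiltonian C m n lam k) x
    (fun h => cm_dham k (cm_point lam (val x)) ('d Psi (val x) h)).
Proof.
exists (cm_hamiltonian k \o Psi); split.
- by have [] := diff_hamiltonian k x 0.
- apply: (@filterS _ (nbhs x) _ _ _ _ filterT) => y _; exact: (esym (hamiltonianE k y)).
- by move=> h _; have [_ ->] := diff_hamiltonian k x h.
Qed.

Lemma hamiltonian_differential_unique k x l h :
  differential_at (@phase_moment C m n) (@hamiltonian C m n lam k) x l ->
  tangent (@phase_moment C m n) x h ->
  l h = cm_dham k (cm_point lam (val x)) ('d Psi (val x) h).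
Proof.
move=> dl th; have [dH <-] := diff_hamiltonian k x h.
apply: (differential_at_eq _ _ dl th) => [F dF Ff|y]; last exact: (esym (hamiltonianE k y)).
exact: (diff_unique_on_level lam0 th dF dH).
Qed.

(** The phase part of the decomposition of [ham_field] is Hamiltonian, because the gauge part pairs
    to zero with the images of tangent vectors. *)
Lemma hamiltonian_vector_exists k x : exists h g,
  [/\ hamvec (@hamiltonian C m n lam k) x h, tangent (@phase_moment C m n) x h &
      ham_field k (cm_point lam (val x))
      = 'd Psi (val x) h + gauge_dir g (cm_point lam (val x))].
Proof.
have [xreg _] := set_mem (valP x).
have zL : cm_level lam (cm_point lam (val x)).
  by apply: cm_point_level; exact: set_mem (valP x).
have [h [g [th hE]]] := cm_tangent_decomposition E m0 lam0 (fun i => flow_tangent E k i zL).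
exists h, g; split=> //; split=> //; eexists; first exact: hamiltonian_differential.
move=> h' th' /=; rewrite -ham_field_form hE -(cm_point_symplectic lam h h' m0 xreg).
apply/esym/eqP; rewrite -subr_eq0 -cm_formB addrAC subrr add0r.
rewrite cm_form_gauge_tangent// => i; exact: cm_point_tangent.
Qed.

(** Two Hamiltonian vectors of the same function differ by a radical vector, that is a scaling, and
    [cm_point] sends scalings to gauge directions. *)
Lemma hamiltonian_vectorP k x xi : hamvec (@hamiltonian C m n lam k) x xi ->
  exists g, ham_field k (cm_point lam (val x))
            = 'd Psi (val x) xi + gauge_dir g (cm_point lam (val x)).
Proof.
move=> [txi [l dl xiE]].
have [h [g [[_ [l' dl' hE]] th ->]]] := hamiltonian_vector_exists k x.
have [|e xih] := (phase_radicalP x (h - xi) m0 lam0).1.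
  split.
    apply/phase_tangentP => j; move/phase_tangentP: th => /(_ j) th; move/phase_tangentP: txi => /(_ j) txi.
    transitivity (phase_dmom (val x) h j - phase_dmom (val x) xi j); last by rewrite th txi subrr.
    rewrite /phase_dmom -sumrB; apply: eq_bigr => r _; rewrite -scaleN1r !(phiD, psiD) !(phiZ, psiZ) //; ring.
  move=> h' th'; have -> : phase_form (h - xi) h' = phase_form h h' - phase_form xi h'.
    rewrite /phase_form -sumrB; apply: eq_bigr => j _.
    rewrite !(nuD, muD) -scaleN1r !(nuZ, muZ).
    under eq_bigr do rewrite phiD psiD phiZ psiZ.
    set S := \sum_r _.
    have -> : S = \sum_r (phi h j r * psi h' r j - phi h' j r * psi h r j)
      - \sum_r (phi xi j r * psi h' r j - phi h' j r * psi xi r j).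
      by rewrite -sumrB; apply: eq_bigr => r _; ring.
    by move: (\sum_r _) (\sum_r _) => a b; ring.
  by rewrite hE// xiE// (hamiltonian_differential_unique dl th') (hamiltonian_differential_unique dl' th') subrr.
exists (fun i => diag_mx (\row_j e j) + g i).
rewrite gauge_dirD -diff_cm_point_scaling -xih addrA; congr (_ + _).
have dD u v : 'd Psi (val x) (u + v) = 'd Psi (val x) u + 'd Psi (val x) v by exact: linearD.
by rewrite -dD (addrC xi) subrK.
Qed.

Lemma hamiltonians_commute k l :
  poisson_commute (@phase_moment C m n) (@phase_form C m n)
    (@hamiltonian C m n lam k) (@hamiltonian C m n lam l).
Proof.
move=> x; have [xreg _] := set_mem (valP x).
have zL : cm_level lam (cm_point lam (val x)).
  by apply: cm_point_level; exact: set_mem (valP x).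
have [h [g [hv th hE]]] := hamiltonian_vector_exists k x.
have [h' [g' [hv' th' hE']]] := hamiltonian_vector_exists l x.
exists h, h'; split; [exact: hv|exact: hv'|]; rewrite -(cm_point_symplectic lam h h' m0 xreg).
set z := cm_point lam (val x) in zL hE hE' *.
have -> : 'd Psi (val x) h = ham_field k z - gauge_dir g z by rewrite hE addrK.
rewrite cm_formB cm_form_gauge_tangent ?subr0; last by move=> i; exact: cm_point_tangent.
rewrite cm_formC; have -> : 'd Psi (val x) h' = ham_field l z - gauge_dir g' z.
  by rewrite hE' addrK.
rewrite cm_formB ham_fields_orthogonal cm_form_gauge_tangent ?subr0 ?oppr0// => i.
exact: (flow_tangent E k i zL).
Qed.

End HamiltonianVectors.

Lemma diff_invariant (K : numFieldType) (V W : normedModType K) (F : V -> W)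
    (L : V -> V) x y h :
  (forall u v, L (u + v) = L u + L v) -> (forall c u, L (c *: u) = c *: L u) ->
  (forall z, F (L z) = F z) -> y = L x -> differentiable F x -> differentiable F y ->
  'd F y (L h) = 'd F x h.
Proof.
move=> LD LZ FL -> dx dy; rewrite -!deriveE// /derive.
suff -> : (fun s => s^-1 *: ((F \o shift (L x)) (s *: L h) - F (L x)))
  = (fun s => s^-1 *: ((F \o shift x) (s *: h) - F x)) by [].
by apply/funext => s /=; rewrite -LZ -LD !FL.
Qed.

(** * Transport of independence along rescaling orbits *)

Section RescaleInvariance.
Context {C : numClosedFieldType} (E : exponential C) {m n : nat}.
Local Notation cmvec := (@cm_vector C m n).
Local Notation V := (@phase_vector C m n).
Variables (lam : 'I_m -> C).
Implicit Types (x y : @phase_level C m n lam).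
Hypothesis m0 : (0 < m)%N.
Hypothesis lam0 : \sum_r lam r != 0.
Local Notation Psi := (cm_point lam : V -> cmvec).

Lemma phi_rescale d (z : V) j r : phi (rescale d z) j r = d j * phi z j r.
Proof. by rewrite [LHS]mxE. Qed.

Lemma psi_rescale d (z : V) r j : psi (rescale d z) r j = (d j)^-1 * psi z r j.
Proof. by rewrite [LHS]mxE. Qed.

Lemma differentiable_phase (W : normedModType C) (c : W -> V) t :
  (forall j, differentiable (fun s => nu (c s) j) t) ->
  (forall j, differentiable (fun s => mu (c s) j) t) ->
  (forall j r, differentiable (fun s => phi (c s) j r) t) ->
  (forall r j, differentiable (fun s => psi (c s) r j) t) ->
  differentiable c t.
Proof.
move=> H1 H2 H3 H4.
have -> : c = fun s => ((c s).1.1.1, (c s).1.1.2, (c s).1.2, (c s).2).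
  by apply/funext => s; case: (c s) => [[[]]].
apply: differentiable_pair; first apply: differentiable_pair; first apply: differentiable_pair;
  apply: differentiable_mx => a b; rewrite ?[a]ord1.
- exact: H1.
- exact: H2.
- exact: H3.
- exact: H4.
Qed.

Lemma phase_orbits x y : same_phase_equiv lam x y -> exists g : V -> V,
  [/\ {for val x, continuous g}, val y = g (val x) &
      forall z : @phase_level C m n lam, exists2 w : @phase_level C m n lam,
        val w = g (val z) & same_phase_equiv lam z w].
Proof.
move=> /asboolP[d d0 yE]; exists (rescale d); split; [|exact: yE|].
- have [d1 d2 d3 d4] := phase_parts_differentiable (val x).
  apply: (differentiable_continuous (_ : differentiable (rescale d) (val x))).
  apply: differentiable_phase => // [j r|r j].
    by under eq_fun do rewrite phi_rescale; apply: differentiableM.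
  by under eq_fun do rewrite psi_rescale; apply: differentiableM.
- move=> z; have [zreg /rowP zmom] := set_mem (valP z).
  have zL : phase_level lam (rescale d (val z)).
    split=> //; apply/rowP => j; rewrite -zmom !mxE; apply: eq_bigr => r _.
    by rewrite phi_rescale psi_rescale mulrACA divff ?mul1r.
  by exists (level_point zL) => //; apply/asboolP; exists d.
Qed.

(** Independence in terms of explicit differentials, which can be compared at different points of a
    rescaling orbit. *)
Definition dham_independent x := forall a : 'I_(m * n) -> C,
  (forall h, tangent (@phase_moment C m n) x h ->
     \sum_k a k * cm_dham k.+1 (Psi (val x)) ('d Psi (val x) h) = 0) ->
  forall k, a k = 0.

Lemma dham_independent_at x : dham_independent x ->
  independent_at (@phase_moment C m n) (fun k : 'I_(m * n) => @hamiltonian C m n lam k.+1) x.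
Proof.
move=> ind; exists (fun k h => cm_dham k.+1 (Psi (val x)) ('d Psi (val x) h)).
by split=> // k; exact: hamiltonian_differential.
Qed.

Lemma rescaleD d (z h : V) : rescale d (z + h) = rescale d z + rescale d h.
Proof.
apply: phase_vectorP => [j|j|j r|r j]; 
  rewrite ?phi_rescale ?psi_rescale.
- by rewrite /nu /= !mxE.
- by rewrite /mu /= !mxE.
- by rewrite [RHS]phiD !phi_rescale phiD mulrDr.
- by rewrite [RHS]psiD !psi_rescale psiD mulrDr.
Qed.

Lemma rescaleZ d c (h : V) : rescale d (c *: h) = c *: rescale d h.
Proof.
apply: phase_vectorP => [j|j|j r|r j]; 
  rewrite ?phi_rescale ?psi_rescale.
- by rewrite /nu /= !mxE.
- by rewrite /mu /= !mxE.
- by rewrite [RHS]phiZ !phi_rescale phiZ mulrCA.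
- by rewrite [RHS]psiZ !psi_rescale psiZ mulrCA.
Qed.

Lemma cm_dham_rescale k x y d h : (forall j, d j != 0) -> val y = rescale d (val x) ->
  cm_dham k (Psi (val y)) ('d Psi (val y) (rescale d h))
  = cm_dham k (Psi (val x)) ('d Psi (val x) h).
Proof.
move=> d0 yE; have [dy <-] := diff_hamiltonian k y (rescale d h).
have [dx <-] := diff_hamiltonian k x h.
apply: (diff_invariant _ (rescaleD d) (rescaleZ d)) => // z.
by rewrite /comp; have [g ug ->] := cm_point_rescale lam z d0; rewrite cm_hamiltonian_gauge.
Qed.

Lemma dham_independent_rescale x y : same_phase_equiv lam x y ->
  dham_independent y -> dham_independent x.
Proof.
move=> /asboolP[d d0 yE] iy a ax; apply: iy => h th.
have hE : h = rescale d (rescale (fun j => (d j)^-1) h).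
  by rewrite rescaleM -[LHS]rescale1; congr rescale; apply/funext => j; rewrite divff.
rewrite hE; under eq_bigr do rewrite (cm_dham_rescale _ _ d0 yE).
apply: ax; apply/phase_tangentP => j; move/phase_tangentP: th => /(_ j) <-.
apply: eq_bigr => r _; rewrite yE !phi_rescale !psi_rescale invrK.
by ring.
Qed.

End RescaleInvariance.

(** * Invertibility of the limiting Jacobian *)

Section ConfluentVandermonde.
Context {F : fieldType} {m n : nat} (zeta : F).
Hypothesis hzeta : m.-primitive_root zeta.
Variable y : 'I_n -> F.
Hypothesis y0 : forall j, y j != 0.
Hypothesis yD : forall j k, j != k -> y j ^+ m - y k ^+ m != 0.

(** A discrete Fourier transform over the residue classes shows that the polynomial with
    coefficients [b] vanishes at all [zeta^a y_j]. These are [m n] distinct points, and its degree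
    is below [m n]. *)
Lemma class_sums_inj (b : 'I_(m * n) -> F) :
  (forall (c : 'I_m) j, \sum_(k < (m * n) | (k.+1 %% m == c)%N) b k * y j ^+ k.+1 = 0) ->
  forall k, b k = 0.
Proof.
move=> bE; have m0 := prim_order_gt0 hzeta.
pose q : {poly F} := \sum_k b k *: 'X^k.
have szq : (size q <= m * n)%N.
  apply: (leq_trans (size_sum _ _ _)); apply/bigmax_leqP => k _.
  by apply: (leq_trans (size_scale_leq _ _)); rewrite size_polyXn ltn_ord.
have zeta0 : zeta != 0.
  apply/eqP => z0; have /eqP := prim_expr_order hzeta.
  by rewrite z0 expr0n gtn_eqF// eq_sym oner_eq0.
have rootq (a : 'I_m) j : root q (zeta ^+ a * y j).
  have u0 : zeta ^+ a * y j != 0 by rewrite mulf_neq0// expf_neq0.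
  apply/eqP/(mulIf u0); rewrite mul0r /q horner_sum mulr_suml.
  transitivity (\sum_(c < m) zeta ^+ (a * c) *
      \sum_(k < (m * n) | (k.+1 %% m == c)%N) b k * y j ^+ k.+1).
    rewrite (partition_big (fun k : 'I_(m * n) => Ordinal (ltn_pmod k.+1 m0)) xpredT) //=.
    apply: eq_bigr => c _; rewrite mulr_sumr; apply: eq_big => [k|k /eqP/(congr1 val)/= kc].
      by rewrite -val_eqE.
    rewrite hornerZ hornerXn -mulrA -exprSr exprMn -exprM.
    suff -> : zeta ^+ (a * k.+1) = zeta ^+ (a * c) by ring.
    by apply/eqP; rewrite (eq_prim_root_expr hzeta) -kc modnMmr.
  by apply: big1 => c _; rewrite bE mulr0.
pose rs := [seq zeta ^+ (a : 'I_m) * y j | a <- enum 'I_m, j <- enum 'I_n].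
have q0 : q = 0.
  apply: (@roots_geq_poly_eq0 _ q rs).
  - by apply/allP => u /allpairsP[[a j] [_ _ ->]]; exact: rootq.
  - apply: allpairs_uniq; try exact: enum_uniq.
    move=> [a j] [a' j'] /= _ _ E.
    have jj : j = j'.
      apply/eqP; apply/negP => /negP /yD /eqP; apply.
      have := congr1 (fun u => u ^+ m) E; rewrite !exprMn -!exprM ![(_ * m)%N]mulnC !exprM.
      by rewrite (prim_expr_order hzeta) !expr1n !mul1r => ->; rewrite subrr.
    move: E; rewrite jj => /(mulIf (y0 j')) /eqP; rewrite (eq_prim_root_expr hzeta).
    by rewrite !modn_small// => /eqP /val_inj ->.
  - by rewrite /rs size_allpairs !size_enum_ord.
move=> k; have := congr1 (fun p : {poly F} => p`_k) q0.
rewrite coef0 /q coef_sum (bigD1 k) //= coefZ coefXn eqxx mulr1 big1 ?addr0// => l lk.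
by rewrite coefZ coefXn val_eqE eq_sym (negbTE lk) mulr0.
Qed.

Definition circulant (psi : 'I_m -> F) : 'M[F]_m :=
  \matrix_(c, b) psi (iter c (@ord_pred m) b).

Lemma iter_ord_pred_mod k (i : 'I_m) :
  iter (k %% m) (@ord_pred m) i = iter k (@ord_pred m) i.
Proof.
rewrite [in RHS](divn_eq k m) addnC iterD; congr (iter _ _ _).
by elim: (k %/ m)%N => //= q IH; rewrite mulSn iterD -IH iter_ord_pred_m.
Qed.

Variables (psi : 'I_n -> 'I_m -> F) (N : 'I_n -> nat -> F) (i0 : 'I_m).
Hypothesis i0E : val i0 = 0%N.
Hypothesis Nmod : forall j k, N j (k %% m)%N = N j k.
Hypothesis N0 : forall j, N j 0%N != 0.
Hypothesis charF : forall k : nat, k.+1%:R != 0 :> F.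
Hypothesis circU : forall j, circulant (psi j) \in unitmx.

(** Grouping by the class [c] of [k + 1] modulo [m], the hypothesis says for each [j] that the
    invertible circulant annihilates a row with entries [N_0 P_c], plus a term [S] at [c = 0]. So
    [P_c = 0] for [c] nonzero, and [class_sums_inj] kills [a k] outside the class 0. In that class
    [N_(k+1) = N_0], and the two contributions combine to [(k + 1) a_k], to which [class_sums_inj]
    applies again. *)
Lemma limit_jacobian_inj (a : 'I_(m * n) -> F) :
  (forall b j, \sum_k a k * (y j ^+ k.+1 * (k%:R * psi j b * N j k.+1
      + N j 0%N * psi j (iter k.+1 (@ord_pred m) b))) = 0) ->
  forall k, a k = 0.
Proof.
move=> H; have m0 := prim_order_gt0 hzeta.
pose P j (c : 'I_m) := \sum_(k < (m * n) | (k.+1 %% m == c)%N) a k * y j ^+ k.+1.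
pose S j := \sum_(k : 'I_(m * n)) a k * y j ^+ k.+1 * k%:R * N j k.+1.
have U j : (\row_c (N j 0%N * P j c + S j *+ (c == i0))) *m circulant (psi j) = 0.
  apply/rowP => b; rewrite [LHS]mxE [RHS]mxE -[RHS](H b j).
  under eq_bigr do rewrite !mxE mulrDl; rewrite big_split /= addrC.
  rewrite (bigD1 i0) //= [X in _ + X + _]big1 ?addr0 => [|c /negbTE ->]; last first.
    by rewrite mulr0n mul0r.
  rewrite eqxx mulr1n i0E /= /S mulr_suml.
  have -> : \sum_c N j 0%N * P j c * psi j (iter c (@ord_pred m) b)
    = \sum_(k : 'I_(m * n)) a k * y j ^+ k.+1 * (N j 0%N * psi j (iter k.+1 (@ord_pred m) b)).
    rewrite [RHS](partition_big (fun k : 'I_(m * n) => Ordinal (ltn_pmod k.+1 m0)) xpredT) //=.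
    apply: eq_bigr => c _; rewrite /P mulr_sumr mulr_suml.
    apply: eq_big => [k|k /eqP kc]; first by rewrite -val_eqE.
    by rewrite -iterS -(iter_ord_pred_mod k.+1 b) kc; ring.
  by rewrite -big_split; apply: eq_bigr => k _ /=; ring.
have {}U j c : N j 0%N * P j c + S j *+ (c == i0) = 0.
  have /rowP/(_ c) : \row_c (N j 0%N * P j c + S j *+ (c == i0)) = 0.
    by apply: (can_inj (mulmxK (circU j))); rewrite U mul0mx.
  by rewrite !mxE.
have a1 (k : 'I_(m * n)) : (k.+1 %% m)%N != 0%N -> a k = 0.
  move=> km; pose b (k : 'I_(m * n)) : F := if (k.+1 %% m == 0)%N then 0 else a k.
  suff : b k = 0 by rewrite /b (negbTE km).
  apply: class_sums_inj => c j; have [ci|ci] := eqVneq c i0.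
    by apply: big1 => l; rewrite ci i0E /b => ->; rewrite mul0r.
  have := U j c; rewrite (negbTE ci) addr0 => /eqP; rewrite mulf_eq0 (negbTE (N0 j)) /=.
  move=> /eqP Pc; rewrite -[RHS]Pc; apply: eq_bigr => l /eqP lc.
  by rewrite /b lc -i0E val_eqE (negbTE ci).
move=> k; have [km|/a1//] := eqVneq (k.+1 %% m)%N 0%N.
suff /eqP : k.+1%:R * a k = 0 by rewrite mulf_eq0 (negbTE (charF k)) => /eqP.
apply: (class_sums_inj (b := fun k : 'I_(m * n) => k.+1%:R * a k)) => c j.
have [->|ci] := eqVneq c i0; last first.
  apply: big1 => l /eqP lc; rewrite a1 ?mulr0 ?mul0r//.
  by rewrite lc -i0E val_eqE.
apply: (mulfI (N0 j)); rewrite mulr0 -[RHS](U j i0) eqxx mulr1n /S /P i0E.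
rewrite [X in _ = _ + X](bigID (fun k : 'I_(m * n) => k.+1 %% m == 0)%N) /=.
rewrite [X in _ = _ + (_ + X)]big1 ?addr0 => [|l /a1 ->]; last by rewrite !mul0r.
rewrite !mulr_sumr -big_split; apply: eq_bigr => l /eqP l0 /=.
by rewrite -(Nmod j l.+1) l0 -natr1; ring.
Qed.

End ConfluentVandermonde.

(** * The Jacobian of the Hamiltonians in the directions of [mu] and [phi] *)

Section Jacobian.
Context {C : numClosedFieldType} {m n : nat}.
Local Notation N := (\sum_(i < m) n)%N.
Local Notation cmvec := (@cm_vector C m n).
Local Notation V := (@phase_vector C m n).
Implicit Types (lam : 'I_m -> C) (x h : V) (z eta : cmvec).

Definition block_dham k (Y T : 'M[C]_N) (v dv : 'M[C]_(N, 1)) (w : 'M[C]_(1, N)) : C :=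
  - (w *m pow_diff k Y T *m v + w *m Y ^+ k *m dv) ord0 ord0.

Lemma cm_dhamE k z eta : (forall i, cmw eta i = 0) ->
  cm_dham k z eta
  = block_dham k (blockY z) (blockY eta) (blockv z) (blockv eta) (blockw z).
Proof.
move=> w0; rewrite /cm_dham /block_dham (_ : blockw eta = 0) ?mul0mx ?add0r//.
by rewrite -[RHS]mxrow0; apply/eq_mxrowP => i; rewrite w0.
Qed.

Lemma blockY_affine z z' z'' (s : C) :
  (forall i, cmY z'' i = cmY z i + s *: cmY z' i) ->
  blockY z'' = blockY z + s *: blockY z'.
Proof.
move=> H; apply/matrixP => a b; rewrite [LHS]mxE [RHS]mxE [X in _ = X + _]mxE.
rewrite [X in _ = _ + X]mxE [X in _ = _ + _ * X]mxE.
case: eqP => _; last by rewrite mxE mulr0 addr0.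
by rewrite H [LHS]mxE [X in _ + X]mxE.
Qed.

Lemma eq_blockY z z' : (forall i, cmY z i = cmY z' i) -> blockY z = blockY z'.
Proof. by move=> H; apply/eq_mxblockP => i j; case: eqP. Qed.

Lemma eq_blockv z z' : (forall i, cmv z i = cmv z' i) -> blockv z = blockv z'.
Proof. by move=> H; apply/eq_mxcolP. Qed.

Lemma eq_blockw z z' : (forall i, cmw z i = cmw z' i) -> blockw z = blockw z'.
Proof. by move=> H; apply/eq_mxrowP. Qed.

(* The Lax matrices are affine in [(mu, phi)]; their linear part in a direction
   [h] is read off the point [polar x h] with zero weight. *)
Definition polar x h : V := mk_phase (nu x) (mu h) (phi h) (psi x).

Lemma Y_affine lam x h s i : (forall j, nu h j = 0) -> (forall r j, psi h r j = 0) ->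
  cmY (cm_point lam (x + s *: h)) i
  = cmY (cm_point lam x) i + s *: cmY (cm_point (fun=> 0) (polar x h)) i.
Proof.
move=> nuh psih; rewrite /cm_point !cmYK; apply/matrixP => j k; rewrite !mxE.
have de a b r : diag_entry (x + s *: h) a b r = diag_entry x a b r + s * diag_entry (polar x h) a b r.
  by rewrite /diag_entry psiD phiD psiZ phiZ psih !mk_phaseE; ring.
have nuE a : nu (x + s *: h) a = nu x a by rewrite nuD nuZ nuh mulr0 addr0.
have sumE (P : pred 'I_m) (c : 'I_m -> C) :
  \sum_(r | P r) c r * (lam r + diag_entry (x + s *: h) j j r)
  = \sum_(r | P r) c r * (lam r + diag_entry x j j r)
    + s * \sum_(r | P r) c r * (0 + diag_entry (polar x h) j j r).
  by rewrite mulr_sumr -big_split; apply: eq_bigr => r _ /=; rewrite de; ring.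
case: eqP => _.
  have sum1 (P : pred 'I_m) := sumE P (fun=> 1).
  rewrite /Y_diag nuE muD muZ !mk_phaseE sumE.
  have -> : \sum_(r < m | (r <= i)%N) (lam r + diag_entry (x + s *: h) j j r)
    = \sum_(r < m | (r <= i)%N) (lam r + diag_entry x j j r)
      + s * \sum_(r < m | (r <= i)%N) (0 + diag_entry (polar x h) j j r).
    by rewrite mulr_sumr -big_split; apply: eq_bigr => r _ /=; rewrite de; ring.
  move: (\sum_(_ < _ | _) _) (\sum_(_ < _ | _) _) (\sum_(_ < _) _) (\sum_(_ < _) _).
  by move=> a b c d; ring.
rewrite /Y_offdiag mulrN mulr_sumr -opprD -big_split; congr (- _); apply: eq_bigr => l _ /=.
by rewrite de !nuE !mk_phaseE; ring.
Qed.

Lemma diff_cm_point_polar lam x h : (0 < m)%N -> hreg x ->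
  (forall j, nu h j = 0) -> (forall r j, psi h r j = 0) ->
  let eta := 'd (cm_point lam : V -> cmvec) x h in
  [/\ forall i, cmY eta i = cmY (cm_point (fun=> 0) (polar x h)) i,
      forall i, cmv eta i = cmv (cm_point (fun=> 0) (polar x h)) i &
      forall i, cmw eta i = 0].
Proof.
move=> m0 xreg nuh psih eta; have [_ _ dv dw] := cm_point_diff lam h m0 xreg.
split=> i.
- have x0 : x + (0 : C) *: h = x by rewrite scale0r addr0.
  have dP : differentiable (cm_point lam : V -> cmvec) (x + (0 : C) *: h).
    by rewrite x0; exact: cm_point_differentiable.
  have := is_derive_curve dP (is_derive_line x h 0).
  rewrite x0 -/eta => /is_derive_cm_parts[_ /(_ i) H _ _]; apply: (is_derive_unique H).
  by apply: (is_derive_ext (is_derive_line _ _ _)) => // s; rewrite /= Y_affine.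
- by rewrite dv /cm_point cmvK; apply/matrixP => j k; rewrite !mxE mk_phaseE.
- by rewrite dw; apply/matrixP => j k; rewrite !mxE psih.
Qed.

(** [m n] tangent directions, indexed without choosing a basis of the hyperplane orthogonal to
    [psi_j]: the [phi] parts satisfy one relation for each [j], with coefficients [phi_j], and the
    same combination of the [mu] parts is a multiple of [mu_j]. The [mu] part is proportional to
    [mu_j] so that it scales along with [Y]. *)
Definition jac_dir x (b : 'I_m) (j : 'I_n) : V :=
  mk_phase (fun=> 0) (fun k => (k == j)%:R * (psi x b j * mu x j))
    (fun k r => (k == j)%:R * ((\sum_q phi x j q * psi x q j) * (r == b)%:R
                               - psi x b j * phi x j r)) (fun _ _ => 0).

Lemma jac_dir_dmom x b j k : phase_dmom x (jac_dir x b j) k = 0.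
Proof.
rewrite /phase_dmom; under eq_bigr do rewrite !mk_phaseE mulr0 addr0 -mulrA.
rewrite -mulr_sumr; have [->|kj] := eqVneq k j; last by rewrite mul0r.
rewrite mul1r; under eq_bigr do rewrite mulrBl.
rewrite sumrB (bigD1 b) //= eqxx mulr1 [X in _ + X - _]big1 ?addr0 => [|r rb]; last first.
  by rewrite (negbTE rb) mulr0 mul0r.
under [X in _ - X]eq_bigr do rewrite -mulrA.
by rewrite -mulr_sumr mulrC subrr.
Qed.

(** Rows are the Hamiltonians [H_(k+1)], columns the directions [jac_dir]; the variations of [Y] and
    [v] are written through [polar], so that the entries are explicit functions of [x]. *)
Definition jac lam x : 'M[C]_(m * n) :=
  \matrix_k mxvec (\matrix_(b, j)
    block_dham k.+1 (blockY (cm_point lam x))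
      (blockY (cm_point (fun=> 0) (polar x (jac_dir x b j))))
      (blockv (cm_point lam x))
      (blockv (cm_point (fun=> 0) (polar x (jac_dir x b j))))
      (blockw (cm_point lam x))).

Lemma jac_independent lam (x : @phase_level C m n lam) : (0 < m)%N ->
  jac lam (val x) \in unitmx -> dham_independent x.
Proof.
move=> m0 uJ a aH k; have [xreg _] := set_mem (valP x).
suff : \row_k a k = 0 by move/rowP/(_ k); rewrite !mxE.
apply: (can_inj (mulmxK uJ)); rewrite mul0mx; apply/rowP => c.
case/mxvec_indexP: c => b j; rewrite [RHS]mxE [LHS]mxE.
have th : tangent (@phase_moment C m n) x (jac_dir (val x) b j).
  by apply/phase_tangentP => i; exact: jac_dir_dmom.
rewrite -[RHS](aH _ th); apply: eq_bigr => l _; rewrite mxE; congr (_ * _).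
have [dY dv dw] := diff_cm_point_polar lam m0 xreg (fun j' => nu_mk _ _ _ _ j' : nu (jac_dir (val x) b j) j' = 0)
  (fun r j' => psi_mk _ _ _ _ r j' : psi (jac_dir (val x) b j) r j' = 0).
rewrite mxE mxvecE mxE (cm_dhamE _ _ dw).
by rewrite (eq_blockY dY) (eq_blockv dv).
Qed.

Lemma jac_differentiable lam x : hreg x -> differentiable (jac lam) x.
Proof.
move=> xreg; have [d1 d2 d3 d4] := phase_parts_differentiable x.
apply: differentiable_mx => k c; case/mxvec_indexP: c => b j.
under eq_fun do rewrite mxE mxvecE mxE.
have dP := cm_point_differentiable lam xreg.
have dpol : differentiable (fun y : V => polar y (jac_dir y b j)) x.
  apply: differentiable_phase => [i|i|i r|r i]; under eq_fun do rewrite !mk_phaseE; try by [].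
  - apply: differentiableM; first exact: differentiable_cst.
    exact: differentiableM.
  - apply: differentiableM; first exact: differentiable_cst.
    apply: differentiableB; last exact: differentiableM.
    apply: differentiableM; last exact: differentiable_cst.
    by apply: differentiable_bigsum => q _; exact: differentiableM.
have dP0 : differentiable (fun y : V => cm_point (fun=> 0) (polar y (jac_dir y b j)) : cmvec) x.
  apply: (differentiable_comp (g := cm_point (fun=> 0) : V -> cmvec) dpol).
  apply: cm_point_differentiable; apply/hregP; move/hregP: xreg => [nu0 nuD].
  by split=> [i|i i']; rewrite !nu_mk; [exact: nu0|exact: nuD].
have dY := differentiable_comp dP (blockY_differentiable _).
have dv := differentiable_comp dP (blockv_differentiable _).
have dw := differentiable_comp dP (blockw_differentiable _).
have dT := differentiable_comp dP0 (blockY_differentiable _).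
have du := differentiable_comp dP0 (blockv_differentiable _).
apply: differentiableN; apply: differentiable_entry; apply: differentiableD.
  apply: differentiable_mulmx => //; apply: differentiable_mulmx => //.
  exact: pow_diff_differentiable.
apply: differentiable_mulmx => //; apply: differentiable_mulmx => //.
exact: expr_mx_differentiable.
Qed.

Lemma differentiable_det (W : normedModType C) p (A : W -> 'M[C]_p) t :
  differentiable A t -> differentiable (fun y => \det (A y)) t.
Proof.
move=> dA; rewrite /determinant; apply: differentiable_bigsum => s _.
apply: differentiableM; first exact: differentiable_cst.
by apply: differentiable_bigprod => i _; exact: differentiable_entry.
Qed.

End Jacobian.

(** * Functions of one variable that are polynomial *)

Section PolynomialFunctions.
Context {F : fieldType}.

Definition polyfun (f : F -> F) := exists p : {poly F}, forall e, f e = p.[e].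
Definition mx_polyfun p q (A : F -> 'M[F]_(p, q)) :=
  forall i j, polyfun (fun e => A e i j).

Lemma polyfun_ext f g : (forall e, f e = g e) -> polyfun f -> polyfun g.
Proof. by move=> fg [p pE]; exists p => e; rewrite -fg. Qed.

Lemma polyfun_cst c : polyfun (fun=> c).
Proof. by exists c%:P => e; rewrite hornerC. Qed.

Lemma polyfunD f g : polyfun f -> polyfun g -> polyfun (fun e => f e + g e).
Proof. by move=> [p pE] [q qE]; exists (p + q) => e; rewrite hornerD pE qE. Qed.

Lemma polyfunM f g : polyfun f -> polyfun g -> polyfun (fun e => f e * g e).
Proof. by move=> [p pE] [q qE]; exists (p * q) => e; rewrite hornerM pE qE. Qed.

Lemma polyfun_sum I (r : seq I) (P : pred I) (f : I -> F -> F) :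
  (forall i, P i -> polyfun (f i)) -> polyfun (fun e => \sum_(i <- r | P i) f i e).
Proof.
move=> H; elim: r => [|i r IH].
  by apply: (polyfun_ext _ (polyfun_cst 0)) => e; rewrite big_nil.
have [Pi|Pi] := boolP (P i).
  by apply: (polyfun_ext _ (polyfunD (H i Pi) IH)) => e; rewrite big_cons Pi.
by apply: (polyfun_ext _ IH) => e; rewrite big_cons (negbTE Pi).
Qed.

Lemma polyfun_prod I (r : seq I) (P : pred I) (f : I -> F -> F) :
  (forall i, P i -> polyfun (f i)) -> polyfun (fun e => \prod_(i <- r | P i) f i e).
Proof.
move=> H; elim: r => [|i r IH].
  by apply: (polyfun_ext _ (polyfun_cst 1)) => e; rewrite big_nil.
have [Pi|Pi] := boolP (P i).
  by apply: (polyfun_ext _ (polyfunM (H i Pi) IH)) => e; rewrite big_cons Pi.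
by apply: (polyfun_ext _ IH) => e; rewrite big_cons (negbTE Pi).
Qed.

Lemma polyfun_det p (A : F -> 'M[F]_p) : mx_polyfun A -> polyfun (fun e => \det (A e)).
Proof.
move=> H; apply: polyfun_sum => s _; apply: polyfunM; first exact: polyfun_cst.
by apply: polyfun_prod => i _; exact: H.
Qed.

Lemma mx_polyfun_cst p q (A : 'M[F]_(p, q)) : mx_polyfun (fun=> A).
Proof. by move=> i j; exact: polyfun_cst. Qed.

Lemma mx_polyfun_affine p q (A B : 'M[F]_(p, q)) : mx_polyfun (fun e => e *: A + B).
Proof.
move=> i j; exists ((A i j)%:P * 'X + (B i j)%:P) => e.
by rewrite hornerD hornerM !hornerC hornerX !mxE mulrC.
Qed.

Lemma mx_polyfunM p q r (A : F -> 'M[F]_(p, q)) (B : F -> 'M[F]_(q, r)) :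
  mx_polyfun A -> mx_polyfun B -> mx_polyfun (fun e => A e *m B e).
Proof.
move=> HA HB i j; apply: polyfun_ext (polyfun_sum (index_enum _) (P := xpredT)
  (fun k _ => polyfunM (HA i k) (HB k j))) => e.
by rewrite mxE.
Qed.

Lemma mx_polyfun_exp p (A : F -> 'M[F]_p) k : mx_polyfun A -> mx_polyfun (fun e => A e ^+ k).
Proof.
move=> HA; elim: k => [|k IH]; first exact: mx_polyfun_cst.
move=> i j; apply: polyfun_ext (mx_polyfunM HA IH i j) => e.
by rewrite exprS.
Qed.

Lemma mx_polyfun_pow_diff p (A B : F -> 'M[F]_p) k :
  mx_polyfun A -> mx_polyfun B ->
  mx_polyfun (fun e => \sum_(a < k) A e ^+ a *m B e *m A e ^+ (k - a.+1)).
Proof.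
move=> HA HB i j; apply: (polyfun_ext (f := fun e => \sum_(a < k)
    (A e ^+ a *m B e *m A e ^+ (k - a.+1)) i j)) => [e|]; first by rewrite summxE.
apply: polyfun_sum => a _; apply: mx_polyfunM; last exact: mx_polyfun_exp.
by apply: mx_polyfunM => //; exact: mx_polyfun_exp.
Qed.

End PolynomialFunctions.

(** * Homogeneity of the differentials and their values at diagonal [Y] *)

Section ScalingLimit.
Context {C : numClosedFieldType} {m n : nat}.
Local Notation N := (\sum_(i < m) n)%N.
Local Notation cmvec := (@cm_vector C m n).
Local Notation V := (@phase_vector C m n).
Implicit Types (lam : 'I_m -> C) (x h : V) (z eta : cmvec).

(** Each term contains [k] factors from [Y] and [T] in all. *)
Lemma block_dham_scale k t (Y T : 'M[C]_N) (v dv : 'M[C]_(N, 1)) (w : 'M[C]_(1, N)) :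
  block_dham k (t *: Y) (t *: T) v dv w = t ^+ k * block_dham k Y T v dv w.
Proof.
have eZ l : (t *: Y) ^+ l = t ^+ l *: Y ^+ l.
  elim: l => [|l IH]; first by rewrite !expr0 scale1r.
  by rewrite exprS IH -mulmxE -scalemxAl -scalemxAr scalerA -exprS mulmxE -exprS.
rewrite /block_dham /pow_diff eZ.
have -> : \sum_(a < k) (t *: Y) ^+ a *m (t *: T) *m (t *: Y) ^+ (k - a.+1)
  = t ^+ k *: \sum_(a < k) Y ^+ a *m T *m Y ^+ (k - a.+1).
  rewrite scaler_sumr; apply: eq_bigr => a _.
  rewrite !eZ -!scalemxAl -!scalemxAr -!scalemxAl !scalerA; congr (_ *: _).
  by rewrite -exprSr -exprD subnSK ?subnKC ?(ltnW (ltn_ord a)).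
rewrite -!scalemxAr -!scalemxAl -scalerDr [X in - X = _]mxE.
by rewrite -mulrN.
Qed.

Lemma block_dham_polyfun k (A B A' B' : 'M[C]_N) (v dv : 'M[C]_(N, 1)) (w : 'M[C]_(1, N)) :
  polyfun (fun e => block_dham k (e *: A + B) (e *: A' + B') v dv w).
Proof.
apply: (polyfun_ext (f := fun e => (-1) * ((w *m pow_diff k (e *: A + B) (e *: A' + B') *m v) ord0 ord0
    + (w *m (e *: A + B) ^+ k *m dv) ord0 ord0))) => [e|].
  by rewrite mulN1r /block_dham [in RHS]mxE.
apply: polyfunM; first exact: polyfun_cst.
apply: polyfunD; apply: mx_polyfunM; try exact: mx_polyfun_cst;
  apply: mx_polyfunM; try exact: mx_polyfun_cst.
  by apply: mx_polyfun_pow_diff; exact: mx_polyfun_affine.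
by apply: mx_polyfun_exp; exact: mx_polyfun_affine.
Qed.

Definition mu_dir (y : 'I_n -> C) : V := mk_phase (fun=> 0) y (fun _ _ => 0) (fun _ _ => 0).

Lemma Y_mu_dir x y i : cmY (cm_point (fun=> 0) (polar x (mu_dir y))) i = diag_mx (\row_j y j).
Proof.
have d0 j k r : diag_entry (polar x (mu_dir y)) j k r = 0.
  by rewrite /diag_entry !mk_phaseE mulr0.
rewrite /cm_point cmYK; apply/matrixP => j k; rewrite !mxE; case: eqP => [->|_].
  rewrite /Y_diag !mk_phaseE big1 => [|r _]; last by rewrite d0 addr0.
  by rewrite big1 => [|r _]; rewrite ?d0 ?addr0 ?mulr0 ?addr0// mulr1n.
by rewrite /Y_offdiag big1 ?oppr0// => l _; rewrite d0 !mul0r.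
Qed.

Lemma is_derive_pow (W : normedModType C) (f : W -> C) t v df k :
  is_derive t v f df -> is_derive t v (fun s => f s ^+ k) (k%:R * f t ^+ k.-1 * df).
Proof.
move=> H; elim: k => [|k IH].
  by under eq_fun do rewrite expr0; rewrite !mul0r; exact: is_derive_cst.
under eq_fun do rewrite exprS; apply: (is_derive_eq (is_derive_mul H IH)).
case: k {IH} => [|k] /=; first by rewrite !expr0 !mul0r mulr0; ring.
by rewrite -[k.+2%:R]natr1 exprS; ring.
Qed.

Lemma diag_hamiltonian k z (y : 'I_n -> C) : (forall i, cmY z i = diag_mx (\row_j y j)) ->
  cm_hamiltonian k z
  = - \sum_i \sum_j cmw z i ord0 j * (y j ^+ k * cmv z (iter k (@ordS m) i) j ord0).
Proof.
move=> YE; rewrite /cm_hamiltonian; congr (- _); apply: eq_bigr => i _.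
have -> : \prod_(0 <= l < k) cmY z (iter l (@ordS m) i) = diag_mx (\row_j y j ^+ k).
  elim: k => [|k IH].
    rewrite big_geq//; apply/matrixP => a b; rewrite !mxE expr0; by case: eqP.
  rewrite big_nat_recr //= IH YE -mulmxE mulmx_diag; congr diag_mx.
  by apply/rowP => a; rewrite !mxE exprSr.
rewrite -mulmxA [LHS]mxE; apply: eq_bigr => j _; congr (_ * _).
by rewrite mul_diag_mx [LHS]mxE [X in X * _]mxE.
Qed.

(** Along the line [z + s eta] the matrices [Y_i] stay diagonal, so the formula of
    [diag_hamiltonian] is differentiated directly. *)
Lemma diag_dham k z eta (y d : 'I_n -> C) :
  (forall i, cmY z i = diag_mx (\row_j y j)) ->
  (forall i, cmY eta i = diag_mx (\row_j d j)) -> (forall i, cmw eta i = 0) ->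
  cm_dham k z eta = - \sum_i \sum_j cmw z i ord0 j *
    (k%:R * y j ^+ k.-1 * d j * cmv z (iter k (@ordS m) i) j ord0
     + y j ^+ k * cmv eta (iter k (@ordS m) i) j ord0).
Proof.
move=> zY eY ew; have L := is_derive_line z eta (0 : C).
have := is_derive_cm_hamiltonian k L; rewrite scale0r addr0 => H.
apply: (is_derive_unique H).
have YE (s : C) i : cmY (z + s *: eta) i = diag_mx (\row_j (y j + s * d j)).
  rewrite /cmY linearD linearD linearZ linearZ /= -/(cmY z i) -/(cmY eta i) zY eY.
  by apply/matrixP => a b; rewrite !mxE; case: eqP => _; rewrite ?mulr1n// mulr0n mulr0 addr0.
have wE (s : C) i : cmw (z + s *: eta) i = cmw z i.
  by rewrite /cmw linearD linearZ /= -/(cmw z i) -/(cmw eta i) ew scaler0 addr0.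
have vE (s : C) i j : cmv (z + s *: eta) i j ord0 = cmv z i j ord0 + s * cmv eta i j ord0.
  by rewrite /cmv !mxE.
have ll (a b : C) : is_derive (0 : C) (1 : C) (fun s : C => a + s * b) b.
  exact: (is_derive_line (V := C^o) a b 0).
under eq_fun do rewrite (diag_hamiltonian _ (YE _)).
apply: is_deriveN; apply: is_derive_bigsum => i _; apply: is_derive_bigsum => j _.
under eq_fun do rewrite wE vE.
apply: (is_derive_eq (is_derive_mul (is_derive_cst (cmw z i ord0 j) (0 : C^o) (1 : C))
  (is_derive_mul (is_derive_pow k (ll (y j) (d j))) (ll _ _)))).
by rewrite !mul0r !addr0 add0r.
Qed.

End ScalingLimit.

(** The points [d / 2 / (i + 1)] lie in [A], are nonzero and infinite in number, while [p] has only
    finitely many roots. *)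
Lemma nonroot_near (C : numFieldType) (p : {poly C}) (g : C -> C) (A : set C) :
  p != 0 -> injective g -> nbhs (0 : C) A ->
  exists s, [/\ A s, s != 0 & ~~ root p (g s)].
Proof.
move=> p0 gI /nbhs_ballP[d /= d0 dA].
pose s (i : nat) : C := d / 2 / i.+1%:R.
have s0 i : s i != 0 by rewrite !mulf_neq0 ?invr_neq0 ?pnatr_eq0 ?gt_eqF.
have sA i : A (s i).
  apply: dA; rewrite -ball_normE /= sub0r normrN.
  rewrite ger0_norm; last by rewrite !divr_ge0 ?ler0n ?ltW.
  rewrite ltr_pdivrMr ?ltr0n// ltr_pdivrMr ?ltr0n//.
  by rewrite -mulrA ltr_pMr// -natrM ltr1n mulSn.
have sI : injective s.
  by move=> i j; rewrite /s => /mulfI; rewrite mulf_neq0 ?invr_neq0 ?pnatr_eq0 ?gt_eqF// => /(_ isT) /invr_inj /eqP; rewrite eqr_nat => /eqP [].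
apply: contrapT => H; move/eqP: p0; apply.
apply: (@roots_geq_poly_eq0 _ p [seq g (s i) | i <- iota 0 (size p)]).
- apply/allP => u /mapP[i _ ->]; apply: contraT => nr; case: H; exists (s i); split=> //.
- by rewrite map_inj_uniq ?iota_uniq// => i j /gI /sI.
- by rewrite size_map size_iota.
Qed.

(** * The Jacobian for large [mu] *)

Section Independence.
Context {C : numClosedFieldType} {m n : nat}.
Local Notation N := (\sum_(i < m) n)%N.
Local Notation cmvec := (@cm_vector C m n).
Local Notation V := (@phase_vector C m n).
Implicit Types (lam : 'I_m -> C) (x h : V) (z eta : cmvec).

(** The Jacobian at [x + t * mu_dir y] with the powers of [t] removed, as a function of
    [e = 1/t]. *)
Definition jac_limit lam x (y : 'I_n -> C) (e : C) : 'M[C]_(m * n) :=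
  \matrix_k mxvec (\matrix_(b, j)
    block_dham k.+1
      (e *: blockY (cm_point lam x) + blockY (cm_point (fun=> 0) (polar x (mu_dir y))))
      (e *: blockY (cm_point (fun=> 0) (polar x (jac_dir x b j)))
       + blockY (cm_point (fun=> 0) (polar x (mu_dir (fun k => (k == j)%:R * (psi x b j * y j))))))
      (blockv (cm_point lam x))
      (blockv (cm_point (fun=> 0) (polar x (jac_dir x b j))))
      (blockw (cm_point lam x))).

(** Moving [mu] by [t y] turns [Y] into [t (Y / t + diag y)], and the variation of [Y] along
    [jac_dir] scales in the same way; [block_dham_scale] then extracts the powers of [t]. *)
Lemma jac_shift lam x y t : t != 0 ->
  jac lam (x + t *: mu_dir y)
  = diag_mx (\row_k t ^+ k.+1) *m jac_limit lam x y t^-1.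
Proof.
move=> t0; set xt := x + t *: mu_dir y.
have nuE j : nu xt j = nu x j by rewrite nuD nuZ nu_mk mulr0 addr0.
have muE j : mu xt j = mu x j + t * y j by rewrite muD muZ mu_mk.
have phiE j r : phi xt j r = phi x j r by rewrite phiD phiZ phi_mk mulr0 addr0.
have psiE r j : psi xt r j = psi x r j by rewrite psiD psiZ psi_mk mulr0 addr0.
have vE : blockv (cm_point lam xt) = blockv (cm_point lam x).
  by apply: eq_blockv => i; rewrite /cm_point !cmvK; apply/matrixP => j k; rewrite !mxE phiE.
have wE : blockw (cm_point lam xt) = blockw (cm_point lam x).
  by apply: eq_blockw => i; rewrite /cm_point !cmwK; apply/matrixP => j k; rewrite !mxE psiE.
have YE : blockY (cm_point lam xt) = t *: (t^-1 *: blockY (cm_point lam x)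
    + blockY (cm_point (fun=> 0) (polar x (mu_dir y)))).
  rewrite scalerDr scalerA divff// scale1r; apply: blockY_affine => i.
  by apply: Y_affine => *; rewrite mk_phaseE.
have dirE b j : polar xt (jac_dir xt b j) = polar x (jac_dir x b j)
    + t *: mu_dir (fun k => (k == j)%:R * (psi x b j * y j)).
  apply: phase_vectorP => [k|k|k r|r k];
    rewrite ?nuD ?nuZ ?muD ?muZ ?phiD ?phiZ ?psiD ?psiZ !mk_phaseE ?mulr0 ?addr0//.
  - by rewrite muE psiE; ring.
  - by congr (_ * (_ * _ - _ * _)) => //; apply: eq_bigr => q _; rewrite phiE psiE.
have TE b j : blockY (cm_point (fun=> 0) (polar xt (jac_dir xt b j)))
  = t *: (t^-1 *: blockY (cm_point (fun=> 0) (polar x (jac_dir x b j)))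
    + blockY (cm_point (fun=> 0) (polar x (mu_dir (fun k => (k == j)%:R * (psi x b j * y j)))))).
  rewrite dirE scalerDr scalerA divff// scale1r; apply: blockY_affine => i.
  rewrite Y_affine; [|by move=> *; rewrite mk_phaseE|by move=> *; rewrite mk_phaseE].
  by rewrite !Y_mu_dir.
have uE b j : blockv (cm_point (fun=> 0) (polar xt (jac_dir xt b j)))
  = blockv (cm_point (fun=> 0) (polar x (jac_dir x b j))).
  rewrite dirE; apply: eq_blockv => i; rewrite /cm_point !cmvK; apply/matrixP => k' l.
  by rewrite [LHS]mxE [RHS]mxE phiD phiZ [X in _ + _ * X]phi_mk mulr0 addr0.
apply/matrixP => k c; case/mxvec_indexP: c => b j.
rewrite mul_diag_mx [LHS]mxE [LHS]mxvecE [LHS]mxE [RHS]mxE [X in X * _]mxE.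
rewrite [X in _ * X]mxE [X in _ * X]mxvecE [X in _ * X]mxE.
by rewrite YE TE vE wE uE block_dham_scale.
Qed.

Lemma jac_limit_polyfun lam x y : polyfun (fun e => \det (jac_limit lam x y e)).
Proof.
apply: polyfun_det => k c; case/mxvec_indexP: c => b j.
by apply: (polyfun_ext _ (block_dham_polyfun k.+1 _ _ _ _ _ _ _)) => e; rewrite mxE mxvecE mxE.
Qed.

Lemma iter_ord_predK k (i : 'I_m) : iter k (@ordS m) (iter k (@ord_pred m) i) = i.
Proof. by elim: k i => // k IH i; rewrite iterS [iter k.+1 _ i]iterSr IH ord_predK. Qed.

Lemma iter_ordSK k (i : 'I_m) : iter k (@ord_pred m) (iter k (@ordS m) i) = i.
Proof. by elim: k i => // k IH i; rewrite iterS [iter k.+1 _ i]iterSr IH ordSK. Qed.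

(** The cyclic cross-correlation of [psi_j] and [phi_j]. At shift 0 it is the moment, equal to minus
    the total weight on the level ([correlation0]). *)
Definition correlation x (j : 'I_n) (k : nat) : C :=
  \sum_i psi x i j * phi x j (iter k (@ordS m) i).

Lemma jac_limit0 lam x y k b j : jac_limit lam x y 0 k (mxvec_index b j)
  = - (y j ^+ k.+1 * (k%:R * psi x b j * correlation x j k.+1
      + correlation x j 0 * psi x (iter k.+1 (@ord_pred m) b) j)).
Proof.
rewrite [LHS]mxE [LHS]mxvecE [LHS]mxE !scale0r !add0r.
(* Representations with the same blocks as the limit data, so that [diag_dham] evaluates the
   entry. *)
pose z0 : cmvec := mk_cm (fun=> 0) (fun=> diag_mx (\row_j y j)) (cmv (cm_point lam x))
  (cmw (cm_point lam x)).
pose d k := (k == j)%:R * (psi x b j * y j).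
pose eta0 : cmvec := mk_cm (fun=> 0) (fun=> diag_mx (\row_j d j))
  (cmv (cm_point (fun=> 0) (polar x (jac_dir x b j)))) (fun=> 0).
rewrite (@eq_blockY _ _ _ _ z0) => [|i]; last by rewrite Y_mu_dir cmYK.
rewrite (@eq_blockY _ _ _ (cm_point (fun=> 0) (polar x (mu_dir d))) eta0) => [|i]; last by rewrite Y_mu_dir cmYK.
rewrite (@eq_blockv _ _ _ (cm_point lam x) z0) => [|i]; last exact: (congr1 (@^~ i) (esym (cmvK _ _ _ _))).
rewrite (@eq_blockv _ _ _ (cm_point (fun=> 0) (polar x (jac_dir x b j))) eta0) => [|i]; last exact: (congr1 (@^~ i) (esym (cmvK _ _ _ _))).
rewrite (@eq_blockw _ _ _ (cm_point lam x) z0) => [|i]; last exact: (congr1 (@^~ i) (esym (cmwK _ _ _ _))).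
rewrite -cm_dhamE => [|i]; last by rewrite cmwK.
rewrite (@diag_dham _ _ _ k.+1 z0 eta0 y d) => [|i|i|i]; [|by rewrite cmYK|by rewrite cmYK|by rewrite cmwK].
congr (- _).
have vE i l : cmv z0 i l ord0 = phi x l i by rewrite cmvK /cm_point cmvK mxE.
have wE i l : cmw z0 i ord0 l = psi x i l by rewrite cmwK /cm_point cmwK mxE.
have uE i l : cmv eta0 i l ord0 = (l == j)%:R * (correlation x j 0 * (i == b)%:R
    - psi x b j * phi x j i).
  rewrite cmvK /cm_point cmvK mxE !mk_phaseE; congr (_ * (_ * _ - _)).
  by apply: eq_bigr => q _; rewrite mulrC.
transitivity (\sum_i psi x i j * (y j ^+ k.+1 * (k%:R * psi x b j * phi x j (iter k.+1 (@ordS m) i)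
    + correlation x j 0 * (iter k.+1 (@ordS m) i == b)%:R))).
  apply: eq_bigr => i _; rewrite (bigD1 j) //= [X in _ + X]big1 ?addr0 => [|l /negbTE lj].
    rewrite wE -!iterS vE uE /d eqxx -natr1 exprS !mul1r. ring.
  by rewrite -!iterS uE /d lj !(mul0r, mulr0) addr0 mulr0.
transitivity (\sum_i (y j ^+ k.+1 * (k%:R * psi x b j) * (psi x i j * phi x j (iter k.+1 (@ordS m) i))
  + y j ^+ k.+1 * correlation x j 0 * (psi x i j * (iter k.+1 (@ordS m) i == b)%:R))).
  by apply: eq_bigr => i _; ring.
rewrite big_split /= -!mulr_sumr -/(correlation x j k.+1).
have -> : \sum_i psi x i j * (iter k.+1 (@ordS m) i == b)%:R
    = psi x (iter k.+1 (@ord_pred m) b) j.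
  rewrite (bigD1 (iter k.+1 (@ord_pred m) b)) //= big1 => [|i ib].
    by rewrite -!iterS iter_ord_predK eqxx mulr1 addr0.
  case: eqP => [E|]; last by rewrite mulr0.
  by case/eqP: ib; rewrite -!iterS -E -iterS iter_ordSK.
by rewrite -!iterS; ring.
Qed.

Lemma jac_limit_unit (zeta : C) lam x y (i0 : 'I_m) : m.-primitive_root zeta -> val i0 = 0%N ->
  (forall j, y j != 0) -> (forall j k, j != k -> y j ^+ m - y k ^+ m != 0) ->
  (forall j, correlation x j 0 != 0) ->
  (forall j, circulant (fun r => psi x r j) \in unitmx) ->
  jac_limit lam x y 0 \in unitmx.
Proof.
move=> hz i00 y0 yD N0 cU; rewrite -row_free_unit; apply: inj_row_free => u uJ.
suff H k : u ord0 k = 0 by apply/rowP => k; rewrite H mxE.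
move: k; apply: (limit_jacobian_inj (psi := fun j r => psi x r j) (N := correlation x)
  hz y0 yD i00) => // [j l|b j].
- apply: eq_bigr => i _; congr (_ * phi x j _); apply: val_inj; rewrite /= !iter_ordSE.
  by rewrite modnDmr.
- have /rowP/(_ (mxvec_index b j)) := uJ; rewrite [LHS]mxE [RHS]mxE => /eqP.
  under eq_bigr do rewrite jac_limit0 mulrN.
  by rewrite sumrN oppr_eq0 => /eqP.
Qed.

End Independence.

(** * From a dense open set of the level to its quotient *)

Section IndependenceOnOrbits.
Context {C : numClosedFieldType} {V V' : normedModType C} {L : set V} {e : equiv_rel L}.
Hypothesis orbits : forall x y : L, e x y -> exists g : V -> V,
  [/\ {for val x, continuous g}, val y = g (val x) &
      forall z : L, exists2 w : L, val w = g (val z) & e z w].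

Lemma independent_on_orbits (mom : V -> V') d (f : 'I_d -> orbit_space e -> C) (W : set L) :
  open W -> (forall (x : L) (A : set V), nbhs (val x) A -> exists y : L, A (val y) /\ W y) ->
  (forall x y, e x y -> W y -> independent_at mom f x) ->
  functionally_independent mom f.
Proof.
move=> oW dW iW; exists ((\pi_(orbit_space e) : L -> _) @` W); split.
- exact: (orbit_map_open orbits).
- move=> U [q Uq] oU; have xq : \pi_(orbit_space e) (repr q) = q by exact: reprK.
  have : nbhs (repr q) ((\pi_(orbit_space e) : L -> _) @^-1` U).
    by apply: open_nbhs_nbhs; split; [exact: oU|rewrite /= xq].
  move=> /level_nbhsP[A xA AU]; have [y [Ay yW]] := dW _ _ xA.
  by exists (\pi_(orbit_space e) y); split; [exact: AU|exists y].
- move=> x [y Wy yx]; apply: (iW x y) => //.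
  by apply/(eqmodP e); rewrite yx.
Qed.

End IndependenceOnOrbits.

(** * Points with invertible Jacobian are dense *)

Section FunctionalIndependence.
Context {C : numClosedFieldType} (E : exponential C) {m n : nat}.
Local Notation V := (@phase_vector C m n).
Variable lam : 'I_m -> C.
Local Notation L := (@phase_level C m n lam).
Implicit Types x y : L.
Hypothesis m0 : (0 < m)%N.
Hypothesis lam0 : \sum_r lam r != 0.

Lemma correlation0 x j : correlation (val x) j 0 = - \sum_r lam r.
Proof.
have [_ /rowP/(_ j)] := set_mem (valP x); rewrite !mxE => <-.
by apply: eq_bigr => i _; rewrite mulrC.
Qed.

(** Adding [s] to the entry of index 0 of [psi_j] adds [s] times the identity to its circulant,
    which is then singular only when [- s] is an eigenvalue of the original one. *)
Lemma circulant_generic x (W : set V) : nbhs (val x) W ->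
  exists y, W (val y) /\ forall j, circulant (fun r => psi (val y) r j) \in unitmx.
Proof.
move=> xW; pose i0 : 'I_m := Ordinal m0; set c := - \sum_r lam r.
have c0 : c != 0 by rewrite oppr_eq0.
have [xreg /rowP xmom] := set_mem (valP x).
have momE j : \sum_q phi (val x) j q * psi (val x) q j = c by have := xmom j; rewrite !mxE.
(* The pairing of [phi_j] with the perturbed [psi_j]; multiplying [phi_j] by [c / D j s] restores
   the moment. *)
pose D j (s : C) := c + s * phi (val x) j i0.
pose y (s : C) : V := mk_phase (nu (val x)) (mu (val x))
  (fun j r => c / D j s * phi (val x) j r) (fun r j => psi (val x) r j + s * (r == i0)%:R).
have dl (a b : C) : differentiable (fun s : C => a + s * b) (0 : C).
  apply: differentiableD; first exact: differentiable_cst.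
  by apply: differentiableM => //; exact: differentiable_cst.
have D0 j : D j 0 = c by rewrite /D mul0r addr0.
have dy : differentiable y 0.
  apply: differentiable_phase => [j|j|j r|r j]; under eq_fun do rewrite !mk_phaseE.
  - exact: differentiable_cst.
  - exact: differentiable_cst.
  - apply: differentiableM; last exact: differentiable_cst.
    apply: differentiableM; first exact: differentiable_cst.
    by apply: differentiableV; [exact: dl|rewrite [X in X != 0]D0].
  - exact: dl.
have y0 : y 0 = val x.
  apply: phase_vectorP => [j|j|j r|r j]; rewrite !mk_phaseE//.
  - by rewrite D0 divff// mul1r.
  - by rewrite mul0r addr0.
have yW : \forall s \near (0 : C), W (y s).
  by apply: (differentiable_continuous dy); rewrite y0.
have Dn : \forall s \near (0 : C), forall j, D j s != 0.
  apply: (@filter_forall _ _ (fun j (s : C) => D j s != 0) (nbhs (0 : C)) _) => j.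
  by apply: (near_neq0 (f := D j)); [exact: dl|rewrite D0].
pose p := \prod_j char_poly (circulant (fun r => psi (val x) r j)).
have p0 : p != 0.
  by rewrite monic_neq0// monic_prod// => j _; exact: char_poly_monic.
have nI : injective (fun s : C => - s) by exact: oppr_inj.
have [s [[Ws Ds] s0 ps]] := nonroot_near p0 nI (filterI yW Dn).
have yL : phase_level lam (y s).
  split; first by apply/hregP; move/hregP: xreg => [nu0 nuD]; split=> [j|j k]; rewrite !nu_mk; [exact: nu0|exact: nuD].
  apply/rowP => j; rewrite !mxE -/c.
  under eq_bigr do rewrite !mk_phaseE mulrDr -!mulrA.
  rewrite big_split /= -!mulr_sumr momE.
  rewrite [X in _ + X](_ : _ = c / D j s * (s * phi (val x) j i0)).
    by rewrite mulrA -!mulrDr -/(D j s) divfK.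
  have -> : \sum_i phi (sval x) j i * (s * (i == i0)%:R) = phi (val x) j i0 * s.
    rewrite (bigD1 i0) //= mulr1 big1 ?addr0// => r ri.
    by rewrite (negbTE ri) !mulr0.
  by ring.
exists (level_point yL); split=> // j /=.
have -> : circulant (fun r => psi (y s) r j)
    = circulant (fun r => psi (val x) r j) - (- s)%:M.
  apply/matrixP => c' b; rewrite !mxE psi_mk mulNrn opprK mulr_natr; congr (_ + _ *+ _).
  congr (nat_of_bool _); apply/eqP/eqP => [H|->].
    rewrite -[b](iter_ord_predK c') H; apply: val_inj.
    by rewrite /= iter_ordSE add0n modn_small.
  have <- : iter b (@ordS m) i0 = b by apply: val_inj; rewrite /= iter_ordSE add0n modn_small.
  by rewrite {1}iter_ordSE add0n modn_small// iter_ordSK.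
have : ~~ root (char_poly (circulant (fun r => psi (val x) r j))) (- s).
  apply: contra ps => rj; rewrite /p (bigD1 j) //= rootM.
  by rewrite rj.
rewrite -eigenvalue_root_char /eigenvalue negbK /eigenspace kermx_eq0 row_free_unit.
by [].
Qed.

(** Once the circulants are invertible, the polynomial in [1/t] is nonzero at 0, that is at infinite
    [t]. Having finitely many roots, it is also nonzero for suitable arbitrarily small [t]. *)
Lemma jac_generic (zeta : C) x (W : set V) : m.-primitive_root zeta -> nbhs (val x) W ->
  exists y, W (val y) /\ jac lam (val y) \in unitmx.
Proof.
move=> hz; rewrite nbhsE => -[B [oB Bx] BW].
have [x' [Bx' cU]] := circulant_generic (open_nbhs_nbhs (conj oB Bx)).
(* Positive integers are nonzero and have distinct powers. *)
pose i0 : 'I_m := Ordinal m0; pose y (j : 'I_n) : C := j.+1%:R.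
have y0 j : y j != 0 by rewrite pnatr_eq0.
have yD j k : j != k -> y j ^+ m - y k ^+ m != 0.
  apply: contra; rewrite subr_eq0 -!natrX eqr_nat eqn_exp2r//.
have N0 j : correlation (val x') j 0 != 0 by rewrite correlation0 oppr_eq0.
have GU := jac_limit_unit lam (i0 := i0) hz erefl y0 yD N0 cU.
have [p pE] := jac_limit_polyfun lam (val x') y.
have p0 : p != 0.
  apply/eqP => p0; move: GU; rewrite unitmxE pE p0 horner0.
  by rewrite unitr0.
have tB : \forall t \near (0 : C), B (val x' + t *: mu_dir y).
  have [+ _] := is_derive_line (val x') (mu_dir y) (0 : C).
  move=> /derivable1_diffP/differentiable_continuous; apply.
  by rewrite scale0r addr0; apply: open_nbhs_nbhs.
have [t [Bt t0 pt]] := nonroot_near p0 (@invr_inj C) tB.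
have [xreg xmom] := set_mem (valP x').
have yL : phase_level lam (val x' + t *: mu_dir y).
  split.
    apply/hregP; move/hregP: xreg => [nu0 nuN].
    by split=> [j|j k]; rewrite !nuD !nuZ !nu_mk !mulr0 !addr0; [exact: nu0|exact: nuN].
  rewrite -xmom; apply/rowP => j; rewrite !mxE; apply: eq_bigr => r _.
  by rewrite phiD phiZ psiD psiZ !mk_phaseE !mulr0 !addr0.
exists (level_point yL); split; first exact: BW.
rewrite /= jac_shift// unitmx_mul; apply/andP; split.
  rewrite unitmxE det_diag unitfE; apply/prodf_neq0 => k _.
  by rewrite mxE expf_neq0.
by rewrite unitmxE unitfE pE.
Qed.

Lemma hamiltonians_independent (zeta : C) : m.-primitive_root zeta ->
  functionally_independent (@phase_moment C m n)
    (fun k : 'I_(m * n) => @hamiltonian C m n lam k.+1).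
Proof.
move=> hz; pose W : set L := [set x | jac lam (val x) \in unitmx].
have oW : open W.
  rewrite openE => x Wx; apply/level_nbhsP.
  have [xreg _] := set_mem (valP x).
  exists [set y : V | \det (jac lam y) != 0]; last by move=> y /=; rewrite /W /= unitmxE unitfE.
  apply: (near_neq0 (f := fun y : V => \det (jac lam y))); first by apply: differentiable_det; exact: jac_differentiable.
  by move: Wx; rewrite /W /= unitmxE unitfE.
have H := @independent_on_orbits C _ _ (@phase_level C m n lam) (same_phase_equiv lam)
  (@phase_orbits C m n lam) (@phase_moment C m n) (m * n)%N
  (fun k : 'I_(m * n) => @hamiltonian C m n lam k.+1) W oW.
apply: H.
- by move=> x A xA; exact: (jac_generic hz xA).
- move=> x y exy Wy; apply: dham_independent_at.
  exact: (dham_independent_rescale exy (jac_independent m0 Wy)).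
Qed.

End FunctionalIndependence.

(** * Gauge invariants along solution curves *)

Section InvariantsAlongFlow.
Context {C : numClosedFieldType} (E : exponential C) {m n : nat}.
Local Notation cmvec := (@cm_vector C m n).
Local Notation V := (@phase_vector C m n).
Variable lam : 'I_m -> C.
Implicit Types (z eta : cmvec).
Hypothesis m0 : (0 < m)%N.
Hypothesis lam0 : \sum_r lam r != 0.
Local Notation Psi := (cm_point lam : V -> cmvec).

Definition gauge_invariant (F : cmvec -> C) :=
  forall h z, (forall i, h i \in unitmx) -> F (gauge h z) = F z.

Lemma diff_gauge_dir F g z : gauge_invariant F -> differentiable F z ->
  'd F z (gauge_dir g z) = 0.
Proof.
move=> Finv dF; have c0 : gauge (fun i => exp_of E (0 *: g i)) z = z.
  rewrite -[RHS]gauge1; congr gauge; apply/funext => i.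
  by rewrite scale0r exp_zero.
have dF' : differentiable F (gauge (fun i => exp_of E (0 *: g i)) z) by rewrite c0.
have := is_derive_curve dF' (gauge_curve E g z); rewrite c0 => H.
apply: (is_derive_unique H); apply: (is_derive_ext (is_derive_cst (F z) (0 : C^o) (1 : C))) => //.
by move=> s; rewrite /= Finv// => i; exact: exp_unitmx.
Qed.

Lemma diff_flow0 k z eta (a : C) :
  'd (fun p : C * cmvec => flow E k p.1 p.2) (0, z) (a, eta) = a *: ham_field k z + eta.
Proof.
set Phi := fun p : C * cmvec => flow E k p.1 p.2.
have dPhi p : differentiable Phi p by exact: flow_differentiable.
have dD u v : 'd Phi (0, z) (u + v) = 'd Phi (0, z) u + 'd Phi (0, z) v by exact: linearD.
have dZ c u : 'd Phi (0, z) (c *: u) = c *: 'd Phi (0, z) u by exact: linearZ.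
have -> : (a, eta) = a *: (1, 0) + (0, eta) :> C * cmvec.
  rewrite -[RHS]/(a * 1 + 0, a *: (0 : cmvec) + eta).
  by congr (_, _); [rewrite mulr1 addr0|rewrite scaler0 add0r].
rewrite dD dZ; congr (_ *: _ + _).
- have I1 : is_derive (0 : C) (1 : C) (fun s : C => (s, z) : C * cmvec) (1, 0).
    exact: is_derive_pair.
  have := is_derive_curve (dPhi (0, z)) I1 => H; apply: (is_derive_unique H).
  exact: flow_derive0.
- have I2 : is_derive (0 : C) (1 : C) (fun s : C => (0, z + s *: eta) : C * cmvec) (0, eta).
    apply: is_derive_pair; exact: is_derive_line.
  have dP0 : differentiable Phi ((fun s : C => (0, z + s *: eta) : C * cmvec) 0) by [].
  have := is_derive_curve dP0 I2; rewrite /= scale0r addr0 => H.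
  apply: (is_derive_unique H); apply: (is_derive_ext (is_derive_line z eta 0)) => // s.
  by rewrite /Phi /= flow0.
Qed.

(** The curve and [flow] move with velocities that differ by a gauge direction, which an invariant
    function does not see. So flowing the curve backwards leaves the value of [F] constant. *)
Lemma invariant_along_flow k F (D : set C) (g : C -> @phase_level C m n lam) :
  gauge_invariant F -> (forall z, differentiable F z) ->
  open D -> connected D -> D 0 ->
  integral_curve (@phase_moment C m n) (@phase_form C m n) (@hamiltonian C m n lam k) D g ->
  forall t, D t -> F (flow E k (- t) (Psi (val (g t)))) = F (Psi (val (g 0))).
Proof.
move=> Finv dF oD cD D0 gH t Dt.
have <- : F (flow E k (- 0) (Psi (val (g 0)))) = F (Psi (val (g 0))).
  by rewrite oppr0 flow0.
apply: (constant_on_connected E (f := fun t => F (flow E k (- t) (Psi (val (g t))))) oD cD D0) => //.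
move=> {Dt}t Dt; have [xi hxi dg] := gH t Dt.
have [xreg _] := set_mem (valP (g t)).
have [y yE] := hamiltonian_vectorP E m0 lam0 hxi.
have dz : is_derive t (1 : C) (Psi \o (fun s => val (g s))) ('d Psi (val (g t)) xi).
  by apply: is_derive_curve => //; exact: cm_point_differentiable.
set z := Psi (val (g t)) in yE *.
pose Phi := fun p : C * cmvec => flow E k p.1 p.2.
have dPhi p : differentiable Phi p by exact: flow_differentiable.
have dc : is_derive t (1 : C) (fun s => (t - s, Psi (val (g s))) : C * cmvec)
    (-1, 'd Psi (val (g t)) xi).
  apply: is_derive_pair => //.
  have := is_deriveB (is_derive_cst t (t : C^o) (1 : C)) (is_derive_id (t : C^o) (1 : C)).
  by rewrite sub0r.
pose G (w : cmvec) := F (flow E k (- t) w).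
have dflow (w : cmvec) : differentiable (fun w : cmvec => flow E k (- t) w) w.
  have dp : differentiable (fun w : cmvec => (- t, w) : C * cmvec) w.
    by apply: differentiable_pair; [exact: differentiable_cst|exact: ex_diff].
  exact: (differentiable_comp dp (dPhi _)).
have dG (w : cmvec) : differentiable G w by exact: (differentiable_comp (dflow w) (dF _)).
have Ginv : gauge_invariant G by move=> h w uh; rewrite /G /= flow_gauge// Finv.
have c0 : Phi (t - t, z) = z by rewrite /Phi subrr flow0.
have H1 := is_derive_curve (dPhi (t - t, z)) dc.
have dG' : differentiable G ((Phi \o (fun s => (t - s, Psi (val (g s))) : C * cmvec)) t).
  exact: dG.
have H2 := is_derive_curve dG' H1.
apply: (is_derive_ext H2) => [s|].
  by rewrite /G /Phi /comp -flowD addrAC subrr add0r.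
rewrite [X in 'd G X _]c0 subrr diff_flow0 scaleN1r yE opprD addrAC addNr add0r.
have dN u : 'd G z (- u) = - 'd G z u by exact: linearN.
by rewrite dN diff_gauge_dir// oppr0.
Qed.

End InvariantsAlongFlow.

(** The relations extend linearly to all polynomials in place of powers; the product of the
    [X - p k] over [k] other than [j] isolates [c j]. *)
Lemma power_sums_inj (F : fieldType) n (p c : 'I_n -> F) :
  (forall j k, j != k -> p j != p k) ->
  (forall r, \sum_j p j ^+ r * c j = 0) -> forall j, c j = 0.
Proof.
move=> pD H j; pose q := \prod_(k | k != j) ('X - (p k)%:P).
have qs : \sum_k q.[p k] * c k = 0.
  under eq_bigr do rewrite horner_coef mulr_suml.
  rewrite exchange_big big1// => r _.
  under eq_bigr do rewrite -mulrA.
  by rewrite -mulr_sumr H mulr0.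
have q0 : q.[p j] != 0.
  rewrite horner_prod; apply/prodf_neq0 => k kj.
  by rewrite hornerXsubC subr_eq0 pD// eq_sym.
move: qs; rewrite (bigD1 j) //= big1 ?addr0 => [/eqP|k kj].
  by rewrite mulf_eq0 (negbTE q0) => /eqP.
by rewrite horner_prod (bigD1 k) //= hornerXsubC subrr !mul0r.
Qed.

(* Two families of rank-one tensors with equal nonzero traces that agree
   differ by a scalar. *)
Lemma rank_one_eq (F : fieldType) (I : finType) (a a' b b' : I -> F) :
  (forall i k, a' i * b' k = a i * b k) -> \sum_i a i * b i != 0 ->
  exists2 d, d != 0 & (forall i, b' i = d * b i) /\ (forall i, a' i = d^-1 * a i).
Proof.
move=> H N0; set N := \sum_i _ in N0; pose d := (\sum_i a i * b' i) / N.
have bE i : b' i = d * b i.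
  rewrite /d mulrAC; apply: (mulIf N0); rewrite divfK// mulr_suml mulr_sumr.
  apply: eq_bigr => k _; rewrite -H; transitivity (a' k * b' i * b' k); first ring.
  by rewrite H; ring.
have d0 : d != 0.
  apply: contra_neq N0 => d0; rewrite /N big1// => i _.
  by rewrite -H bE d0 mul0r mulr0.
exists d => //; split=> // i; apply: (mulfI d0); rewrite mulrA divff// mul1r.
apply: (mulIf N0); rewrite !mulr_sumr; apply: eq_bigr => k _.
have := H i k; rewrite bE => HE.
transitivity ((a' i * (d * b k)) * a k); first by ring.
by rewrite HE; ring.
Qed.

(** * Gauge invariants built from products of the [X_i] *)

Section Separation.
Context {C : numClosedFieldType} (E : exponential C) {m n : nat}.
Local Notation cmvec := (@cm_vector C m n).
Local Notation V := (@phase_vector C m n).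
Implicit Types (z : cmvec) (lam : 'I_m -> C).

(* [X_(i+k-1) ... X_(i+1) X_i] *)
Fixpoint chain z (i : 'I_m) (k : nat) : 'M[C]_n :=
  if k is k'.+1 then cmX z (iter k' (@ordS m) i) *m chain z i k' else 1%:M.

Lemma chain_gauge h z i k : (forall i, h i \in unitmx) ->
  chain (gauge h z) i k = h (iter k (@ordS m) i) *m chain z i k *m invmx (h i).
Proof.
move=> uh; elim: k => [|k IH] /=; first by rewrite mulmx1 mulmxV.
by rewrite IH {1}/gauge cmXK !mulmxA mulmxKV.
Qed.

Lemma chain_diag (d : 'I_n -> C) z i k : (forall i, cmX z i = diag_mx (\row_j d j)) ->
  chain z i k = diag_mx (\row_j d j ^+ k).
Proof.
move=> zX; elim: k => [|k IH] /=.
  by apply/matrixP => a b; rewrite !mxE expr0.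
rewrite IH zX mulmx_diag; congr diag_mx; apply/rowP => a.
by rewrite !mxE exprS.
Qed.

Lemma chainD z i k l : chain z i (k + l) = chain z (iter l (@ordS m) i) k *m chain z i l.
Proof.
elim: k => [|k IH]; first by rewrite mul1mx.
by rewrite addSn /= IH -iterD mulmxA.
Qed.

Lemma chain_differentiable i k z : differentiable (fun z : cmvec => chain z i k) z.
Proof.
elim: k => [|k IH] /=; first exact: differentiable_cst.
by apply: differentiable_mulmx => //; exact: cmX_differentiable.
Qed.

Lemma chain_charpoly_invariant i c : gauge_invariant (fun z : cmvec => \det (c%:M - chain z i m)).
Proof.
move=> h z uh; rewrite chain_gauge//.
have -> : iter m (@ordS m) i = i by rewrite -[in LHS](iter_ord_pred_m i) iter_ord_predK.
have -> : c%:M - h i *m chain z i m *m invmx (h i)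
  = h i *m (c%:M - chain z i m) *m invmx (h i).
  by rewrite mulmxBr mulmxBl mul_mx_scalar -scalemxAl mulmxV// scalemx1.
by rewrite !det_mulmx mulrAC -det_mulmx mulmxV// det1 mul1r.
Qed.

Lemma chain_wv_invariant i k : gauge_invariant (fun z : cmvec =>
  (cmw z (iter k (@ordS m) i) *m chain z i k *m cmv z i) ord0 ord0).
Proof.
move=> h z uh; rewrite chain_gauge// /gauge cmwK cmvK !mulmxA.
by rewrite !mulmxKV.
Qed.

Lemma chain_trY_invariant i r : gauge_invariant (fun z : cmvec =>
  \tr (cmY z i *m chain z i (r * m).+1)).
Proof.
move=> h z uh; rewrite chain_gauge// /gauge cmYK.
have -> : iter (r * m).+1 (@ordS m) i = ordS i.
  by apply: val_inj; rewrite [LHS]iter_ordSE addnS addnC -addnS modnMDl.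
rewrite !mulmxA mulmxKV// mxtrace_mulC !mulmxA mulVmx// mul1mx.
by [].
Qed.

Lemma invariants_differentiable i k c z :
  [/\ differentiable (fun z : cmvec => \det (c%:M - chain z i m)) z,
      differentiable (fun z : cmvec =>
        (cmw z (iter k (@ordS m) i) *m chain z i k *m cmv z i) ord0 ord0) z &
      differentiable (fun z : cmvec => \tr (cmY z i *m chain z i (k * m).+1)) z].
Proof.
have dC l := chain_differentiable i l z.
split.
- apply: differentiable_det; apply: differentiableB; first exact: differentiable_cst.
  exact: dC.
- apply: differentiable_entry; apply: differentiable_mulmx; last exact: cmv_differentiable.
  by apply: differentiable_mulmx; [exact: cmw_differentiable|exact: dC].
- apply: differentiable_bigsum => j _; apply: differentiable_entry.
  by apply: differentiable_mulmx; [exact: cmY_differentiable|exact: (dC (k * m).+1)].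
Qed.

(** The form in which [invariant_along_flow] delivers its information. Three families of invariants
    are extracted from it below: characteristic polynomials of full turns, the scalars [w X...X v],
    and the traces of [Y X...X]. *)
Definition same_invariants z z' := forall F : cmvec -> C, gauge_invariant F ->
  (forall w, differentiable F w) -> F z = F z'.

Lemma same_invariants_gauge h z z' : (forall i, h i \in unitmx) ->
  same_invariants z z' -> same_invariants (gauge h z) z'.
Proof. by move=> uh H F Finv dF; rewrite Finv//; exact: H. Qed.

Lemma same_chain_charpoly z z' : same_invariants z z' ->
  forall i c, \det (c%:M - chain z i m) = \det (c%:M - chain z' i m).
Proof.
move=> H i c; apply: (H _ (chain_charpoly_invariant i c)) => w.
by have [] := invariants_differentiable i 0 c w.
Qed.

Lemma same_chain_wv z z' : same_invariants z z' -> forall i k,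
  (cmw z (iter k (@ordS m) i) *m chain z i k *m cmv z i) ord0 ord0
  = (cmw z' (iter k (@ordS m) i) *m chain z' i k *m cmv z' i) ord0 ord0.
Proof.
move=> H i k; apply: (H _ (chain_wv_invariant i k)) => w.
by have [] := invariants_differentiable i k 0 w.
Qed.

Lemma same_chain_trY z z' : same_invariants z z' -> forall i r,
  \tr (cmY z i *m chain z i (r * m).+1) = \tr (cmY z' i *m chain z' i (r * m).+1).
Proof.
move=> H i k; apply: (H _ (chain_trY_invariant i k)) => w.
by have [] := invariants_differentiable i k 0 w.
Qed.

End Separation.

(** * The invariants determine the gauge class of a regular point *)

Section Slice.
Context {C : numClosedFieldType} (E : exponential C) {m n : nat}.
Local Notation cmvec := (@cm_vector C m n).
Local Notation V := (@phase_vector C m n).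
Implicit Types (z y : cmvec) (lam : 'I_m -> C).
Hypothesis m0 : (0 < m)%N.

(** A full turn [P] has the distinct nonzero eigenvalues [d_j^m]; its left eigenvectors form an
    invertible [S]. The gauge at vertex [k] must then be [D^k S] times the inverse of the product of
    the first [k] maps. *)
Lemma diagonalizing_gauge z (d : 'I_n -> C) (i0 : 'I_m) : val i0 = 0%N ->
  (forall j, d j != 0) -> (forall j k, j != k -> d j ^+ m - d k ^+ m != 0) ->
  (forall c, \det (c%:M - chain z i0 m) = \det (c%:M - diag_mx (\row_j d j ^+ m))) ->
  exists2 h : 'I_m -> 'M[C]_n, forall i, h i \in unitmx &
    forall i, cmX (gauge h z) i = diag_mx (\row_j d j).
Proof.
move=> i00 d0 dD chP; set P := chain z i0 m.
have ev j : exists v : 'rV[C]_n, v != 0 /\ v *m P = d j ^+ m *: v.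
  have : \det ((d j ^+ m)%:M - P) == 0.
    rewrite chP (_ : _ - _ = diag_mx (\row_k (d j ^+ m - d k ^+ m))).
      by rewrite det_diag (bigD1 j) //= mxE subrr mul0r.
    by apply/matrixP => a b; rewrite !mxE; case: eqP => _; rewrite ?mulr1n// !mulr0n subrr.
  move=> /det0P[v v0 /eqP]; rewrite mulmxBr mul_mx_scalar subr_eq0 => /eqP vE.
  by exists v.
have [v vP] := choice ev; pose S : 'M[C]_n := \matrix_j v j.
pose D k : 'M[C]_n := diag_mx (\row_j d j ^+ k).
have DM k l : D k *m D l = D (k + l)%N.
  by rewrite mulmx_diag; congr diag_mx; apply/rowP => a; rewrite !mxE exprD.
have DU k : D k \in unitmx.
  by rewrite unitmxE det_diag unitfE; apply/prodf_neq0 => j _; rewrite mxE expf_neq0.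
have SP : S *m P = D m *m S.
  apply/row_matrixP => j; rewrite !row_mul rowK (vP j).2 row_diag_mx -scalemxAl -rowE rowK.
  by rewrite mxE.
have SPr r : S *m P ^+ r = D (m * r)%N *m S.
  elim: r => [|r IH].
    rewrite muln0 expr0 -idmxE mulmx1 (_ : D 0%N = 1%:M) ?mul1mx//.
    by apply/matrixP => a b; rewrite !mxE expr0.
  by rewrite exprSr -mulmxE mulmxA IH -mulmxA SP mulmxA DM mulnS addnC.
have SU : S \in unitmx.
  rewrite -row_free_unit; apply: inj_row_free => u uS.
  have uv l j : u ord0 j * v j ord0 l = 0.
    (* Eigenvectors for distinct eigenvalues are independent: applying powers of [P] to a relation
       gives vanishing power sums. *)
    apply: (power_sums_inj (p := fun j => d j ^+ m) (c := fun j => u ord0 j * v j ord0 l)).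
      by move=> a b ab; rewrite -subr_eq0 dD.
    move=> r; have : (u *m S *m P ^+ r) ord0 l = 0 by rewrite uS mul0mx mxE.
    rewrite -mulmxA SPr [LHS]mxE => us; rewrite -[RHS]us; apply: eq_bigr => a _.
    by rewrite mul_diag_mx !mxE -exprM; ring.
  apply/rowP => j; rewrite [RHS]mxE; apply/eqP; have [v0 _] := vP j.
  apply: contraNT v0 => uj; apply/eqP/rowP => l; rewrite [RHS]mxE.
  by apply: (mulfI uj); rewrite uv mulr0.
have PU : P \in unitmx.
  have -> : P = invmx S *m (D m *m S) by rewrite -SP mulKmx.
  by rewrite !unitmx_mul unitmx_inv SU DU.
have cU k : (k <= m)%N -> chain z i0 k \in unitmx.
  move=> km; move: PU; rewrite /P.
  have -> : chain z i0 m = chain z i0 (m - k + k) by rewrite subnK.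
  by rewrite chainD unitmx_mul => /andP[].
pose H k : 'M[C]_n := D k *m S *m invmx (chain z i0 k).
have HU k : (k <= m)%N -> H k \in unitmx.
  by move=> km; rewrite !unitmx_mul unitmx_inv cU// SU DU.
(* The prescription closes up after one turn: [H m] is [S P P^(-1) = S], which is [H 0]. *)
have HS (i : 'I_m) : H (val (ordS i)) = H i.+1.
  have [im|] := ltnP i.+1 m; first by rewrite /= modn_small.
  move=> mi; have im : i.+1 = m by apply/eqP; rewrite eqn_leq mi andbT ltn_ord.
  rewrite /= im modnn /H -SP -/P mulmxK//= invmx1 mulmx1.
  rewrite (_ : D 0%N = 1%:M) ?mul1mx//.
  by apply/matrixP => a b; rewrite !mxE expr0.
exists (fun i => H (val i)) => [i|i]; first by apply: HU; exact: (ltnW (ltn_ord i)).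
rewrite /gauge cmXK; apply: (can_inj (mulmxK (HU i (ltnW (ltn_ord i))))).
rewrite mulmxKV ?HU ?(ltnW (ltn_ord i))// HS.
have iE : iter i (@ordS m) i0 = i.
  by apply: val_inj; rewrite [LHS]iter_ordSE i00 add0n modn_small.
have cS : chain z i0 i.+1 = cmX z i *m chain z i0 i by rewrite /= iE.
have := cU i.+1 (ltn_ord i); rewrite cS unitmx_mul => /andP[XU ciU].
rewrite /H cS invmxM// !mulmxA mulmxKV//; congr (_ *m _ *m _).
rewrite mulmx_diag; congr diag_mx; apply/rowP => a.
by rewrite !mxE exprS.
Qed.

(** The gauge is fixed in stages. First [X] is made diagonal. The scalars [w X...X v] then determine
    the products of entries of [w] and [v] for each [j], so a diagonal gauge makes [v] and [w]
    agree. Finally the moment equation determines [Y] off the diagonal, and the traces determine its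
    diagonal. *)
Lemma invariants_separate lam y (x : @phase_level C m n lam) :
  \sum_r lam r != 0 -> cm_level lam y ->
  same_invariants y (cm_point lam (val x)) ->
  exists2 h : 'I_m -> 'M[C]_n, forall i, h i \in unitmx &
    gauge h y = cm_point lam (val x).
Proof.
move=> lam0 yL yx; set z := cm_point lam (val x) in yx *.
have [xreg /rowP xmom] := set_mem (valP x); have /hregP[nu0 nuN] := xreg.
have zL : cm_level lam z by apply: cm_point_level; exact: set_mem (valP x).
pose d := nu (val x); pose i0 : 'I_m := Ordinal m0.
have zX i : cmX z i = diag_mx (\row_j d j) by rewrite /z /cm_point cmXK.
have zv i j : cmv z i j ord0 = phi (val x) j i by rewrite /z /cm_point cmvK mxE.
have zw i j : cmw z i ord0 j = psi (val x) i j by rewrite /z /cm_point cmwK mxE.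
have [h1 u1 y1X] : exists2 h : 'I_m -> 'M[C]_n, forall i, h i \in unitmx &
    forall i, cmX (gauge h y) i = diag_mx (\row_j d j).
  apply: (diagonalizing_gauge (i0 := i0)) => // c.
  by rewrite (same_chain_charpoly yx) (chain_diag _ _ zX).
set y1 := gauge h1 y in y1X; have y1z := same_invariants_gauge u1 yx.
have pD j k : j != k -> d j ^+ m != d k ^+ m by move=> jk; rewrite -subr_eq0 nuN.
have wvE w i k : (forall i, cmX w i = diag_mx (\row_j d j)) ->
  (cmw w (iter k (@ordS m) i) *m chain w i k *m cmv w i) ord0 ord0
  = \sum_j d j ^+ k * (cmw w (iter k (@ordS m) i) ord0 j * cmv w i j ord0).
  move=> wX; rewrite (chain_diag _ _ wX) [LHS]mxE; apply: eq_bigr => j _.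
  by rewrite mul_mx_diag [X in X * _]mxE [X in _ * X * _]mxE; ring.
have wv a b j : cmw y1 a ord0 j * cmv y1 b j ord0 = psi (val x) a j * phi (val x) j b.
  (* A length of path from [b] to [a]; adding [r] full turns keeps the endpoints and multiplies the
     [j]-th term by the [r]-th power of [d_j^m]. *)
  pose k0 := (m - b + a)%N.
  have k0E r : iter (r * m + k0) (@ordS m) b = a.
    apply: val_inj; rewrite [LHS]iter_ordSE addnCA modnMDl /k0 addnA.
    by rewrite subnKC ?modnDl ?modn_small// ltnW.
  apply/eqP; rewrite -subr_eq0; apply/eqP/(mulfI (expf_neq0 k0 (nu0 j))); rewrite mulr0.
  apply: (power_sums_inj (p := fun j => d j ^+ m) (c := fun j => d j ^+ k0 *
    (cmw y1 a ord0 j * cmv y1 b j ord0 - psi (val x) a j * phi (val x) j b)) pD) => r.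
  have := same_chain_wv y1z b (r * m + k0); rewrite !wvE// k0E => /eqP.
  rewrite -subr_eq0 -sumrB => /eqP H; rewrite -[RHS]H; apply: eq_bigr => l _.
  by rewrite zw zv exprD mulnC exprM; ring.
have N0 j : \sum_i psi (val x) i j * phi (val x) j i != 0.
  have := xmom j; rewrite !mxE (eq_bigr (fun i => psi (val x) i j * phi (val x) j i)) => [->|i _].
    by rewrite oppr_eq0.
  by rewrite mulrC.
have r1 j := rank_one_eq (fun a b => wv a b j) (N0 j).
have [c cP] := choice (fun j => let: ex_intro2 c c0 cE := r1 j in ex_intro _ c (conj c0 cE)).
pose K : 'M[C]_n := diag_mx (\row_j (c j)^-1).
have KU : K \in unitmx.
  by rewrite unitmxE det_diag unitfE; apply/prodf_neq0 => j _; rewrite mxE invr_eq0 (cP j).1.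
have Kinv : invmx K = diag_mx (\row_j c j).
  apply: (can_inj (mulKmx KU)); rewrite mulmxV// mulmx_diag; apply/matrixP => a b.
  by rewrite !mxE mulVf ?(cP a).1.
have u2 : forall i : 'I_m, (fun=> K) i \in unitmx by [].
exists (fun i => K *m h1 i) => [i|]; first by rewrite unitmx_mul KU u1.
rewrite -(gaugeM _ u2 u1) -/y1; set y2 := gauge _ y1.
have y2z : same_invariants y2 z by exact: (same_invariants_gauge u2 y1z).
have y2L : cm_level lam y2 by apply: gauge_level => //; exact: gauge_level.
have y2X i : cmX y2 i = diag_mx (\row_j d j).
  by rewrite /y2 /gauge cmXK -/y1 y1X diag_mxC -mulmxA mulmxV// mulmx1.
have y2v i : cmv y2 i = cmv z i.
  apply/matrixP => j k; rewrite [k]ord1 zv /y2 /gauge cmvK -/y1 mul_diag_mx [LHS]mxE [X in X * _]mxE.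
  by have [cj [-> _]] := cP j; rewrite mulKf.
have y2w i : cmw y2 i = cmw z i.
  apply/matrixP => k j; rewrite [k]ord1 zw /y2 /gauge cmwK -/y1 Kinv mul_mx_diag [LHS]mxE [X in _ * X]mxE.
  by have [cj [_ ->]] := cP j; rewrite mulrAC mulVf// mul1r.
apply/eqP; rewrite -subr_eq0; apply/eqP.
have X0 i : cmX (y2 - z) i = 0 by rewrite cmXB y2X zX subrr.
have v0 i : cmv (y2 - z) i = 0 by rewrite cmvB y2v subrr.
have w0 i : cmw (y2 - z) i = 0 by rewrite cmwB y2w subrr.
apply: (cm_dmom_inj m0 nu0 nuN zX _ X0 _ v0 w0) => [i|j].
(* With [X], [v] and [w] equal, the difference of the two moment equations is linear in the
   difference of the [Y_i], hence is its linearised moment. *)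
- rewrite /cm_dmom !X0 v0 w0 !(mulmx0, mul0mx) !addr0 subr0 add0r !cmYB mulmxBl mulmxBr.
  have := y2L i; rewrite -(zL i) y2v y2w !y2X !zX => /eqP.
  rewrite -subr_eq0 => /eqP H; rewrite -[RHS]H.
  by apply/matrixP => a b; do ![rewrite [in LHS]mxE]; do ![rewrite [in RHS]mxE]; ring.
- apply: big1 => i _; rewrite cmYB [LHS]mxE [X in _ + X]mxE.
  have trE w r : (forall i, cmX w i = diag_mx (\row_j d j)) ->
    \tr (cmY w i *m chain w i (r * m).+1) = \sum_l d l ^+ (r * m).+1 * cmY w i l l.
    move=> wX; rewrite (chain_diag _ _ wX); apply: eq_bigr => l _.
    by rewrite mul_mx_diag [LHS]mxE [X in _ * X]mxE mulrC.
  apply: (mulfI (nu0 j)); rewrite mulr0.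
  apply: (power_sums_inj (p := fun j => d j ^+ m) (c := fun j => d j *
    (cmY y2 i j j - cmY z i j j)) pD) => r.
  have := same_chain_trY y2z i r; rewrite !trE// => /eqP.
  rewrite -subr_eq0 -sumrB => /eqP H; rewrite -[RHS]H; apply: eq_bigr => l _.
  by rewrite exprS mulnC exprM; ring.
Qed.

End Slice.

(** * Solution curves follow the flow on the Calogero-Moser space *)

Section ExtendedFlow.
Context {C : numClosedFieldType} (E : exponential C) {m n : nat}.
Variable lam : 'I_m -> C.
Hypothesis m0 : (0 < m)%N.
Hypothesis lam0 : \sum_r lam r != 0.

Lemma cm_flow_class k t (x : @phase_level C m n lam) (y : @cm_level C m n lam) :
  val y = flow E k t (cm_point lam (val x)) ->
  cm_flow E k t (cm_class x) = \pi_(cm_space lam) y.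
Proof.
move=> yE; have H := @orbit_flow_pi C _ (@cm_level C m n lam) (same_cm_equiv lam)
  (level_flow E k) (@level_flow_equiv C E m n lam k) t
  (level_point (cm_point_level (set_mem (valP x)))).
have -> : y = level_flow E k t (level_point (cm_point_level (set_mem (valP x)))).
  by apply: val_inj.
exact: H.
Qed.

(** The point [cm_point (g t)] flowed back by [t] has the same invariants as [cm_point (g 0)], hence
    is gauge equivalent to it; [flow_gauge] carries this equivalence forward to time [t]. *)
Lemma cm_flow_extends (zeta : C) (hz : m.-primitive_root zeta) k :
  extends_hamiltonian_flow hz (@hamiltonian C m n lam k) (cm_flow E k).
Proof.
move=> D g oD cD D0 gH t Dt; rewrite !cm_embeddingE.
have L0 := cm_point_level (set_mem (valP (g 0))).
have Lt := cm_point_level (set_mem (valP (g t))).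
have yL := flow_level E k (- t) Lt.
have [|h uh hE] := @invariants_separate _ m n m0 lam _ (g 0) lam0 yL.
  by move=> F Finv dF; exact: (invariant_along_flow E m0 lam0 Finv dF oD cD D0 gH Dt).
rewrite (cm_flow_class (y := level_point (flow_level E k t L0))) //.
apply/cm_eqP/asboolP; exists h => //=.
by rewrite -hE flow_gauge// -flowD addNr flow0.
Qed.

End ExtendedFlow.

Theorem proposition5p16 (R : realType) (m n : nat) (hm : (0 < m)%N)
    (hn : (0 < n)%N) (zeta : R[i]) (hzeta : m.-primitive_root zeta)
    (lam : 'I_m -> R[i]) (hlam : regular_weight lam) :
  completely_integrable (@phase_moment R[i] m n) (@phase_form R[i] m n)
    (fun k : 'I_(m * n) => @hamiltonian R[i] m n lam k.+1) /\
  forall k : nat, (0 < k)%N ->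
    exists Phi : R[i] -> @cm_space R[i] m n lam -> @cm_space R[i] m n lam,
      complete_flow Phi /\
      extends_hamiltonian_flow hzeta (@hamiltonian R[i] m n lam k) Phi.
Proof.
(* From here on the exponential enters only through the properties listed in the record
   [exponential]. *)
have [lam0 _] := hlam; have E := complex_exponential R; split.
  split; [|move=> k l|exact: (hamiltonians_independent (zeta := zeta) hm lam0 hzeta)].
    by move=> x; exact: (phase_reduced_dim x hm lam0).
  exact: (hamiltonians_commute E hm lam0 k.+1 l.+1).
move=> k _; exists (@cm_flow (complexField R) E m n lam k); split.
  exact: (@cm_flow_complete (complexField R) E m n lam k).
exact: (@cm_flow_extends (complexField R) E m n lam hm lam0 zeta hzeta k).
Qed.
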